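(* Let $d>2$, let $\Omega\subseteq\mathbb{R}^d$ be open, and let $2\le k\le d-1$ and $p\ge 1$ be integers/reals. Let $f\in W^{1,p}(\Omega,\mathbb{R}^d)$ and suppose that either $\det df>0$ a.e. in $\Omega$ or $\det df<0$ a.e. in $\Omega$. Suppose further that the a.e.-defined map $x\mapsto \bigwedge^k df_x$ has a smooth representative $\Omega\to\operatorname{End}(\bigwedge^k\mathbb{R}^d)$ which takes values in $\operatorname{GL}(\bigwedge^k\mathbb{R}^d)$ at every point. If $k$ and $d$ are not both even, then $f$ is smooth (i.e. $f$ has a $C^\infty$ representative). Moreover, if $k$ is odd, the assumption on the sign of $\det df$ can be omitted. *)

(* Defs.v *)
From HB Require Import structures.
From mathcomp Require Import all_boot all_order all_algebra.
From mathcomp Require Import all_classical all_reals all_analysis.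

Set Implicit Arguments.
Unset Strict Implicit.
Unset Printing Implicit Defensive.

Import Order.TTheory GRing.Theory Num.Theory.
Import numFieldNormedType.Exports.

Local Open Scope classical_set_scope.
Local Open Scope ring_scope.

Section Defs.
Variable R : realType.

Definition consrow n (t : R) (y : 'rV[R]_n) : 'rV[R]_n.+1 :=
  \row_i (if unlift ord0 i is Some j then y 0 j else t).

(* iterated Lebesgue integral over R^n (coordinate by coordinate).  For
   nonnegative Borel functions this is the integral w.r.t. the Lebesgue
   (product) measure on R^n, by Tonelli. *)
Fixpoint iint (n : nat) : ('rV[R]_n -> \bar R) -> \bar R :=
  match n return ('rV[R]_n -> \bar R) -> \bar R with
  | 0 => fun F => F 0
  | n'.+1 => fun F =>
      (\int[@lebesgue_measure R]_t iint (fun y : 'rV[R]_n' => F (consrow t y)))%E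
  end.

Definition Rint n (F : 'rV[R]_n -> R) : \bar R :=
  (iint (fun x => (Num.max (F x) 0)%:E) - iint (fun x => (Num.max (- F x) 0)%:E))%E.

Definition borel_set n (A : set 'rV[R]_n) : Prop :=
  <<s [set U : set 'rV[R]_n | open U] >> A.

Definition null_set n (N : set 'rV[R]_n) : Prop :=
  exists B, [/\ borel_set B, N `<=` B & iint (fun x => (\1_B x)%:E) = 0%E].

Definition ae_in n (Omega : set 'rV[R]_n) (P : 'rV[R]_n -> Prop) : Prop :=
  null_set [set x | Omega x /\ ~ P x].

Definition borel_on n (Omega : set 'rV[R]_n) (f : 'rV[R]_n -> R) : Prop :=
  forall B : set R, open B -> borel_set (Omega `&` f @^-1` B).

Definition Lp n (Omega : set 'rV[R]_n) (p : R) (f : 'rV[R]_n -> R) : Prop :=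
  borel_on Omega f /\
  (iint (fun x => (\1_Omega x * (`|f x| `^ p))%:E) < +oo)%E.

Definition basis_vec n (i : 'I_n) : 'rV[R]_n := delta_mx 0 i.

Definition pder n (i : 'I_n) (g : 'rV[R]_n -> R) : 'rV[R]_n -> R :=
  fun x => 'D_(basis_vec i) g x.

Fixpoint pders n (s : seq 'I_n) (g : 'rV[R]_n -> R) : 'rV[R]_n -> R :=
  match s with
  | [::] => g
  | i :: s' => pder i (pders s' g)
  end.

Definition smooth_on n (Omega : set 'rV[R]_n) (g : 'rV[R]_n -> R) : Prop :=
  forall s : seq 'I_n, forall x, Omega x ->
    (forall i, derivable (pders s g) x (basis_vec i)) /\
    {for x, continuous (pders s g)}.

Definition smooth_vec_on n m (Omega : set 'rV[R]_n) (g : 'rV[R]_n -> 'rV[R]_m) :=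
  forall j : 'I_m, smooth_on Omega (fun x => g x 0 j).
Definition smooth_mx_on n m (Omega : set 'rV[R]_n) (g : 'rV[R]_n -> 'M[R]_m) :=
  forall a b : 'I_m, smooth_on Omega (fun x => g x a b).

Definition test_fun n (Omega : set 'rV[R]_n) (phi : 'rV[R]_n -> R) : Prop :=
  smooth_on setT phi /\
  exists K, [/\ compact K, K `<=` Omega & forall x, ~ K x -> phi x = 0].

Definition weak_pder n (Omega : set 'rV[R]_n) (i : 'I_n) (f g : 'rV[R]_n -> R) :=
  forall phi, test_fun Omega phi ->
    Rint (fun x => f x * pder i phi x) = (- Rint (fun x => (g x * phi x)%R))%E.

Definition sobolev_W1p n m (Omega : set 'rV[R]_n) (p : R)
    (f : 'rV[R]_n -> 'rV[R]_m) (Df : 'rV[R]_n -> 'M[R]_(m, n)) : Prop :=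
  forall j : 'I_m,
    Lp Omega p (fun x => f x 0 j) /\
    forall i : 'I_n, Lp Omega p (fun x => Df x j i) /\
                     weak_pder Omega i (fun x => f x 0 j) (fun x => Df x j i).

(* k-element subsets of {0,..,d-1}: index set of the standard basis
   e_{i_1} /\ ... /\ e_{i_k} (i_1 < ... < i_k) of /\^k R^d *)
Definition ksubset (d k : nat) := {S : {set 'I_d} | #|S| == k}.

Definition ksub_enum d k (S : ksubset d k) : 'I_k -> 'I_d :=
  fun a => enum_val (A := val S) (cast_ord (esym (eqP (valP S))) a).

(* matrix of /\^k A in the basis above: entries are the k x k minors *)
Definition compound d k (A : 'M[R]_d) : 'M[R]_#|{: ksubset d k}| :=
  \matrix_(I, J) \det (mxsub (ksub_enum (enum_val I)) (ksub_enum (enum_val J)) A).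

End Defs.

(* Main.v *)
(** Algebra. By Cauchy-Binet the compound is multiplicative, so near a point x0 of Omega one may
    replace df_x by B = df_y^-1 df_x for a fixed generic y near x0; then C = compound k B is given by
    a function of x that is smooth and close to the identity. Let M be a (k+1)-block of B. Up to sign,
    the entries of its adjugate are entries of C, so adj M is a known smooth matrix close to 1. Since
    det (adj M) = (det M)^k, |det M| is the k-th root of det (adj M), and
    M = (det M / det (adj M)) adj (adj M). Hence the diagonal entries of M have the sign of det M;
    blocks overlap in diagonal entries, so a single sign s remains and B = s T with T smooth and close
    to 1. If k is odd, (det M)^k > 0 forces s = 1; if k is even and d is odd, the sign of
    det B = s^d det T does.

    Analysis. If G is the weak gradient of u on a ball, the mollifications F_m of u satisfy
    F_m (x + s e_i) - F_m x = the integral along the segment of the mollified G_i, as one sees by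
    testing the weak derivative against an antiderivative of the kernel. So F_m - F_m c converges to a
    primitive g of G, self-adjointness of mollification identifies u with g + const almost everywhere,
    and g is smooth because its partial derivatives G_i are. *)

Require Import Defs.
From HB Require Import structures.
From mathcomp Require Import all_boot all_order all_algebra.
From mathcomp Require Import fingroup perm.
From mathcomp Require Import all_classical all_reals all_analysis.
From mathcomp Require Import measurable_realfun ring lra.
Import Order.TTheory GRing.Theory Num.Theory.
Import numFieldNormedType.Exports.
Local Open Scope classical_set_scope.
Local Open Scope ring_scope.
Set Implicit Arguments.
Unset Strict Implicit.
Unset Printing Implicit Defensive.

(** * Compound matrices *)

Section Compound.
Variable R : realType.

(** Dividing by the value at a nearby point is forced by the recovery formula: the (k+1)-minors of
    df itself may vanish, and then neither the division nor the root is available, whereas near the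
    identity all the determinants involved stay close to 1. The base point cannot simply be x0,
    which may lie in the null set where the representative is unrelated to df. So the open
    conditions are imposed jointly on pairs near (x0, x0), and the base point is picked afterwards
    in the resulting ball, from a set of full measure.

    On the analytic side nothing is differentiated under an integral sign. A primitive of the kernel
    has no compact support, but its difference along a segment has, and this difference is the test
    function that yields an exact increment formula. The values F_m c need not converge a priori;
    their limit is extracted by pairing with one continuous cutoff of nonzero integral. Balls are
    sup-norm cubes, which suits tensor kernels, product measures and axis-parallel paths. *)

Lemma ksub_enum_inj d k (S : ksubset d k) : injective (ksub_enum S).
Proof. by move=> a b /enum_val_inj/cast_ord_inj. Qed.

Lemma ksub_enum_mem d k (S : ksubset d k) a : ksub_enum S a \in val S.
Proof. exact: enum_valP. Qed.

Lemma ksub_enum_surj d k (S : ksubset d k) i : i \in val S -> exists a, ksub_enum S a = i.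
Proof.
move=> iS; exists (cast_ord (eqP (valP S)) (enum_rank_in iS i)).
by rewrite /ksub_enum cast_ordK enum_rankK_in.
Qed.

(** Distributivity in the Leibniz formula: [h a] is the summation index chosen in row [a] of the
    matrix product. *)
Lemma det_mxsub_mul_ffun d k (f g : 'I_k -> 'I_d) (A B : 'M[R]_d) :
  \det (mxsub f g (A *m B)) =
  \sum_(h : {ffun 'I_k -> 'I_d}) (\prod_a A (f a) (h a)) * \det (mxsub h g B).
Proof.
rewrite /determinant.
transitivity (\sum_(s : 'S_k) \sum_(h : {ffun 'I_k -> 'I_d})
   (\prod_a A (f a) (h a)) * ((-1) ^+ s * \prod_a B (h a) (g (s a)))).
  apply: eq_bigr => s _; under eq_bigr do rewrite !mxE.
  rewrite bigA_distr_bigA mulr_sumr; apply: eq_bigr => h _ /=.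
  by rewrite big_split/= mulrCA.
rewrite exchange_big; apply: eq_bigr => h _; rewrite mulr_sumr.
apply: eq_bigr => s _; congr (_ * (_ * _)).
by apply: eq_bigr => a _; rewrite mxE.
Qed.

Lemma det_mxsub_noninj d k (h g : 'I_k -> 'I_d) (B : 'M[R]_d) :
  ~~ injectiveb h -> \det (mxsub h g B) = 0.
Proof.
move=> /injectivePn[a [b ab hab]].
by apply: (determinant_alternate ab) => c; rewrite !mxE hab.
Qed.

Lemma det_mxsub_perm d k (s : 'S_k) (e g : 'I_k -> 'I_d) (B : 'M[R]_d) :
  \det (mxsub (e \o s) g B) = (-1) ^+ s * \det (mxsub e g B).
Proof.
rewrite -det_perm -det_mulmx -row_permE; congr determinant.
by apply/matrixP => a b; rewrite !mxE.
Qed.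

(** Normal form of an injective map: a permutation followed by the enumeration of the image.
    Existence ([inj_ffun_perm]) and uniqueness ([ffun_perm_inj]) regroup the sum in Cauchy-Binet by
    image. *)
Definition ffun_perm d k (S : ksubset d k) (s : 'S_k) : {ffun 'I_k -> 'I_d} :=
  [ffun a => ksub_enum S (s a)].

Lemma inj_ffun_perm d k (h : {ffun 'I_k -> 'I_d}) : injective h ->
  exists (S : ksubset d k) s, h = ffun_perm S s.
Proof.
move=> hi; have hS : #|imset h (mem predT)| == k.
  by rewrite card_imset// card_ord.
pose S : ksubset d k := Sub (imset h (mem predT)) hS; exists S.
have hmem a : h a \in val S by exact: imset_f.
have hs a : exists b, ksub_enum S b == h a.
  by have [b <-] := ksub_enum_surj (hmem a); exists b.
pose r a := xchoose (hs a).
have rE a : ksub_enum S (r a) = h a := eqP (xchooseP (hs a)).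
have ri : injective r by move=> a b rab; apply: hi; rewrite -!rE rab.
by exists (perm ri); apply/ffunP => a; rewrite ffunE permE rE.
Qed.

Lemma ffun_perm_inj d k (S S' : ksubset d k) s s' :
  ffun_perm S s = ffun_perm S' s' -> S = S' /\ s = s'.
Proof.
move=> E; have Ea a : ksub_enum S (s a) = ksub_enum S' (s' a).
  by have /ffunP/(_ a) := E; rewrite !ffunE.
have SS' : S = S'.
  apply/val_inj/setP => i; apply/idP/idP => /ksub_enum_surj[a <-].
    by rewrite -[a](permKV s) Ea ksub_enum_mem.
  by rewrite -[a](permKV s') -Ea ksub_enum_mem.
split=> //; subst S'; apply/permP => a; exact: (ksub_enum_inj (Ea a)).
Qed.

Lemma sum_injective_ffun d k (F : {ffun 'I_k -> 'I_d} -> R) :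
  \sum_(h : {ffun 'I_k -> 'I_d} | injectiveb h) F h = \sum_(S : ksubset d k) \sum_(s : 'S_k) F (ffun_perm S s).
Proof.
rewrite pair_big/=.
(* The inverse [g] needs a default pair; if there is no pair at all, both sums are empty. *)
have [/existsP[[S0 s0] _]|/existsPn no] := boolP [exists p : ksubset d k * 'S_k, true]; last first.
  rewrite big1 => [|h /injectiveP/inj_ffun_perm[S [s _]]]; last by have := no (S, s).
  by rewrite big1// => -[S s]; have := no (S, s).
pose g (h : {ffun 'I_k -> 'I_d}) := odflt (S0, s0) [pick p : ksubset d k * 'S_k | h == ffun_perm p.1 p.2].
rewrite (reindex_onto (fun p : ksubset d k * 'S_k => ffun_perm p.1 p.2) g)/=; last first.
  move=> h /injectiveP/inj_ffun_perm[S [s ->]]; rewrite /g.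
  by case: pickP => [p /eqP <-//|/(_ (S, s))]; rewrite eqxx.
apply: eq_bigl => -[S s] /=; rewrite (_ : g _ = (S, s)) ?eqxx ?andbT.
  by apply/injectiveP => a b; rewrite !ffunE => /ksub_enum_inj/perm_inj.
rewrite /g; case: pickP => [[S' s'] /= /eqP/ffun_perm_inj[-> ->]//|/(_ (S, s))].
by rewrite eqxx.
Qed.

Lemma cauchy_binet d k (f g : 'I_k -> 'I_d) (A B : 'M[R]_d) :
  \det (mxsub f g (A *m B)) = \sum_(S : ksubset d k)
    \det (mxsub f (ksub_enum S) A) * \det (mxsub (ksub_enum S) g B).
Proof.
rewrite det_mxsub_mul_ffun (bigID (fun h : {ffun _} => injectiveb h))/= [X in _ + X]big1 ?addr0.
  rewrite sum_injective_ffun; apply: eq_bigr => S _.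
  rewrite [in RHS]/determinant mulr_suml; apply: eq_bigr => s _.
  rewrite (_ : mxsub (ffun_perm S s) g B = mxsub (ksub_enum S \o s) g B); last first.
    by apply/matrixP => a b; rewrite !mxE ffunE.
  rewrite det_mxsub_perm mulrA [_ * (-1) ^+ s]mulrC; congr (_ * _ * _).
  by apply: eq_bigr => a _; rewrite mxE ffunE.
by move=> h ih; rewrite det_mxsub_noninj ?mulr0.
Qed.

Lemma compoundM d k (A B : 'M[R]_d) : compound k (A *m B) = compound k A *m compound k B.
Proof.
apply/matrixP => I J; rewrite !mxE cauchy_binet (reindex (@enum_val _ predT))/=.
  by apply: eq_bigr => S _; rewrite !mxE.
by apply: onW_bij; exact: enum_val_bij.
Qed.

Lemma compound1 d k : compound k (1%:M : 'M[R]_d) = 1%:M.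
Proof.
apply/matrixP => I J; rewrite !mxE; have [->|IJ] := eqVneq I J.
  rewrite (_ : mxsub _ _ _ = 1%:M) ?det1//; apply/matrixP => a b.
  by rewrite !mxE (inj_eq (@ksub_enum_inj _ _ _)).
set S := enum_val I; set S' := enum_val J.
have SS' : val S != val S'.
  by apply: contra IJ => /eqP/val_inj/enum_val_inj ->.
(* Distinct sets of equal size: the first has an element outside the second, and its row in the
   minor of the identity is zero. *)
have [a aS'] : exists a, ksub_enum S a \notin val S'.
  apply/existsP; apply: contraR SS' => /existsPn SS'.
  have sub : val S \subset val S'.
    by apply/fintype.subsetP => i /ksub_enum_surj[a <-]; have := SS' a; rewrite negbK.
  by rewrite eqEcard sub (eqP (valP S)) (eqP (valP S')) /=.
rewrite (expand_det_row _ a) big1// => b _; rewrite !mxE.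
case: eqP => [E|]; last by rewrite mul0r.
by rewrite E ksub_enum_mem in aS'.
Qed.

Lemma exists_ksubset d k (i : 'I_d) : (0 < k <= d)%N -> exists S : ksubset d k, i \in val S.
Proof.
move=> /andP[k0 kd].
have d0 : (0 < d)%N by exact: leq_trans kd.
pose s := tperm (Ordinal d0) i.
pose S := imset (fun a => s (widen_ord kd a)) (mem predT).
have cS : #|S| == k.
  by rewrite card_imset ?card_ord// => a b /perm_inj/(congr1 val)/= /val_inj.
exists (Sub S cS); apply/imsetP; exists (Ordinal k0) => //.
by rewrite (_ : widen_ord _ _ = Ordinal d0) ?tpermL//; exact: val_inj.
Qed.

(* A singular A is left-equivalent to a matrix with a zero row, whose compound has a zero row too. *)
Lemma compound_unitmx d k (A : 'M[R]_d) : (0 < k <= d)%N ->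
  compound k A \in unitmx -> A \in unitmx.
Proof.
move=> kd cA; rewrite unitmxE unitfE; apply/negP => /det0P[v v0 vA].
have [i vi] : exists i, v 0 i != 0.
  by apply/existsP; apply: contraR v0 => /existsPn h; apply/eqP/rowP => i;
    rewrite mxE; apply/eqP; have := h i; rewrite negbK.
pose X : 'M[R]_d := \matrix_(a, b) (if a == i then v 0 b else (a == b)%:R).
have XU : X \in unitmx.
  rewrite unitmxE unitfE (_ : \det X = v 0 i)//.
  rewrite (expand_det_col X i) (bigD1 i)//= big1 ?addr0 => [|j ji]; last first.
    by rewrite mxE (negbTE ji) mul0r.
  rewrite mxE eqxx /cofactor -signr_odd oddD addbb mul1r.
  rewrite (_ : row' i (col' i X) = 1%:M) ?det1 ?mulr1//.
  apply/matrixP => a b; rewrite !mxE eq_sym (negbTE (neq_lift _ _)).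
  by rewrite (inj_eq (@lift_inj _ i)).
have XA j : (X *m A) i j = 0.
  transitivity ((v *m A) 0 j); last by rewrite vA mxE.
  by rewrite !mxE; apply: eq_bigr => c _; rewrite mxE eqxx.
have [S iS] := exists_ksubset i kd; have [a aS] := ksub_enum_surj iS.
have : compound k (X *m A) \in unitmx.
  rewrite compoundM unitmx_mul cA andbT.
  have : compound k X *m compound k (invmx X) = 1%:M.
    by rewrite -compoundM mulmxV// compound1.
  by case/mulmx1_unit.
rewrite unitmxE unitfE (expand_det_row _ (enum_rank S)) big1 ?eqxx// => J _.
rewrite mxE enum_rankK (expand_det_row _ a) big1 ?mul0r// => b _.
by rewrite mxE aS XA mul0r.
Qed.

(** Alternation in rows and columns: [c] is a product of two signs, or 0 if an index map repeats a
    value, in which case [S0] fills the index slots. The data are independent of [A], so adjugates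
    of blocks become linear in the compound. *)
Lemma minor_compound d k (f g : 'I_k -> 'I_d) : (0 < k <= d)%N ->
  exists c I J, forall A : 'M[R]_d, \det (mxsub f g A) = c * compound k A I J.
Proof.
move=> /andP[k0 kd]; have d0 : (0 < d)%N by exact: leq_trans kd.
have [S0 _] := @exists_ksubset d k (Ordinal d0) (introT andP (conj k0 kd)).
have [/injectiveP/inj_ffun_perm|fni] := boolP (injectiveb (finfun f)); last first.
  exists 0, (enum_rank S0), (enum_rank S0) => A; rewrite mul0r det_mxsub_noninj//.
  by apply: contra fni => /injectiveP fi; apply/injectiveP => a b; rewrite !ffunE => /fi.
move=> [S [s fS]].
have [/injectiveP/inj_ffun_perm|gni] := boolP (injectiveb (finfun g)); last first.
  exists 0, (enum_rank S0), (enum_rank S0) => A; rewrite mul0r -det_tr.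
  rewrite (_ : _^T = mxsub g f A^T); last by apply/matrixP => a b; rewrite !mxE.
  rewrite det_mxsub_noninj//.
  by apply: contra gni => /injectiveP fi; apply/injectiveP => a b; rewrite !ffunE => /fi.
move=> [S' [s' gS]]; exists ((-1) ^+ s * (-1) ^+ s'), (enum_rank S), (enum_rank S') => A.
have fE a : f a = ksub_enum S (s a) by have /ffunP/(_ a) := fS; rewrite !ffunE.
have gE a : g a = ksub_enum S' (s' a) by have /ffunP/(_ a) := gS; rewrite !ffunE.
rewrite (_ : mxsub f g A = mxsub (ksub_enum S \o s) g A); last first.
  by apply/matrixP => a b; rewrite !mxE fE.
rewrite det_mxsub_perm -mulrA; congr (_ * _).
rewrite -det_tr (_ : _^T = mxsub (ksub_enum S' \o s') (ksub_enum S) A^T); last first.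
  by apply/matrixP => a b; rewrite !mxE gE.
rewrite det_mxsub_perm mxE !enum_rankK; congr (_ * _); rewrite -det_tr; congr determinant.
by apply/matrixP => a b; rewrite !mxE.
Qed.

End Compound.

(** * Recovering a matrix from its compound *)

Section Recover.
Variable R : realType.

Lemma adjugate_compound d k (h : 'I_k.+1 -> 'I_d) : (0 < k <= d)%N ->
  exists (c : 'I_k.+1 -> 'I_k.+1 -> R) I J, forall (B : 'M[R]_d) a b,
    \adj (mxsub h h B) a b = c a b * compound k B (I a b) (J a b).
Proof.
move=> kd.
have H (ab : 'I_k.+1 * 'I_k.+1) : exists t : R * 'I_#|{: ksubset d k}| * 'I_#|{: ksubset d k}|,
    forall B : 'M[R]_d, \adj (mxsub h h B) ab.1 ab.2 = t.1.1 * compound k B t.1.2 t.2.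
  have [c [I [J cE]]] := minor_compound R (h \o lift ab.2) (h \o lift ab.1) kd.
  exists ((-1) ^+ (ab.2 + ab.1) * c, I, J) => B; rewrite mxE /cofactor -mulrA -cE/=.
  by congr (_ * \det _); apply/matrixP => a b; rewrite !mxE.
have [t tE] := fin_all_exists H.
by exists (fun a b => (t (a, b)).1.1), (fun a b => (t (a, b)).1.2), (fun a b => (t (a, b)).2) => B a b; exact: (tE (a, b)).
Qed.

Lemma adjugate1 n : \adj (1%:M : 'M[R]_n) = 1%:M.
Proof. by have := mul_mx_adj (1%:M : 'M[R]_n); rewrite mul1mx det1. Qed.

(** Taking determinants in M adj M = det M and cancelling [\det M]. If [\det M] were 0, then M adj M
    = 0 with adj M invertible would give M = 0, whose minors of positive order vanish, against
    [\det (\adj M) != 0]. *)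
Lemma det_adjugate k (M : 'M[R]_k.+1) : (0 < k)%N -> \det (\adj M) != 0 ->
  \det M ^+ k = \det (\adj M).
Proof.
move=> k0 dW; have E := congr1 determinant (mul_mx_adj M).
rewrite det_mulmx det_scalar exprS in E.
have [M0|M0] := eqVneq (\det M) 0; last exact/esym/(mulfI M0).
have M_0 : M = 0.
  have := congr1 (mulmx^~ (\adj (\adj M))) (mul_mx_adj M).
  rewrite -mulmxA mul_mx_adj M0 mul_mx_scalar mul_scalar_mx scale0r => /eqP.
  by rewrite scaler_eq0 (negbTE dW)/= => /eqP.
have W0 : \adj M = 0.
  apply/matrixP => a b; rewrite !mxE /cofactor M_0.
  rewrite (_ : row' _ _ = 0); last by apply/matrixP => i j; rewrite !mxE.
  by case: k k0 {M M0 M_0 dW E a b} => // k _ in a b *; rewrite det0 mulr0.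
by rewrite W0 det0 eqxx in dW.
Qed.

(** Multiply M adj M = det M on the right by adj (adj M). *)
Lemma adjugate_recover k (M : 'M[R]_k.+1) : \det (\adj M) != 0 ->
  M = (\det M / \det (\adj M)) *: \adj (\adj M).
Proof.
move=> dW; have := congr1 (mulmx^~ (\adj (\adj M))) (mul_mx_adj M).
rewrite -mulmxA mul_mx_adj mul_mx_scalar mul_scalar_mx => E.
by rewrite mulrC -scalerA -E scalerA mulVf// scale1r.
Qed.

Lemma powR_root k (t : R) : (0 < k)%N -> (`|t| ^+ k) `^ (k%:R^-1) = `|t|.
Proof.
move=> k0; rewrite -powR_mulrn// -powRrM mulfV ?powRr1//.
by rewrite pnatr_eq0 -lt0n.
Qed.

(* For each (i, j) the (k+1)-block used to read off the entry (i, j) has i at position 0 and j at position pos i j. *)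
Definition pos d k (i j : 'I_d) : 'I_k.+2 := if i == j then 0 else 1.

Lemma exists_block d k (i j : 'I_d) : (k.+2 <= d)%N ->
  exists h : 'I_k.+2 -> 'I_d, [/\ injective h, h 0 = i & h (pos k i j) = j].
Proof.
move=> kd; pose w := widen_ord kd; pose s1 := tperm (w 0) i.
have w_inj : injective w by move=> a b /(congr1 val)/= /val_inj.
rewrite /pos; have [->|ij] := eqVneq i j.
  exists (fun a => tperm (w 0) j (w a)); split; rewrite ?tpermL//.
  by move=> a b /perm_inj/w_inj.
(* The outer transposition sends the image of 1 to [j] and fixes [i], the image of 0, which differs
   from both points it exchanges. *)
exists (fun a => tperm (s1 (w 1)) j (s1 (w a))); split; rewrite ?tpermL//.
  by move=> a b /perm_inj/perm_inj/w_inj.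
have s10 : s1 (w 0) = i by rewrite /s1 tpermL.
rewrite tpermD// 1?eq_sym//.
by rewrite -s10 (inj_eq perm_inj) (inj_eq w_inj).
Qed.

(** The unsigned factor T: with [W i j C] the adjugate of a block M through (i, j), this is an entry
    of |det M| / det (adj M) times adj (adj M). Root and inverse are both real powers, so [C1k_powR]
    covers them together. *)
Definition recover d k N (W : 'I_d -> 'I_d -> 'M[R]_N -> 'M[R]_k.+2) (C : 'M[R]_N) : 'M[R]_d :=
  \matrix_(i, j) (\det (W i j C) `^ (k.+1%:R^-1) * \det (W i j C) `^ (-1)
                  * \adj (W i j C) 0 (pos k i j)).

Lemma recover1 d k N (W : 'I_d -> 'I_d -> 'M[R]_N -> 'M[R]_k.+2) (C : 'M[R]_N) :
  (forall i j, W i j C = 1%:M) -> recover W C = 1%:M.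
Proof.
move=> W1; apply/matrixP => i j; rewrite [LHS]mxE W1 det1 !powR1 !mul1r adjugate1 !mxE /pos.
by have [] := eqVneq i j.
Qed.

(** Minors have order k.+1 and blocks size k.+2. [W] is defined on every matrix, so it can be
    applied to the smooth representative even where that is not known to be a compound. The three
    positivity requirements are open conditions satisfied at the identity. *)
Lemma compound_recover d k : (k.+2 < d.+1)%N ->
  exists W : 'I_d -> 'I_d -> 'M[R]_#|{: ksubset d k.+1}| -> 'M[R]_k.+2,
  [/\ forall i j a b, exists c I J, forall C, W i j C a b = c * C I J,
      forall i j, W i j 1%:M = 1%:M &
      forall B : 'M[R]_d, let C := compound k.+1 B in
        (forall i j, 0 < \det (W i j C)) ->
        (forall i j a, 0 < \adj (W i j C) a a) ->
        0 < \det (recover W C) ->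
        odd k.+1 \/ (odd d /\ 0 < \det B) ->
        B = recover W C].
Proof.
rewrite ltnS => kd; have kd' : (0 < k.+1 <= d)%N by rewrite /= ltnW.
have [h hE] := choice (fun ij : 'I_d * 'I_d => exists_block ij.1 ij.2 kd).
have T ij : exists t : ('I_k.+2 -> 'I_k.+2 -> R) * ('I_k.+2 -> 'I_k.+2 -> 'I_#|{: ksubset d k.+1}|) * ('I_k.+2 -> 'I_k.+2 -> 'I_#|{: ksubset d k.+1}|),
   forall (B : 'M[R]_d) a b, \adj (mxsub (h ij) (h ij) B) a b
     = t.1.1 a b * compound k.+1 B (t.1.2 a b) (t.2 a b).
  by have [c [I [J cE]]] := adjugate_compound (h ij) kd'; exists (c, I, J).
have [t tE] := choice T.
pose W i j (C : 'M[R]_#|{: ksubset d k.+1}|) : 'M[R]_k.+2 := \matrix_(a, b)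
  ((t (i, j)).1.1 a b * C ((t (i, j)).1.2 a b) ((t (i, j)).2 a b)).
have WE i j (B : 'M[R]_d) : W i j (compound k.+1 B) = \adj (mxsub (h (i, j)) (h (i, j)) B).
  by apply/matrixP => a b; rewrite [LHS]mxE tE.
exists W; split.
- move=> i j a b; exists ((t (i, j)).1.1 a b), ((t (i, j)).1.2 a b), ((t (i, j)).2 a b).
  by move=> C; rewrite mxE.
- move=> i j; rewrite -(compound1 R d k.+1) WE -[RHS]adjugate1; congr adjugate.
  have [hi _ _] := hE (i, j).
  by apply/matrixP => a b; rewrite !mxE (inj_eq hi).
move=> B C dW aW dH sgnB.
pose M i j := mxsub (h (i, j)) (h (i, j)) B.
have WC i j : W i j C = \adj (M i j) := WE i j B.
have dW0 i j : \det (\adj (M i j)) != 0 by rewrite -WC gt_eqF.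
have Mk i j : \det (M i j) ^+ k.+1 = \det (W i j C) by rewrite WC det_adjugate.
have Mabs i j : `|\det (M i j)| = \det (W i j C) `^ (k.+1%:R^-1).
  by rewrite -(gtr0_norm (dW i j)) -Mk normrX powR_root.
have Mrec i j : M i j = (\det (M i j) / \det (W i j C)) *: \adj (W i j C).
  by rewrite WC; exact: adjugate_recover.
have Mdiag i j a : Num.sg (M i j a a) = Num.sg (\det (M i j)).
  by rewrite [in LHS]Mrec mxE sgrM [X in _ * X]gtr0_sg// mulr1 sgrM [X in _ * X]gtr0_sg ?invr_gt0// mulr1.
(* Positions 0 and [pos k i j] of the block carry [B i i] and [B j j]; both share the sign of its
   determinant. *)
have sgi i j : Num.sg (\det (M i j)) = Num.sg (B i i).
  by rewrite -(Mdiag i j 0) mxE; have [_ -> _] := hE (i, j).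
have sgj i j : Num.sg (\det (M i j)) = Num.sg (B j j).
  by rewrite -(Mdiag i j (pos k i j)) mxE; have [_ _ ->] := hE (i, j).
have d0 : (0 < d)%N by exact: leq_trans kd.
pose o := Ordinal d0; pose s := Num.sg (B o o).
(* The block of (o, i) contains [B o o] and [B i i], and so ties every sign to that of [B o o]. *)
have sE i j : Num.sg (\det (M i j)) = s by rewrite sgi -(sgj o i) sgi.
have B_s : B = s *: recover W C.
  apply/matrixP => i j; rewrite [RHS]mxE [recover _ _ i j]mxE.
  have := congr1 (fun X : 'M[R]_k.+2 => X 0 (pos k i j)) (Mrec i j).
  rewrite [LHS]mxE; have [_ -> ->] := hE (i, j) => ->; rewrite mxE.
  by rewrite {1}[\det (M i j)]numEsg sE Mabs powR_inv1 ?ltW// !mulrA.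
suff s1 : s = 1 by rewrite {1}B_s s1 scale1r.
have s3 : s \in [:: 0; 1; -1] by rewrite /s; case: sgrP; rewrite !inE eqxx ?orbT.
case: sgnB => [ok|[od dB]].
  have : 0 < \det (M o o) ^+ k.+1 by rewrite Mk.
  by rewrite exprn_odd_gt0// => /gtr0_sg <-.
have : 0 < \det B by [].
rewrite {1}B_s detZ pmulr_lgt0// exprn_odd_gt0//.
by move: s3; rewrite !inE => /or3P[] /eqP-> //; rewrite ?ltxx// oppr_gt0 ltr10.
Qed.
End Recover.

(** * Lebesgue measure on row vectors *)

(** A synonym of the row vectors carrying the Borel sigma-algebra; its measurable sets are
    convertible to [borel_set]. *)
Definition borelV (R : realType) n :=
  g_sigma_algebraType [set U : set 'rV[R]_n | open U].

Section RationalCubes.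
Variable R : realType.

(** Balls are for the sup norm, hence cubes; the index type of the rational ones is countable. *)
Definition ratball n (q : 'rV[rat]_n * rat) : set 'rV[R]_n :=
  ball (map_mx ratr q.1 : 'rV[R]_n) (ratr q.2 : R).

Lemma ratball_between n (x : 'rV[R]_n) (e : R) : 0 < e ->
  exists q, ratball q x /\ ratball q `<=` ball x e.
Proof.
move=> e0.
have [r /[!in_itv]/= /andP[r0 re]] : exists r, ratr r \in `]0, e / 2[%R.
  by apply: rat_in_itvoo; rewrite divr_gt0.
have qx i : exists q : rat, ratr q \in `](x 0 i - ratr r), (x 0 i + ratr r)[%R.
  by apply: rat_in_itvoo; rewrite ltrBlDr -addrA ltrDl addr_gt0.
pose c : 'rV[rat]_n := \row_i xchoose (qx i).
have bx : ball (map_mx ratr c : 'rV[R]_n) (ratr r : R) x.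
  split=> // i j; rewrite !mxE /ball/= ord1.
  have := xchooseP (qx j); rewrite in_itv/= => /andP[h1 h2].
  by rewrite ltr_norml; apply/andP; split; lra.
exists (c, r); split=> // y /= by_.
have /le_ball : ratr r + ratr r <= e by lra.
by apply; apply: ball_triangle by_; exact: ball_sym.
Qed.

Lemma open_bigcup_ratball n (U : set 'rV[R]_n) : open U ->
  U = \bigcup_(q in [set q | ratball q `<=` U]) ratball q.
Proof.
move=> oU; apply/seteqP; split=> [x Ux|x [q /= + qx]]; last exact.
have /nbhs_ballP[e /= e0 eU] : nbhs x U by exact: open_nbhs_nbhs.
have [q [qx qe]] := ratball_between x e0.
by exists q => //=; exact: subset_trans qe eU.
Qed.

End RationalCubes.

Section ProductMeasure.
Variable R : realType.

Lemma open_measurableV n (U : set 'rV[R]_n) : open U -> measurable (U : set (borelV R n)).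
Proof. by move=> oU; exact: sub_sigma_algebra. Qed.

Lemma ball_measurableV n (x : 'rV[R]_n) e : measurable (ball x e : set (borelV R n)).
Proof.
by apply: open_measurableV; exact: ball_open.
Qed.

(* The rational cubes form a countable base of the topology. *)
Lemma measurable_fun_rV d (T : measurableType d) n (f : T -> borelV R n) :
  (forall (x : 'rV[R]_n) e, measurable (f @^-1` ball x e)) ->
  measurable_fun setT f.
Proof.
move=> fb; apply: (@measurability _ _ T (borelV R n) setT f [set U : set 'rV[R]_n | open U]) => //.
move=> _ [U oU <-]; rewrite setTI (open_bigcup_ratball oU) preimage_bigcup.
rewrite bigcup_mkcond; apply: countable_bigcupT_measurable => [|q].
  exact: countableP.
by case: ifPn => _; [exact: fb|exact: measurable0].
Qed.

Definition consp n (z : measurableTypeR R * borelV R n) : borelV R n.+1 := consrow z.1 z.2.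

Lemma consrow0 n t (y : 'rV[R]_n) : consrow t y 0 ord0 = t.
Proof. by rewrite mxE unlift_none. Qed.

Lemma consrowS n t (y : 'rV[R]_n) j : consrow t y 0 (lift ord0 j) = y 0 j.
Proof. by rewrite mxE liftK. Qed.

(** Cubes are products of intervals; measurability of [consp] and the volume in [muV_ball] both come
    from this. *)
Lemma preimage_consp_ball n (x : 'rV[R]_n.+1) e : 0 < e ->
  @consp n @^-1` ball x e = (ball (x 0 ord0) e) `*`
    (ball (\row_j x 0 (lift ord0 j) : 'rV[R]_n) e).
Proof.
move=> e0; apply/seteqP; split=> [[t y]/= [_ h]|[t y]/= [h1 [_ h2]]].
  split; first by have := h 0 ord0; rewrite /consp consrow0.
  by split=> // i j; have := h 0 (lift ord0 j); rewrite /consp consrowS ord1 mxE.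
split=> // i j; rewrite ord1 /consp/=.
case: (unliftP ord0 j) => [k ->|->]; rewrite ?consrowS ?consrow0//.
by have := h2 0 k; rewrite mxE.
Qed.

Lemma measurable_consp n : measurable_fun setT (@consp n).
Proof.
apply: measurable_fun_rV => x e.
have [e0|e0] := ltP 0 e; last first.
  rewrite (_ : ball x e = set0) ?preimage_set0//.
  by apply/seteqP; split=> // y [] ; rewrite ltNge e0.
rewrite preimage_consp_ball//; apply: measurableX; last exact: ball_measurableV.
by apply: open_measurable; exact: ball_open.
Qed.

End ProductMeasure.

Section ConsMeasure.
Variables (R : realType).

Lemma continuous_measurable_rV n (f : 'rV[R]_n -> R) :
  continuous f -> measurable_fun setT (f : borelV R n -> R).
Proof.
move=> cf; apply: (measurability _ (@RGenOpens.measurableE R)) => _ [_ [a [b ->]] <-].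
rewrite setTI; apply: open_measurableV.
move/continuousP : cf; apply; exact: interval_open.
Qed.

Lemma measurable_coord n (j : 'I_n) : measurable_fun setT (fun x : borelV R n => x 0 j).
Proof. apply: continuous_measurable_rV; exact: coord_continuous. Qed.

Lemma measurable_coord_rV d (T : measurableType d) n (f : T -> borelV R n) :
  (forall j, measurable_fun setT (fun t => f t 0 j)) -> measurable_fun setT f.
Proof.
move=> mf; apply: measurable_fun_rV => x e.
have [e0|e0] := ltP 0 e; last first.
  rewrite (_ : ball x e = set0) ?preimage_set0//.
  by apply/seteqP; split=> // y [] ; rewrite ltNge e0.
rewrite (_ : _ @^-1` _ = \bigcap_(j in [set: 'I_n]) ((fun t => f t 0 j) @^-1` ball (x 0 j) e)).
  apply: fin_bigcap_measurable => // j _; rewrite -[X in measurable X]setTI.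
  by apply: mf => //; apply: open_measurable; exact: ball_open.
apply/seteqP; split=> t /=; first by move=> [_ h] j _; exact: h.
by move=> h; split=> // i j; rewrite ord1; exact: h.
Qed.

Definition uncons n (x : borelV R n.+1) : measurableTypeR R * borelV R n :=
  (x 0 ord0, \row_j x 0 (lift ord0 j)).

Lemma measurable_uncons n : measurable_fun setT (@uncons n).
Proof.
apply/measurable_fun_pairP; split; first exact: measurable_coord.
apply: measurable_coord_rV => j /=.
rewrite (_ : (fun _ => _) = (fun x : borelV R n.+1 => x 0 (lift ord0 j))).
  exact: measurable_coord.
by apply/funext => x; rewrite /= mxE.
Qed.

Lemma conspK n : cancel (@consp R n) (@uncons n).
Proof.
move=> [t y]; rewrite /uncons /consp/= consrow0; congr pair.
by apply/rowP => j; rewrite mxE consrowS.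
Qed.

Variable (n : nat) (m : {sigma_finite_measure set (borelV R n) -> \bar R}).

(** Counterpart for measures of one recursion step of [iint]: the product with Lebesgue measure,
    transported to rows with one more coordinate. *)
Definition cons_measure : set (borelV R n.+1) -> \bar R :=
  pushforward (@lebesgue_measure R \x m)%E (@consp R n).

HB.instance Definition _ := Measure.copy cons_measure
  (measure_function_pushforward__canonical__measure_function_Measure
     (@lebesgue_measure R \x m)%E (@measurable_consp R n)).

(** Rectangles [F k] x [G k] of two increasing exhaustions exhaust the product; pulling them back by
    [uncons] gives sets whose preimage under [consp] is again the rectangle. *)
Lemma cons_measure_sigma_finite : sigma_finite setT cons_measure.
Proof.
have /sigma_finiteP[F [TF ndF Foo]] := sigma_finiteT (@lebesgue_measure R).
have /sigma_finiteP[G [TG ndG Goo]] := sigma_finiteT m.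
exists (fun k => @uncons n @^-1` (F k `*` G k)).
  apply/esym; rewrite -subTset => z _.
  have /= [i _ Fi] : (\bigcup_i F i) (uncons z).1 by rewrite -TF.
  have /= [j _ Gj] : (\bigcup_i G i) (uncons z).2 by rewrite -TG.
  exists (maxn i j) => //; split.
  - by move: Fi; exact/subsetPset/ndF/leq_maxl.
  - by move: Gj; exact/subsetPset/ndG/leq_maxr.
move=> k; have [mF ?] := Foo k; have [mG ?] := Goo k; split.
  rewrite -[X in measurable X]setTI; apply: measurable_uncons => //.
  exact: measurableX.
rewrite /cons_measure /pushforward -comp_preimage.
rewrite (_ : _ \o _ = id); last by apply/funext => z; exact: conspK.
rewrite preimage_id; apply: (@le_lt_trans _ _ (@lebesgue_measure R (F k) * m (G k))%E).
  by rewrite product_measure1E.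
by rewrite lte_mul_pinfty// ge0_fin_numE.
Qed.

HB.instance Definition _ := Measure_isSigmaFinite.Build _ _ _ cons_measure cons_measure_sigma_finite.
Definition cons_sfm : {sigma_finite_measure set (borelV R n.+1) -> \bar R} := cons_measure.
End ConsMeasure.

Section Lebesgue.
Variable R : realType.
Local Notation leb := (@lebesgue_measure R).

(** Lebesgue measure on rows; R^0 is a point, hence the Dirac mass at the base. *)
Fixpoint muV n : {sigma_finite_measure set (borelV R n) -> \bar R} :=
  match n with
  | 0 => dirac (0 : borelV R 0)
  | n'.+1 => cons_sfm (muV n')
  end.

(** Tonelli, one coordinate at a time. This makes general integration theory applicable to the
    iterated integrals of the statement. *)
Lemma iintE n (F : 'rV[R]_n -> \bar R) :
  measurable_fun setT (F : borelV R n -> \bar R) -> (forall x, (0 <= F x)%E) ->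
  iint F = (\int[muV n]_x F x)%E.
Proof.
elim: n F => [|n IH] F mF F0 /=.
  by rewrite integral_dirac// diracE mem_set// mul1e.
have -> := @ge0_integral_pushforward _ _ _ _ R _ (@measurable_consp R n)
  (leb \x muV n)%E setT F measurableT mF (fun x _ => F0 x).
have mFc : measurable_fun setT (F \o @consp R n).
  by apply: measurableT_comp => //; exact: measurable_consp.
rewrite preimage_setT fubini_tonelli1//; last by move=> z; exact: F0.
apply: eq_integral => t _; rewrite IH//.
exact: (measurableT_comp mFc (pair1_measurable _)).
Qed.

Let shift (a : R) (t : measurableTypeR R) : measurableTypeR R := t + a.

Let measurable_shift a : measurable_fun setT (shift a).
Proof. exact: measurable_funD. Qed.

(** Uniqueness of the measure that gives half-open intervals their length. *)
Lemma lebesgue_measure_translate (a : R) (A : set R) : measurable A ->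
  pushforward leb (shift a) A = leb A.
Proof.
move=> mA; apply/esym.
apply: (@lebesgue_measure_unique _ (measure_function_pushforward__canonical__measure_function_Measure leb (measurable_shift a))) => //= _ [[b c]] _ <-.
rewrite /pushforward (_ : _ @^-1` _ = `]b - a, c - a]%classic); last first.
  by apply/seteqP; split=> t /=; rewrite !in_itv/= ltrBlDr lerBrDr.
rewrite !lebesgue_measure_itv/= !lte_fin ltrD2r.
by case: ifP => // _; rewrite -!EFinD opprB addrA subrK.
Qed.

Lemma ge0_integral_translate (a : R) (f : R -> \bar R) :
  measurable_fun setT f -> (forall t, (0 <= f t)%E) ->
  (\int[leb]_t f (t + a)%R = \int[leb]_t f t)%E.
Proof.
move=> mf f0.
transitivity (\int[pushforward leb (shift a)]_t f t)%E; last first.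
  by apply: eq_measure_integral => A mA _; exact: lebesgue_measure_translate.
have -> := @ge0_integral_pushforward _ _ _ _ R _ (measurable_shift a)
  leb setT f measurableT mf (fun x _ => f0 x).
by rewrite preimage_setT.
Qed.

Lemma iint_translate n (a : 'rV[R]_n) (F : 'rV[R]_n -> \bar R) :
  measurable_fun setT (F : borelV R n -> \bar R) -> (forall x, (0 <= F x)%E) ->
  iint (fun x => F (x + a)) = iint F.
Proof.
elim: n a F => [|n IH] a F mF F0 /=.
  by congr F; apply/rowP => -[].
have mFt t : measurable_fun setT (fun y : borelV R n => F (consrow t y)).
  exact: (measurableT_comp (measurableT_comp mF (@measurable_consp R n)) (pair1_measurable _)).
pose a' : 'rV[R]_n := \row_j a 0 (lift ord0 j).
have cD t y : consrow t y + a = consrow (t + a 0 ord0) (y + a').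
  apply/rowP => j; rewrite mxE; case: (unliftP ord0 j) => [k ->|->].
    by rewrite !consrowS !mxE.
  by rewrite !consrow0.
transitivity (\int[leb]_t iint (fun y => F (consrow (t + a 0 ord0)%R y)))%E.
  by apply: eq_integral => t _; under eq_fun do rewrite cD; exact: IH.
apply: (@ge0_integral_translate _ (fun t => iint (fun y : 'rV[R]_n => F (consrow t y)))); last first.
  by move=> t; rewrite iintE//; exact: integral_ge0.
rewrite (_ : (fun _ => _) = (fun t => \int[muV n]_y F (consp (t, y)))%E); last first.
  by apply/funext => t; rewrite iintE.
apply: (@measurable_fun_fubini_tonelli_F _ _ _ _ _ _ (F \o @consp R n)).
  by apply: measurableT_comp => //; exact: measurable_consp.
by move=> z; exact: F0.
Qed.

Lemma ge0_integral_translateV n (a : 'rV[R]_n) (F : 'rV[R]_n -> \bar R) :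
  measurable_fun setT (F : borelV R n -> \bar R) -> (forall x, (0 <= F x)%E) ->
  (\int[muV n]_x F (x + a)%R = \int[muV n]_x F x)%E.
Proof.
move=> mF F0; rewrite -!iintE//; first exact: iint_translate.
apply: (measurableT_comp mF); apply: measurable_coord_rV => j.
rewrite (_ : (fun _ => _) = (fun x : borelV R n => x 0 j + a 0 j)); last first.
  by apply/funext => x; rewrite mxE.
by apply: measurable_funD => //; exact: measurable_coord.
Qed.

Lemma muV_ball n (x : 'rV[R]_n) e : 0 < e -> muV n (ball x e) = (((e *+ 2) ^+ n)%:E).
Proof.
move=> e0; elim: n x => [|n IH] x.
  rewrite /= diracE mem_set//; split=> // i j; by case: j.
rewrite /= /cons_sfm /cons_measure /pushforward /= preimage_consp_ball//.
rewrite product_measure1E ?IH//=; last exact: ball_measurableV.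
  by rewrite lebesgue_measure_ball ?ltW// -EFinM exprS.
by apply: open_measurable; exact: ball_open.
Qed.

Lemma null_setE n (N : set 'rV[R]_n) : Defs.null_set N <-> negligible (muV n) (N : set (borelV R n)).
Proof.
have iB (B : set (borelV R n)) : measurable B -> iint (fun x => (\1_B x)%:E) = muV n B.
  move=> mB; rewrite iintE//; first by rewrite integral_indic// setIT.
    exact/measurable_EFinP/measurable_indic.
split=> [[B [mB NB B0]]|[B [mB B0 NB]]]; exists B; split=> //.
  by rewrite -iB.
by rewrite iB.
Qed.

End Lebesgue.

(** * Smooth functions *)

Section SmoothClass.
Variables (R : realType) (n : nat).
Implicit Types (Om : set 'rV[R]_n) (g h : 'rV[R]_n -> R).

(** Finite orders of smoothness, so that closure under products and composition can be proved by
    induction on the order. *)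
Fixpoint Ck k Om g : Prop :=
  (forall x, Om x -> {for x, continuous g}) /\
  match k with
  | 0 => True
  | k'.+1 => forall i, (forall x, Om x -> derivable g x (basis_vec R i)) /\ Ck k' Om (pder i g)
  end.

(** [pders] adds derivatives on the outside while [Ck] recurses on the innermost one; words are
    therefore decomposed from their last letter. *)
Lemma pders_rcons (s : seq 'I_n) i g : pders (rcons s i) g = pders s (pder i g).
Proof. by elim: s => //= j s ->. Qed.

Lemma smooth_on_pder Om g i : smooth_on Om g -> smooth_on Om (pder i g).
Proof. by move=> sg s x Ox; rewrite -pders_rcons; exact: sg. Qed.

Lemma smooth_onP Om g : smooth_on Om g <-> forall k, Ck k Om g.
Proof.
split=> [+ k|Cg s].
  elim: k g => [|k IH] g sg /=; first by split=> // x /(sg [::])[].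
  split=> [x /(sg [::])[]//|i]; split=> [x /(sg [::])[]//|].
  by apply: IH; exact: smooth_on_pder.
(* One order more than the length of the word, to get derivability of [pders s g] and not only its
   continuity. *)
have : Ck (size s).+1 Om g by exact: Cg.
elim/last_ind: s g {Cg} => [|s i IH] g /=.
  by move=> [cg dg] x Ox; split=> [i|]; [have [+ _] := dg i; exact|exact: cg].
rewrite size_rcons => -[_ /(_ i)[_ Cg]]; rewrite pders_rcons.
exact: IH.
Qed.

Lemma CkW k Om g : Ck k.+1 Om g -> Ck k Om g.
Proof.
elim: k g => [|k IH] g [cg dg]; first by split.
by split=> // i; have [dgi Cg] := dg i; split=> //; exact: IH.
Qed.

Lemma Ck_cont k Om g x : Ck k Om g -> Om x -> {for x, continuous g}.
Proof. by case: k => [|k] [+ _]; exact. Qed.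

Lemma Ck_eq k Om g h : open Om -> (forall x, Om x -> g x = h x) -> Ck k Om g -> Ck k Om h.
Proof.
move=> oO; elim: k g h => [|k IH] g h gh [cg dg].
all: have ngh x : Om x -> \forall y \near x, g y = h y
  by move=> Ox; apply: filterS (open_nbhs_nbhs (conj oO Ox)).
all: have ch : forall x, Om x -> {for x, continuous h}
  by move=> x Ox; move: (cg _ Ox); rewrite /prop_for /continuous_at (gh _ Ox) => ghx;
    exact: cvg_trans (near_eq_cvg (F := nbhs x) (ngh _ Ox)) ghx.
  by split.
split=> // i; have [dgi Cg] := dg i; split=> [x Ox|].
  exact: near_eq_derivable (ngh _ Ox) (dgi _ Ox).
apply: IH Cg => x Ox; exact: near_eq_derive (ngh _ Ox).
Qed.

Lemma Ck_cst k Om c : Ck k Om (cst c).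
Proof.
elim: k c => [|k IH] c; (split=> [x _|]; first exact: cst_continuous) => // i.
split=> [x _|]; first exact: derivable_cst.
rewrite (_ : pder i _ = cst 0) //; apply/funext => x; exact: derive_cst.
Qed.

Lemma Ck_add k Om g h : open Om -> Ck k Om g -> Ck k Om h -> Ck k Om (g + h).
Proof.
move=> oO; elim: k g h => [|k IH] g h [cg dg] [ch dh].
all: have cgh : forall x, Om x -> {for x, continuous (g + h)}
  by move=> x Ox; apply: continuousD; [exact: cg|exact: ch].
  by split.
split=> // i; have [dgi Cg] := dg i; have [dhi Ch] := dh i; split=> [x Ox|].
  by apply: derivableD; [exact: dgi|exact: dhi].
apply: (Ck_eq oO) (IH _ _ Cg Ch) => x Ox.
by rewrite /pder deriveD//; [exact: dgi|exact: dhi].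
Qed.

Lemma Ck_mul k Om g h : open Om -> Ck k Om g -> Ck k Om h -> Ck k Om (g * h).
Proof.
move=> oO; elim: k g h => [|k IH] g h Cg0 Ch0.
all: have cgh : forall x, Om x -> {for x, continuous (g * h)}
  by move=> x Ox; apply: continuousM; [exact: Ck_cont Cg0 Ox|exact: Ck_cont Ch0 Ox].
  by split.
have [cg dg] := Cg0; have [ch dh] := Ch0.
split=> // i; have [dgi Cg] := dg i; have [dhi Ch] := dh i; split=> [x Ox|].
  by apply: derivableM; [exact: dgi|exact: dhi].
apply: (Ck_eq oO) (Ck_add oO (IH _ _ (CkW Cg0) Ch) (IH _ _ (CkW Ch0) Cg)) => x Ox.
by rewrite /pder deriveM//; [exact: dgi|exact: dhi].
Qed.

Lemma Ck_coord k Om (j : 'I_n) : Ck k Om (fun x => x 0 j).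
Proof.
have D i (x : 'rV[R]_n) : is_derive x (basis_vec R i) (fun x => x 0 j) ((i == j)%:R).
  apply: DeriveDef.
    by apply: diff_derivable; exact: differentiable_coord.
  apply: cvg_lim => //.
  apply: (@cvg_trans _ (cst (i == j)%:R @ 0^')); last exact: cvg_cst.
  apply: near_eq_cvg; near=> h => /=.
  rewrite !mxE addrK eqxx eq_sym /= [_ *: _]mulrA mulVf ?mul1r//.
  by near: h; exact: nbhs_dnbhs_neq.
have c x : {for x, continuous (fun x : 'rV[R]_n => x 0 j)} by exact: coord_continuous.
case: k => [|k]; split=> // i; split=> [x _|]; first by case: (D i x).
rewrite (_ : pder i _ = cst (i == j)%:R); first exact: Ck_cst.
by apply/funext => x; exact: (@derive_val _ _ _ _ _ _ _ (D i x)).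
Unshelve. all: by end_near. Qed.

Fixpoint C1k k (D : set R) (psi : R -> R) : Prop :=
  match k with
  | 0 => forall t, D t -> {for t, continuous psi}
  | k'.+1 => (forall t, D t -> derivable psi t 1) /\ C1k k' D (derive1 psi)
  end.

Lemma C1k_cont k D psi t : C1k k D psi -> D t -> {for t, continuous psi}.
Proof.
case: k => [|k]; first exact.
by move=> [dp _] Dt; apply/differentiable_continuous/derivable1_diffP/dp.
Qed.

Lemma C1kW k D psi : C1k k.+1 D psi -> C1k k D psi.
Proof.
elim: k psi => [|k IH] psi; first by move=> C t; exact: C1k_cont C.
by move=> [d C]; split=> //; exact: IH.
Qed.

(** Only a directional derivative of [g] is available, not its differential, so the chain rule is
    applied to the restriction of [g] to a line. *)
Lemma is_derive_comp1 (psi : R -> R) g x v :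
  derivable g x v -> derivable psi (g x) 1 ->
  is_derive x v (psi \o g) ((derive1 psi) (g x) * 'D_v g x).
Proof.
move=> dg dp; have dg' := dg; have /derivable1P dl := dg.
pose l := fun t : R => g (t *: v + x).
have l0 : l 0 = g x by rewrite /l scale0r add0r.
have dp' : derivable psi (l 0) 1 by rewrite l0.
have dpl : derivable (psi \o l) 0 1.
  by move/derivable1_diffP in dl; move/derivable1_diffP in dp'; apply/derivable1_diffP; exact: differentiable_comp.
have Dl (f : 'rV[R]_n -> R) : 'D_v f x = derive1 (fun t => f (t *: v + x)) 0.
  rewrite derive1E /derive; set g1 := fun z : R => z^-1 *: _; set g2 := fun z : R => z^-1 *: _.
  suff -> : g1 = g2 by [].
  by rewrite funeqE /g1 /g2 => z /=; rewrite addr0 scale0r add0r [_%:A]mulr1.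
apply: DeriveDef; first by apply/derivable1P.
by rewrite (Dl (psi \o g)) (@derive1_comp R l psi 0 dl dp') l0 -Dl.
Qed.

Lemma Ck_comp k Om g D psi : open Om -> (forall x, Om x -> D (g x)) ->
  Ck k Om g -> C1k k D psi -> Ck k Om (psi \o g).
Proof.
move=> oO gD; elim: k g psi gD => [|k IH] g psi gD Cg0 Cp0.
all: have c : forall x, Om x -> {for x, continuous (psi \o g)}
  by move=> x Ox; apply: continuous_comp; [exact: Ck_cont Cg0 Ox|exact: C1k_cont Cp0 (gD _ Ox)].
  by split.
have [cg dg] := Cg0; have [dp Cp] := Cp0.
split=> // i; have [dgi Cg] := dg i.
have D' x (Ox : Om x) := is_derive_comp1 (dgi _ Ox) (dp _ (gD _ Ox)).
split=> [x Ox|]; first by case: (D' x Ox).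
apply: (Ck_eq oO) (Ck_mul oO (IH _ _ gD (CkW Cg0) Cp) Cg) => x Ox.
by rewrite [RHS](@derive_val _ _ _ _ _ _ _ (D' x Ox)).
Qed.

Lemma Ck_prod k Om (I : Type) (r : seq I) (P : pred I) (F : I -> 'rV[R]_n -> R) : open Om ->
  (forall i, Ck k Om (F i)) -> Ck k Om (fun x => \prod_(i <- r | P i) F i x).
Proof.
move=> oO CF; rewrite (_ : (fun x => _) = \prod_(i <- r | P i) F i); last first.
  by apply/funext => x; rewrite fct_prodE.
by elim/big_ind: _ => //; [exact: Ck_cst|move=> *; exact: Ck_mul].
Qed.

Lemma Ck_sub k Om Om' g : Om' `<=` Om -> Ck k Om g -> Ck k Om' g.
Proof.
move=> sub; elim: k g => [|k IH] g [cg dg]; split=> //; try by move=> x /sub; exact: cg.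
by move=> i; have [d C] := dg i; split; [move=> x /sub; exact: d|exact: IH].
Qed.

End SmoothClass.

(** * Smooth functions of one real variable and flat functions *)

Section OneVariable.
Variable R : realType.
Implicit Types p q : R -> R.

Lemma C1k_cst k (c : R) : C1k k setT (cst c).
Proof.
elim: k c => [|k IH] c /=; first by move=> t _; exact: cst_continuous.
split=> [t _|]; first exact: derivable_cst.
by rewrite (_ : derive1 _ = cst (0 : R))//; apply/funext => t; rewrite derive1_cst.
Qed.

Lemma C1k_id k : C1k k setT (@id R).
Proof.
case: k => [|k]; first by move=> t _; exact: cvg_id.
split=> [t _|]; first exact: derivable_id.
rewrite (_ : derive1 _ = cst (1 : R)); first exact: C1k_cst.
by apply/funext => t; rewrite derive1E derive_id.
Qed.

Lemma C1k_add k p q : C1k k setT p -> C1k k setT q -> C1k k setT (p + q).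
Proof.
elim: k p q => [|k IH] p q.
  by move=> cp cq t _; apply: continuousD; [exact: cp|exact: cq].
move=> [dp Cp] [dq Cq]; split=> [t _|]; first by apply: derivableD; [exact: dp|exact: dq].
rewrite (_ : derive1 _ = derive1 p + derive1 q); first exact: IH.
by apply/funext => t; rewrite derive1E deriveD ?derive1E//; [rewrite -!derive1E|exact: dp|exact: dq].
Qed.

Lemma C1k_mul k p q : C1k k setT p -> C1k k setT q -> C1k k setT (p * q).
Proof.
elim: k p q => [|k IH] p q.
  by move=> cp cq t _; apply: continuousM; [exact: cp|exact: cq].
move=> Cp0 Cq0; have [dp Cp] := Cp0; have [dq Cq] := Cq0.
split=> [t _|]; first by apply: derivableM; [exact: dp|exact: dq].
rewrite (_ : derive1 _ = p * derive1 q + q * derive1 p).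
  by apply: C1k_add; apply: IH => //; exact: C1kW.
by apply/funext => t; rewrite derive1E deriveM ?derive1E//; [rewrite -!derive1E|exact: dp|exact: dq].
Qed.

Lemma C1k_comp k p q : C1k k setT p -> C1k k setT q -> C1k k setT (p \o q).
Proof.
elim: k p q => [|k IH] p q.
  by move=> cp cq t _; apply: continuous_comp; [exact: cq|exact: cp].
move=> Cp0 Cq0; have [dp Cp] := Cp0; have [dq Cq] := Cq0.
split=> [t _|].
  have := dq t I; have := dp (q t) I => /derivable1_diffP d1 /derivable1_diffP d2.
  by apply/derivable1_diffP; exact: differentiable_comp.
rewrite (_ : derive1 _ = (derive1 p \o q) * derive1 q).
  by apply: C1k_mul => //; apply: IH => //; exact: C1kW.
by apply/funext => t; rewrite derive1_comp//; [exact: dq|exact: dp].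
Qed.

(* The functions t^-m exp(-1/t), extended by 0, form a family stable under differentiation up to linear combination. *)
Definition flat m (t : R) : R := if 0 < t then t^-1 ^+ m * expR (- t^-1) else 0.

Lemma flat_ge0 m t : 0 <= flat m t.
Proof.
by rewrite /flat; case: ifP => // t0; rewrite mulr_ge0 ?expR_ge0// exprn_ge0// invr_ge0 ltW.
Qed.

Lemma flat_le0 m t : t <= 0 -> flat m t = 0.
Proof. by rewrite /flat ltNge => ->. Qed.

(** From exp u >= u^(m+2) / (m+2)! at u = 1/t. A quadratic bound is what yields derivative 0 at the
    origin. *)
Lemma flat_le m t : flat m t <= m.+2`!%:R * t ^+ 2.
Proof.
rewrite /flat; case: ifPn => [t0|_]; last by rewrite mulr_ge0// sqr_ge0.
have u0 : 0 <= t^-1 by rewrite invr_ge0 ltW.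
have f0 : 0 < m.+2`!%:R :> R by rewrite ltr0n fact_gt0.
rewrite expRN ler_pdivrMr ?expR_gt0//.
have h : t^-1 ^+ m.+2 <= expR t^-1 * m.+2`!%:R.
  by rewrite -ler_pdivrMr//; apply: le_trans (expR_ge1Dxn m.+1 u0); rewrite lerDr.
have -> : t^-1 ^+ m = t ^+ 2 * t^-1 ^+ m.+2.
  by rewrite -[m.+2]addn2 exprD mulrCA -exprMn mulfV ?gt_eqF// expr1n mulr1.
rewrite [leRHS](_ : _ = t ^+ 2 * (expR t^-1 * m.+2`!%:R)); last by ring.
by apply: ler_wpM2l => //; exact: sqr_ge0.
Qed.

Lemma derivable0_quadratic p (C : R) : p 0 = 0 -> (forall t, `|p t| <= C * t ^+ 2) ->
  is_derive (0 : R) (1 : R) p 0.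
Proof.
move=> p0 pC.
have C0 : 0 <= C by have := le_trans (normr_ge0 _) (pC 1); rewrite expr1n mulr1.
have D : (fun h => h^-1 *: ((p \o shift 0) (h *: (1 : R)) - p 0)) @ 0^' --> (0 : R).
  apply/cvgrPdist_le => e e0; near=> h.
  have h0 : h != 0 by near: h; exact: nbhs_dnbhs_neq.
  rewrite /= p0 subr0 addr0 sub0r normrN [_%:A]mulr1 normrZ normfV.
  rewrite ler_pdivrMl ?normr_gt0//; apply: le_trans (pC h) _.
  rewrite -real_normK ?num_real// expr2 mulrA mulrC ler_wpM2l//.
  have hC : `|h| <= e / (C + 1).
    near: h; apply: dnbhs0_le; first by rewrite divr_gt0// ltr_wpDl.
  apply: (@le_trans _ _ ((C + 1) * `|h|)); first by rewrite ler_wpM2r// lerDl.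
  by rewrite -ler_pdivlMl ?ltr_wpDl// mulrC.
by split; [apply/cvg_ex; exists 0|exact: cvg_lim].
Unshelve. all: by end_near. Qed.

Lemma is_derive_flat m t : is_derive t (1 : R) (flat m) (flat m.+2 t - m%:R * flat m.+1 t).
Proof.
have [t0|t0|->] := ltgtP t 0.
- rewrite !flat_le0 ?ltW// mulr0 subr0; apply: (@near_eq_is_derive _ _ _ (cst (0 : R))).
    by near=> s; rewrite flat_le0// ltW//; near: s; exact: lt_nbhsl.
- apply: (@near_eq_is_derive R R R (fun s : R => s^-1 ^+ m * expR (- s^-1))).
    by near=> s; rewrite /flat ifT//; near: s; exact: lt_nbhsr.
  have tn0 : t != 0 by rewrite gt_eqF.
  have dV : is_derive t (1 : R) (fun s : R => s^-1) (- t^-1 ^+ 2).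
    apply: DeriveDef; first by apply: derivableV => //; exact: derivable_id.
    by rewrite deriveV ?derive_id// [LHS]mulr1 exprVn.
  have dE : is_derive t (1 : R) (fun s : R => expR (- s^-1)) (expR (- t^-1) * t^-1 ^+ 2).
    have dN : is_derive t (1 : R) (fun s : R => - s^-1) (t^-1 ^+ 2).
      by rewrite -[_ ^+ 2]opprK; exact: is_deriveN.
    exact: (@is_derive1_comp _ expR (fun s => - s^-1)).
  have dX : is_derive t (1 : R) ((fun s : R => s^-1) ^+ m) _ := is_deriveX m dV.
  have := is_deriveM dX dE.
  rewrite (_ : _ ^+ m * _ = (fun s => s^-1 ^+ m * expR (- s^-1))); last first.
    by apply/funext => s; rewrite /= [LHS]/GRing.mul/= exprfctE.
  move/is_derive_eq; apply; rewrite /flat t0 exprfctE.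
  rewrite /GRing.scale/= {dV dE dX}.
  case: m => [|m]; first by rewrite expr0; ring.
  rewrite /= !exprS; ring.
- rewrite !flat_le0 ?mulr0 ?subr0//; apply: (derivable0_quadratic (C := m.+2`!%:R)).
    by rewrite flat_le0.
  by move=> s; rewrite ger0_norm ?flat_ge0// flat_le.
Unshelve. all: by end_near. Qed.

Lemma C1k_flat k m : C1k k setT (flat m).
Proof.
elim: k m => [|k IH] m.
  move=> t _; apply/differentiable_continuous/derivable1_diffP.
  by case: (is_derive_flat m t).
split=> [t _|]; first by case: (is_derive_flat m t).
rewrite (_ : derive1 _ = flat m.+2 + cst (- m%:R) * flat m.+1).
  by apply: C1k_add => //; apply: C1k_mul => //; exact: C1k_cst.
apply/funext => t; rewrite derive1E (@derive_val _ _ _ _ _ _ _ (is_derive_flat m t)).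
by rewrite /= [in RHS]/GRing.add/= [in RHS]/GRing.mul/= mulNr.
Qed.

End OneVariable.

(** * One-variable mollifiers and their primitives *)

Section Mollifier.
Variable R : realType.
Local Notation leb := (@lebesgue_measure R).

Lemma flat0_ge (t : R) : 2^-1 <= t -> expR (- 2) <= flat 0 t.
Proof.
move=> t2; have t0 : 0 < t by apply: lt_le_trans t2; rewrite invr_gt0.
by rewrite /flat t0 expr0 mul1r ler_expR lerN2 invf_ple// posrE.
Qed.

Lemma flat0_le1 (t : R) : flat 0 t <= 1.
Proof.
rewrite /flat; case: ifPn => // t0.
by rewrite expr0 mul1r -expR0 ler_expR oppr_le0 invr_ge0 ltW.
Qed.

(** The normalised product of flat functions of 1 + t/e and 1 - t/e. Evenness will make
    mollification self-adjoint; the bound [K] gives the integrability needed for Fubini. *)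
Lemma exists_mollifier (e : R) : 0 < e -> exists rho : R -> R,
  [/\ forall k, C1k k setT rho, forall t, 0 <= rho t,
      forall t, e <= `|t| -> rho t = 0, forall t, rho (- t) = rho t
    & (\int[leb]_t (rho t)%:E = 1)%E /\ exists K, forall t, rho t <= K].
Proof.
move=> e0; pose b (t : R) := flat 0 (1 + e^-1 * t) * flat 0 (1 - e^-1 * t).
have Cb k : C1k k setT b.
  have Ca (c : R) : C1k k setT (fun t => flat 0 (1 + c * t)).
    rewrite (_ : (fun t => _) = flat 0 \o (cst 1 + cst c * id)) //.
    apply: C1k_comp; first exact: C1k_flat.
    by apply: C1k_add; [exact: C1k_cst|apply: C1k_mul; [exact: C1k_cst|exact: C1k_id]].
  rewrite (_ : b = (fun t => flat 0 (1 + e^-1 * t)) * (fun t => flat 0 (1 + (- e^-1) * t))).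
    exact: C1k_mul.
  by apply/funext => t; rewrite /b -mulNr.
have b_ge0 t : 0 <= b t by rewrite mulr_ge0 ?flat_ge0.
have b_out t : e <= `|t| -> b t = 0.
  rewrite ler_normr => /orP[te|te]; rewrite /b.
    by rewrite [X in _ * X]flat_le0 ?mulr0// subr_le0 mulrC ler_pdivlMr// mul1r.
  by rewrite flat_le0 ?mul0r// -[e^-1 * t]opprK subr_le0 -mulrN mulrC ler_pdivlMr// mul1r.
have b_even t : b (- t) = b t by rewrite /b mulrN opprK mulrC.
have mb : measurable_fun setT b.
  by apply: continuous_measurable_fun => t; exact: (Cb 0%N).
have mbE : measurable_fun setT (EFin \o b) by exact/measurable_EFinP.
pose I := (\int[leb]_t (b t)%:E)%E.
have I_lt : (I < +oo)%E.
  apply: (@le_lt_trans _ _ (\int[leb]_t (\1_(`[- e, e]%classic : set R) t)%:E)%E).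
    apply: ge0_le_integral => //.
    - by move=> t _; rewrite lee_fin.
    - exact/measurable_EFinP/measurable_indic.
    - move=> t _; rewrite lee_fin indicE; case: (boolP (t \in _)) => [_|].
        by rewrite -[leRHS]mulr1 ler_pM ?flat_ge0// flat0_le1.
      rewrite notin_setE/= in_itv/= -ler_norml => /negP; rewrite -ltNge => /ltW te.
      by rewrite b_out.
  rewrite integral_indic// setIT. rewrite /= lebesgue_measure_itv/= lte_fin gtrN//.
  by rewrite -EFinB ltry.
(* For |t| <= e/2 both arguments 1 + t/e and 1 - t/e are at least 1/2, so each factor is at least
   exp(-2). *)
have I_gt : (0 < I)%E.
  pose A : set R := `[- (e / 2), e / 2]%classic.
  have mA : measurable A by exact: measurable_itv.
  apply: (@lt_le_trans _ _ (\int[leb]_t (expR (- 2) ^+ 2 * \1_A t)%:E)%E).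
    under eq_integral do rewrite EFinM.
    rewrite (@ge0_integralZl _ _ _ leb setT measurableT (fun t => (\1_A t)%:E)); first last.
    - by rewrite lee_fin exprn_ge0 ?expR_ge0.
    - by move=> t _; rewrite lee_fin.
    - by apply/measurable_EFinP; exact: measurable_indic.
    rewrite integral_indic//= setIT lebesgue_measure_itv/= lte_fin gtrN ?divr_gt0//.
    by rewrite -EFinB -EFinM lte_fin mulr_gt0 ?exprn_gt0 ?expR_gt0// opprK addr_gt0 ?divr_gt0.
  apply: ge0_le_integral => //.
  - by apply/measurable_EFinP; apply: measurable_funM => //; exact: measurable_indic.
  - move=> t _; rewrite lee_fin indicE; case: (boolP (t \in _)); last by rewrite mulr0.
    rewrite mulr1 inE /A/= in_itv/= => /andP[t1 t2].
    have h : `|e^-1 * t| <= 2^-1.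
      rewrite normrM gtr0_norm ?invr_gt0// mulrC ler_pdivrMr// mulrC ler_norml.
      by rewrite t1 t2.
    move: h; rewrite ler_norml => /andP[h1 h2].
    by rewrite expr2 ler_pM ?expR_ge0// flat0_ge//; lra.
have If : I \is a fin_num by rewrite ge0_fin_numE// ltW.
have c0 : 0 < fine I by rewrite fine_gt0// I_gt.
exists (cst (fine I)^-1 * b); split.
- by move=> k; apply: C1k_mul => //; exact: C1k_cst.
- by move=> t; rewrite mulr_ge0// invr_ge0 ltW.
- by move=> t te; rewrite [LHS]/GRing.mul/= b_out// mulr0.
- by move=> t; rewrite [LHS]/GRing.mul/= b_even.
split; last first.
  exists (fine I)^-1 => t; rewrite -[leRHS]mulr1 ler_pM ?invr_ge0 ?(ltW c0)//.
  by rewrite -[leRHS]mulr1 ler_pM ?flat_ge0// flat0_le1.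
transitivity (\int[leb]_t ((fine I)^-1%:E * (b t)%:E))%E.
  by apply: eq_integral => t _; rewrite -EFinM.
rewrite ge0_integralZl//; last 2 first.
- by move=> t _; rewrite lee_fin.
- by rewrite lee_fin invr_ge0 ltW.
by rewrite -/I -{2}(fineK If) -EFinM mulVf// gt_eqF.
Qed.

Lemma exists_primitive (rho : R -> R) : continuous rho ->
  leb.-integrable setT (EFin \o rho) ->
  exists F : R -> R, (forall t, derivable F t 1) /\ derive1 F = rho.
Proof.
move=> cr ir; pose F x := (\int[leb]_(t in `]-oo, x]) rho t)%R.
have H x : derivable F x 1 /\ derive1 F x = rho x.
  apply: (@continuous_FTC1 R rho -oo%O x (x + 1)) => //.
  - by rewrite ltrDl.
  - exact: integrableS ir.
  - by rewrite /Order.lt/=.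
  - exact: cr.
by exists F; split=> [t|]; [exact: (H t).1|apply/funext => t; exact: (H t).2].
Qed.

Lemma Rintegral_derive1 (F f : R -> R) a b : a <= b -> continuous f ->
  (forall t, derivable F t 1) -> derive1 F = f ->
  (\int[leb]_(t in `[a, b]) (f t)%:E = (F b - F a)%:E)%E.
Proof.
move=> + cf dF F'; rewrite le_eqVlt => /predU1P[->|ab].
  by rewrite set_itv1 subrr; apply: integral_set1.
have cF x : {for x, continuous F} by exact/differentiable_continuous/derivable1_diffP.
rewrite (@continuous_FTC2 _ f F)//.
- by apply: continuous_subspaceT => t; exact: cf.
- split=> [t _||]; first exact: dF.
  + exact: cvg_at_right_filter (cF a).
  + exact: cvg_at_left_filter (cF b).
- by move=> t _; rewrite F'.
Qed.
End Mollifier.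

(** * Mollification *)

Section RealIntegrals.
Context d (T : measurableType d) (R : realType) (mu : {measure set T -> \bar R}).

Lemma integrable_mul_bounded (f h : T -> R) (M : R) :
  mu.-integrable setT (EFin \o f) -> measurable_fun setT h ->
  (forall x, `|h x| <= M) -> mu.-integrable setT (EFin \o (fun x => f x * h x)).
Proof.
move=> fi mh hM; have mf : measurable_fun setT f.
  by apply/measurable_EFinP; exact: measurable_int fi.
have M0 : 0 <= M by apply: le_trans (hM point); exact: normr_ge0.
apply: (@le_integrable _ _ _ mu setT _ _ (EFin \o (fun x => M * f x))) => //.
- by apply/measurable_EFinP; exact: measurable_funM.
- move=> x _ /=; rewrite lee_fin !normrM mulrC (ger0_norm M0).
  by rewrite ler_wpM2r.
- rewrite (_ : _ \o _ = (fun x => M%:E * (f x)%:E)%E); last by apply/funext.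
  exact: integrableZl.
Qed.

Lemma Rdominated_convergence D (f_ : nat -> T -> R) (f g : T -> R) :
  measurable D -> (forall n, measurable_fun D (f_ n)) ->
  measurable_fun D f ->
  (forall x, D x -> f_ n x @[n --> \oo] --> f x) ->
  mu.-integrable D (EFin \o g) ->
  (forall n x, D x -> `|f_ n x| <= g x) ->
  (\int[mu]_(x in D) f_ n x)%R @[n --> \oo] --> (\int[mu]_(x in D) f x)%R.
Proof.
move=> mD mf_ mf ff ig fg.
have [| | | | |if_ _ cI] := @dominated_convergence _ _ _ mu D mD (fun n => EFin \o f_ n) (EFin \o f) (EFin \o g).
- by move=> n; exact/measurable_EFinP.
- by apply/measurable_EFinP.
- by apply: aeW => x Dx; apply: cvg_EFin; [exact: nearW|exact: ff].
- exact: ig.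
- by apply: aeW => x n Dx /=; rewrite lee_fin; exact: fg.
apply: fine_cvg; rewrite fineK//; exact: integrable_fin_num.
Qed.

End RealIntegrals.

(** Every section is required to be integrable, so the inner extended integrals are finite
    everywhere and may be replaced by real ones. *)
Lemma RFubini d1 d2 (T1 : measurableType d1) (T2 : measurableType d2) (R : realType)
  (m1 : {sigma_finite_measure set T1 -> \bar R}) (m2 : {sigma_finite_measure set T2 -> \bar R})
  (f : T1 * T2 -> R) :
  (m1 \x m2)%E.-integrable setT (EFin \o f) ->
  (forall x, m2.-integrable setT (EFin \o (fun y => f (x, y)))) ->
  (forall y, m1.-integrable setT (EFin \o (fun x => f (x, y)))) ->
  \int[m1]_x (\int[m2]_y f (x, y)) = \int[m2]_y (\int[m1]_x f (x, y)).
Proof.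
move=> fi f1 f2; congr fine; transitivity (\int[m1]_x \int[m2]_y (EFin \o f) (x, y))%E.
  apply: eq_integral => x _; rewrite fineK//; exact: (integrable_fin_num _ (f1 x)).
rewrite Fubini//; apply: eq_integral => y _; rewrite /Rintegral fineK//.
exact: (integrable_fin_num _ (f2 y)).
Qed.

Lemma integrable_product d1 d2 (T1 : measurableType d1) (T2 : measurableType d2) (R : realType)
  (m1 : {sigma_finite_measure set T1 -> \bar R}) (m2 : {sigma_finite_measure set T2 -> \bar R})
  (f : T1 -> R) (g : T2 -> R) :
  m1.-integrable setT (EFin \o f) -> m2.-integrable setT (EFin \o g) ->
  (m1 \x m2)%E.-integrable setT (EFin \o (fun z => f z.1 * g z.2)).
Proof.
move=> fi gi.
have mf : measurable_fun setT f by apply/measurable_EFinP; exact: measurable_int fi.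
have mg : measurable_fun setT g by apply/measurable_EFinP; exact: measurable_int gi.
have mfg : measurable_fun setT (fun z : T1 * T2 => f z.1 * g z.2).
  by apply: measurable_funM; exact: measurableT_comp.
apply/integrable12ltyP; first exact/measurable_EFinP.
under eq_integral => x _.
  under eq_integral do rewrite /= normrM EFinM.
  rewrite ge0_integralZl//; last first.
    by apply/measurable_EFinP; exact: measurableT_comp.
  over.
have gI : (\int[m2]_y `|g y|%:E)%E \is a fin_num.
  rewrite ge0_fin_numE; first by case/integrableP : gi.
  by apply: integral_ge0 => y _; rewrite lee_fin.
rewrite -(fineK gI) ge0_integralZr//.
- rewrite fineK// lte_mul_pinfty//; first by apply: integral_ge0 => y _; rewrite lee_fin.
    rewrite ge0_fin_numE; first by case/integrableP : fi.
    by apply: integral_ge0 => y _; rewrite lee_fin.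
  by rewrite ltey_eq gI.
- by apply/measurable_EFinP; exact: measurableT_comp.
- by rewrite lee_fin fine_ge0// integral_ge0// => y _; rewrite lee_fin.
Qed.

Section Kernel.
Variables (R : realType).
Local Notation leb := (@lebesgue_measure R).
Implicit Types rho : R -> R.

Lemma RintE n (F : 'rV[R]_n -> R) :
  (muV R n).-integrable setT (EFin \o (F : borelV R n -> R)) ->
  Defs.Rint F = (\int[muV R n]_x F x)%R%:E.
Proof.
move=> Fi; have mF : measurable_fun setT (F : borelV R n -> R).
  by apply/measurable_EFinP; exact: measurable_int Fi.
have mFm (G : borelV R n -> R) : measurable_fun setT G ->
    measurable_fun setT (fun x => (Num.max (G x) 0)%:E).
  by move=> mG; apply/measurable_EFinP; apply: measurable_maxr => //; exact: measurable_cst.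
have mNF : measurable_fun setT (fun x : borelV R n => - F x) by exact: measurableT_comp.
have F0 (G : 'rV[R]_n -> R) x : (0 <= (Num.max (G x) 0)%:E)%E.
  by rewrite lee_fin le_max lexx orbT.
rewrite /Defs.Rint iintE//; last exact: mFm.
rewrite iintE; [|exact: mFm mNF|exact: (F0 (fun x => - F x))].
rewrite /Rintegral fineK ?(integrable_fin_num _ Fi)//.
rewrite [RHS]integralE; congr (_ - _)%E; apply: eq_integral => x _.
  by rewrite funeposE EFin_max.
by rewrite funenegE EFin_max EFinN.
Qed.

(** A tensor product of one-variable kernels, so that a primitive can be taken in a single
    coordinate. *)
Definition kern n (rho : R -> R) (z : 'rV[R]_n) : R := \prod_j rho (z 0 j).

Lemma kern_ge0 n rho (z : 'rV[R]_n) : (forall t, 0 <= rho t) -> 0 <= kern rho z.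
Proof. by move=> r0; apply: prodr_ge0. Qed.

Lemma kern_sym n rho (z : 'rV[R]_n) : (forall t, rho (- t) = rho t) -> kern rho (- z) = kern rho z.
Proof. by move=> re; apply: eq_bigr => j _; rewrite mxE re. Qed.

Lemma kern_out n rho e (x y : 'rV[R]_n) : 0 < e -> (forall t, e <= `|t| -> rho t = 0) ->
  ~ ball x e y -> kern rho (x - y) = 0.
Proof.
move=> e0 re nb; have [j jP] : exists j, e <= `|(x - y) 0 j|.
  apply: contrapT => h; apply: nb; split=> // i j; rewrite ord1.
  rewrite /ball/= ltNge; apply/negP => hj; apply: h; exists j.
  by rewrite !mxE.
by rewrite /kern (bigD1 j)//= re ?mul0r.
Qed.

Lemma kern_le n rho K (z : 'rV[R]_n) : (forall t, 0 <= rho t) -> (forall t, rho t <= K) ->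
  kern rho z <= K ^+ n.
Proof.
move=> r0 rK; rewrite -[n in leRHS]card_ord -prodr_const; apply: ler_prod => j _.
by rewrite r0 rK.
Qed.

Lemma measurable_kern n rho : measurable_fun setT rho ->
  measurable_fun setT (fun z : borelV R n => kern rho z).
Proof.
move=> mr; apply: measurable_prod => j _; apply: measurableT_comp => //.
exact: measurable_coord.
Qed.

Lemma integral_kern n rho : measurable_fun setT rho -> (forall t, 0 <= rho t) ->
  (\int[leb]_t (rho t)%:E = 1)%E ->
  (\int[muV R n]_z (kern rho z)%:E = 1)%E.
Proof.
move=> mr r0 r1.
have mk m : measurable_fun setT (fun z : borelV R m => (kern rho z)%:E).
  by apply/measurable_EFinP; exact: measurable_kern.
rewrite -iintE//; last by move=> z; rewrite lee_fin kern_ge0.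
elim: n => [|n IH] /=; first by rewrite /kern big_ord0.
rewrite -r1; apply: eq_integral => t _.
rewrite (_ : (fun y => _) = (fun y : 'rV[R]_n => (rho t)%:E * (kern rho y)%:E)%E); last first.
  apply/funext => y; rewrite -EFinM /kern big_ord_recl consrow0.
  by congr (_ * _)%:E; apply: eq_bigr => j _; rewrite consrowS.
rewrite iintE; last 2 first.
- by apply: emeasurable_funM => //; exact: mk.
- by move=> y; rewrite mule_ge0// lee_fin// kern_ge0.
rewrite ge0_integralZl//; last 2 first.
- by move=> y _; rewrite lee_fin kern_ge0.
- by rewrite lee_fin.
by rewrite -iintE// ?IH ?mule1// => z; rewrite lee_fin kern_ge0.
Qed.

Lemma measurable_translate n (x : 'rV[R]_n) :
  measurable_fun setT ((fun y : borelV R n => x - y) : borelV R n -> borelV R n).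
Proof.
apply: measurable_coord_rV => j.
rewrite (_ : (fun _ => _) = (fun y : borelV R n => x 0 j - y 0 j)); last first.
  by apply/funext => y; rewrite !mxE.
by apply: measurable_funB => //; exact: measurable_coord.
Qed.

Lemma integral_kern_translate n rho (x : 'rV[R]_n) : measurable_fun setT rho ->
  (forall t, 0 <= rho t) -> (forall t, rho (- t) = rho t) ->
  (\int[leb]_t (rho t)%:E = 1)%E ->
  (\int[muV R n]_y (kern rho (x - y)%R)%:E = 1)%E.
Proof.
move=> mr r0 re r1; rewrite -(@integral_kern n rho mr r0 r1).
rewrite -(@ge0_integral_translateV R n (- x) (fun y => (kern rho y)%:E)).
- by apply: eq_integral => y _; rewrite -kern_sym// opprB.
- by apply/measurable_EFinP; exact: measurable_kern.
- by move=> z; rewrite lee_fin kern_ge0.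
Qed.

(** The kernel has mass 1, so [phi x] can be moved under the integral; the kernel then restricts the
    difference to the ball of radius [e]. *)
Lemma kern_approx n rho e (phi : 'rV[R]_n -> R) (x : 'rV[R]_n) (eta M : R) : 0 < e ->
  measurable_fun setT rho ->
  (forall t, 0 <= rho t) -> (forall t, rho (- t) = rho t) ->
  (forall t, e <= `|t| -> rho t = 0) ->
  (\int[leb]_t (rho t)%:E = 1)%E ->
  measurable_fun setT (phi : borelV R n -> R) -> (forall y, `|phi y| <= M) ->
  (forall y, ball x e y -> `|phi y - phi x| <= eta) ->
  `|\int[muV R n]_y (phi y * kern rho (x - y)) - phi x| <= eta.
Proof.
move=> e0 mr r0 re rout r1 mphi phiM osc.
have mk : measurable_fun setT (fun y : borelV R n => kern rho (x - y)).
  exact: (measurableT_comp (measurable_kern mr) (measurable_translate x)).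
have k1 := integral_kern_translate x mr r0 re r1.
have ki : (muV R n).-integrable setT (EFin \o (fun y : borelV R n => kern rho (x - y))).
  apply/integrableP; split; first exact/measurable_EFinP.
  under eq_integral do rewrite /= ger0_norm ?kern_ge0//.
  by rewrite k1 ltry.
have Rk1 : \int[muV R n]_y kern rho (x - y) = 1 by rewrite /Rintegral k1.
have pki : (muV R n).-integrable setT (EFin \o (fun y : borelV R n => phi y * kern rho (x - y))).
  under [X in EFin \o X]eq_fun do rewrite mulrC.
  exact: integrable_mul_bounded ki mphi phiM.
rewrite -[X in _ - X]mulr1 -Rk1 -RintegralZl// -RintegralB//; last first.
  under [X in EFin \o X]eq_fun do rewrite mulrC.
  by apply: (integrable_mul_bounded ki) => [|y]; [exact: measurable_cst|exact: lexx].
apply: le_trans (le_normr_Rintegral _ _) _ => //.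
  apply: (eq_integrable _ (EFin \o (fun y : borelV R n => kern rho (x - y) * (phi y - phi x)))) => //.
    by move=> y _ /=; rewrite mulrC mulrBl.
  apply: (integrable_mul_bounded (M := M + M) ki) => [|y].
    by apply: measurable_funB.
  by apply: le_trans (ler_normB _ _) _; exact: lerD.
have eta0 : 0 <= eta by apply: le_trans (osc x _); [exact: normr_ge0|exact: ballxx].
rewrite -[leRHS]mulr1 -Rk1 -RintegralZl//; apply: le_Rintegral => //.
- apply: (eq_integrable _ (EFin \o (fun y : borelV R n => kern rho (x - y) * `|phi y - phi x|))) => //.
    by move=> y _ /=; rewrite -mulrBl normrM [`|kern _ _|]ger0_norm ?kern_ge0// mulrC.
  apply: (integrable_mul_bounded (M := M + M) ki) => [|y].
    by apply: measurableT_comp => //; exact: measurable_funB.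
  by rewrite normr_id; apply: le_trans (ler_normB _ _) _; exact: lerD.
- rewrite (_ : _ \o _ = (fun y => eta%:E * (kern rho (x - y))%:E)%E); last by apply/funext.
  exact: integrableZl.
move=> y _; rewrite -mulrBl normrM [`|kern _ _|]ger0_norm ?kern_ge0//.
have [by_|nby] := pselect (ball x e y); first by rewrite ler_wpM2r ?kern_ge0// osc.
by rewrite (kern_out e0 rout nby) !mulr0.
Qed.

End Kernel.

(** * From weak derivatives in L^p to identities between integrable functions *)

Section WeakIdentity.
Variables (R : realType) (n : nat).
Local Notation mu := (muV R n).
Implicit Types (Om V : set 'rV[R]_n) (u v g phi : 'rV[R]_n -> R).

Lemma Lp_measurable_restrict Om p u V : Lp Om p u -> V `<=` Om ->
  measurable (V : set (borelV R n)) ->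
  measurable_fun setT ((fun x => u x * \1_V x) : borelV R n -> R).
Proof.
move=> [bu _] VO mV.
have mu_ : measurable_fun (V : set (borelV R n)) (u : borelV R n -> R).
  apply: (measurability _ (@RGenOpens.measurableE R)) => _ [_ [a [b ->]] <-].
  have -> : V `&` u @^-1` `]a, b[%classic = V `&` (Om `&` u @^-1` `]a, b[%classic).
    by rewrite setIA (setIidl VO).
  by apply: measurableI => //; apply: bu; exact: interval_open.
rewrite (_ : (fun _ => _) = u \_ V).
  by apply/(measurable_restrictT _ mV).
apply/funext => x; rewrite patchE indicE; case: ifPn => _; rewrite ?mulr1 ?mulr0//.
Qed.

(** For p >= 1, |u| <= 1 + |u|^p, and the constant 1 is integrable on a set of finite measure. *)
Lemma Lp_integrable_restrict Om p u V : 1 <= p -> Lp Om p u -> V `<=` Om ->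
  measurable (Om : set (borelV R n)) ->
  measurable (V : set (borelV R n)) -> (mu V < +oo)%E ->
  mu.-integrable setT (EFin \o ((fun x => u x * \1_V x) : borelV R n -> R)).
Proof.
move=> p1 Lu VO mO mV Voo; have mu1 := Lp_measurable_restrict Lu VO mV.
have muO := Lp_measurable_restrict Lu (@subset_refl _ Om) mO.
have mP : measurable_fun setT (fun x : borelV R n => \1_Om x * (`|u x| `^ p)).
  rewrite (_ : (fun _ => _) = (fun x => \1_Om x * (`|u x * \1_Om x| `^ p))); last first.
    apply/funext => x; rewrite indicE; case: (x \in Om); by rewrite ?mulr1// !mul0r.
  apply: measurable_funM; first exact: measurable_indic.
  apply: (measurableT_comp (measurable_powR p)); exact: measurableT_comp.
case: Lu => _; rewrite iintE; [|exact/measurable_EFinP|]; last first.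
  by move=> x; rewrite lee_fin mulr_ge0// powR_ge0.
move=> Ioo; apply/integrableP; split; first exact/measurable_EFinP.
apply: (@le_lt_trans _ _ (\int[mu]_x ((\1_V x)%:E + (\1_Om x * (`|u x| `^ p))%:E))%E).
  apply: ge0_le_integral => //.
  - by apply: measurableT_comp => //; exact/measurable_EFinP.
  - apply: emeasurable_funD; last exact/measurable_EFinP.
    by apply/measurable_EFinP; exact: measurable_indic.
  - move=> x _; rewrite /= lee_fin !indicE.
    case: (boolP (x \in V)) => [xV|_]; last first.
      by rewrite mulr0 normr0 add0r mulr_ge0// powR_ge0.
    rewrite mulr1 mem_set ?mul1r; last by apply: VO; exact: set_mem.
    have [u1|u1] := leP `|u x| 1; first by apply: le_trans u1 _; rewrite lerDl powR_ge0.
    rewrite -[X in X <= _]powRr1//; apply: (@le_trans _ _ (`|u x| `^ p)); last by rewrite lerDr.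
    by apply: ler_powR => //; exact: ltW.
rewrite ge0_integralD//.
- by rewrite integral_indic// setIT lte_add_pinfty.
- by apply/measurable_EFinP; exact: measurable_indic.
- by apply/measurable_EFinP.
Qed.

Lemma compact_support_bounded phi K : compact K -> (forall x, ~ K x -> phi x = 0) ->
  continuous phi -> exists M, forall x, `|phi x| <= M.
Proof.
move=> cK out cphi.
have /compact_bounded[M [_ HM]] : compact (phi @` K).
  by apply: continuous_compact => //; exact: continuous_subspaceT.
exists (`|M| + 1) => x; have [Kx|nKx] := pselect (K x); last by rewrite out// normr0 addr_ge0.
by apply: HM; [rewrite ltr_pwDr// ler_norm|exists x].
Qed.

Lemma pder_out phi K i x : closed K -> (forall x, ~ K x -> phi x = 0) -> ~ K x -> pder i phi x = 0.
Proof.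
move=> cK out nKx; rewrite /pder -(derive_cst (0 : R) x (basis_vec R i)).
apply: near_eq_derive.
have : nbhs x (~` K) by apply: open_nbhs_nbhs; split=> //; exact: closed_openC.
by apply: filterS => y /out.
Qed.

(** The test function and its derivative vanish off a compact subset of [V], so truncation by the
    indicator of [V] changes neither integrand. All functions become globally integrable, and [v]
    can then be replaced by its almost everywhere equal [g]. *)
Lemma weak_identity Om p u v g V phi i : 1 <= p -> open Om -> open V -> V `<=` Om ->
  (mu V < +oo)%E -> Lp Om p u -> Lp Om p v -> weak_pder Om i u v ->
  ae_in V (fun x => v x = g x) ->
  measurable_fun setT ((fun x => g x * \1_V x) : borelV R n -> R) ->
  test_fun V phi ->
  \int[mu]_x ((u x * \1_V x) * pder i phi x) = - \int[mu]_x ((g x * \1_V x) * phi x).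
Proof.
move=> p1 oO oV VO Voo Lu Lv uv vg mg [sphi [K [cK KV out]]].
have mO := open_measurableV oO; have mV := open_measurableV oV.
have Ksep : closed K by apply: compact_closed => //; exact: norm_hausdorff.
have cphi : continuous phi by move=> x; case: (sphi [::] x I).
have cdphi : continuous (pder i phi) by move=> x; case: (sphi [:: i] x I).
have dout x : ~ K x -> pder i phi x = 0 by exact: pder_out.
have [M phiM] := compact_support_bounded cK out cphi.
have [M' dphiM] := compact_support_bounded cK dout cdphi.
have onV w psi x : (forall x, ~ K x -> psi x = 0) -> w x * psi x = (w x * \1_V x) * psi x :> R.
  move=> po; rewrite indicE; case: (boolP (x \in V)) => [_|]; first by rewrite mulr1.
  by rewrite notin_setE => nV; rewrite po ?mulr0// => /KV.
have iu := integrable_mul_bounded (Lp_integrable_restrict p1 Lu VO mO mV Voo)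
  (continuous_measurable_rV cdphi) dphiM.
have iv := integrable_mul_bounded (Lp_integrable_restrict p1 Lv VO mO mV Voo)
  (continuous_measurable_rV cphi) phiM.
have := uv phi (conj sphi (ex_intro _ K (And3 cK (subset_trans KV VO) out))).
rewrite (_ : (fun x => u x * pder i phi x) = (fun x => (u x * \1_V x) * pder i phi x)); last first.
  by apply/funext => x; exact: onV.
rewrite (_ : (fun x => v x * phi x) = (fun x => (v x * \1_V x) * phi x)); last first.
  by apply/funext => x; exact: onV.
rewrite !RintE// -EFinN => -[->]; congr (- _); congr fine; apply: ae_eq_integral => //.
- exact: measurable_int iv.
- apply/measurable_EFinP/measurable_funM => //; exact: continuous_measurable_rV.
- move/null_setE : vg => [N [mN N0 sN]]; exists N; split => // x /= H.
  apply: sN => /=; split.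
    by apply: contrapT => nV; apply: H => _; rewrite indicE memNset// !mulr0.
  by move=> e; apply: H => _; rewrite e.
Qed.

End WeakIdentity.

(** * Increments of mollifications along coordinate directions *)

Section Increment.
Variables (R : realType) (n : nat).
Local Notation mu := (muV R n).
Local Notation leb := (@lebesgue_measure R).
Implicit Types (rho P : R -> R) (i : 'I_n) (x y : 'rV[R]_n) (s : R).

Lemma pder_line (i : 'I_n) (f : 'rV[R]_n -> R) (x : 'rV[R]_n) :
  pder i f x = derive1 (fun t : R => f (t *: basis_vec R i + x)) 0.
Proof.
rewrite /pder derive1E /derive; set g1 := fun z : R => z^-1 *: _; set g2 := fun z : R => z^-1 *: _.
suff -> : g1 = g2 by [].
by rewrite funeqE /g1 /g2 => z /=; rewrite addr0 scale0r add0r [_%:A]mulr1.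
Qed.

Definition kern_off rho (i : 'I_n) (z : 'rV[R]_n) : R := \prod_(j | j != i) rho (z 0 j).

Lemma shift_coord (x : 'rV[R]_n) (i j : 'I_n) (t : R) :
  (x + t *: basis_vec R i) 0 j = x 0 j + (if j == i then t else 0).
Proof. by rewrite !mxE eqxx /=; case: eqP => _; rewrite ?mulr1 ?mulr0. Qed.

Lemma kern_shift rho (i : 'I_n) (x y : 'rV[R]_n) (t : R) :
  kern rho (x + t *: basis_vec R i - y) = kern_off rho i (x - y) * rho (x 0 i - y 0 i + t).
Proof.
rewrite /kern (bigD1 i)//= mulrC; congr (_ * _).
  apply: eq_bigr => j ji; congr rho.
  by rewrite [LHS]mxE shift_coord (negbTE ji) addr0 [RHS]mxE.
by congr rho; rewrite mxE shift_coord eqxx mxE addrAC.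
Qed.

Lemma measurable_kern_line rho (i : 'I_n) (x : 'rV[R]_n) : measurable_fun setT rho ->
  measurable_fun setT (fun z : measurableTypeR R * borelV R n => kern rho (x + z.1 *: basis_vec R i - z.2)).
Proof.
move=> mr.
have H : measurable_fun setT ((fun z => x + z.1 *: basis_vec R i - z.2) : measurableTypeR R * borelV R n -> borelV R n).
  apply: measurable_coord_rV => j.
  rewrite (_ : (fun _ => _) = (fun z : measurableTypeR R * borelV R n =>
     (x 0 j + (if j == i then z.1 else 0)) - z.2 0 j)); last first.
    by apply/funext => z; rewrite [LHS]mxE shift_coord mxE.
  apply: measurable_funB; last exact: (measurableT_comp (@measurable_coord R n j) measurable_snd).
  apply: measurable_funD; first exact: measurable_cst.
  by case: (j == i); [exact: measurable_fst|exact: measurable_cst].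
exact: (measurableT_comp (measurable_kern mr) H).
Qed.

(** The integral of the kernel along the segment from [x] to x + s e_i (see [bump_lineE]), as a
    function of [y]. Written with a primitive [P] of [rho] it is visibly smooth, and the two values
    of [P] cancel far from the segment. *)
Definition bump_line rho (P : R -> R) (i : 'I_n) (x : 'rV[R]_n) (s : R) (y : 'rV[R]_n) : R :=
  kern_off rho i (x - y) * (P (x 0 i - y 0 i + s) - P (x 0 i - y 0 i)).

Lemma bump_line_smooth rho P i x s : (forall k, C1k k setT rho) ->
  (forall t, derivable P t 1) -> derive1 P = rho -> smooth_on setT (bump_line rho P i x s).
Proof.
move=> Cr dP P'; apply/smooth_onP => k.
have CP m : C1k m setT P.
  case: m => [|m]; first by move=> t _; exact/differentiable_continuous/derivable1_diffP.
  by split=> [t _|]; [exact: dP|rewrite P'].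
have Cc (a : R) (j : 'I_n) : Ck k setT (fun y : 'rV[R]_n => a - y 0 j).
  rewrite (_ : (fun _ => _) = cst a + (cst (-1) * (fun y : 'rV[R]_n => y 0 j))); last first.
    by apply/funext => y; rewrite [RHS]/GRing.add/= [X in _ = _ + X]/GRing.mul/= mulN1r.
  apply: Ck_add; [exact: openT|exact: Ck_cst|].
  by apply: Ck_mul; [exact: openT|exact: Ck_cst|exact: Ck_coord].
have Cx (f : R -> R) (a : R) (j : 'I_n) : C1k k setT f -> Ck k setT (fun y : 'rV[R]_n => f (a - y 0 j)).
  by move=> Cf; apply: (@Ck_comp _ _ _ _ (fun y : 'rV[R]_n => a - y 0 j) setT f) => //; exact: openT.
rewrite (_ : bump_line _ _ _ _ _ = (fun y => \prod_(j | j != i) rho (x 0 j - y 0 j)) *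
  ((fun y : 'rV[R]_n => P ((x 0 i + s) - y 0 i)) + cst (-1) * (fun y : 'rV[R]_n => P (x 0 i - y 0 i)))).
  apply: Ck_mul; first exact: openT.
    by apply: Ck_prod => [|j]; [exact: openT|exact: Cx].
  apply: Ck_add; [exact: openT|exact: Cx|].
  by apply: Ck_mul; [exact: openT|exact: Ck_cst|exact: Cx].
apply/funext => y; rewrite /bump_line [RHS]/GRing.mul/= [X in _ = _ * X]/GRing.add/=.
rewrite [X in _ = _ * (_ + X)]/GRing.mul/= mulN1r addrAC; congr (_ * _).
by apply: eq_bigr => j _; rewrite !mxE.
Qed.

(** Since [P] is differentiated back to [rho], two kernels remain: testing the weak derivative
    against [bump_line] produces the increment of the mollification. *)
Lemma bump_line_pder rho P i x s y : (forall t, derivable P t 1) -> derive1 P = rho ->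
  pder i (bump_line rho P i x s) y = - (kern rho (x + s *: basis_vec R i - y) - kern rho (x - y)).
Proof.
move=> dP P'; rewrite -[x in X in _ - X]addr0 -(scale0r (basis_vec R i)) !kern_shift addr0 -mulrBr.
rewrite pder_line.
rewrite (_ : (fun t => _) = (fun t => kern_off rho i (x - y) *
    (P (x 0 i - y 0 i + s - t) - P (x 0 i - y 0 i - t)))); last first.
  apply/funext => t; rewrite /bump_line [t *: _ + y]addrC shift_coord eqxx; congr (_ * _).
    by apply: eq_bigr => j ji; congr rho; rewrite [LHS]mxE mxE shift_coord (negbTE ji) addr0 [RHS]mxE mxE.
  by congr (P _ - P _); lra.
have D a : is_derive (0 : R) (1 : R) (fun t => P (a - t)) (- rho a).
  have dl : is_derive (0 : R) (1 : R) (fun t => a - t) (- 1).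
    by have := is_deriveB (is_derive_cst a (0 : R) (1 : R)) (is_derive_id (0 : R) (1 : R)); rewrite sub0r.
  have dPa : is_derive (a - 0) (1 : R) P (rho (a - 0)).
    by apply: DeriveDef => //; rewrite -derive1E P'.
  have := @is_derive1_comp _ P (fun t => a - t) 0 _ _ dPa dl.
  by rewrite subr0 mulrN1.
have H := is_deriveB (D (x 0 i - y 0 i + s)) (D (x 0 i - y 0 i)).
have := is_deriveZ (kern_off rho i (x - y)) H.
rewrite derive1E => /(@derive_val _ _ _ _ _ _ _) E.
rewrite [LHS](_ : _ = kern_off rho i (x - y) *: (- rho (x 0 i - y 0 i + s) - - rho (x 0 i - y 0 i))); last exact: E.
by rewrite /GRing.scale/= -mulrN; congr (_ * _); lra.
Qed.

Lemma bump_lineE rho P i x s y : 0 <= s -> continuous rho ->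
  (forall t, derivable P t 1) -> derive1 P = rho ->
  bump_line rho P i x s y = \int[leb]_(t in `[0, s]) kern rho (x + t *: basis_vec R i - y).
Proof.
move=> s0 cr dP P'; rewrite /bump_line; set a := x 0 i - y 0 i.
under eq_Rintegral do rewrite kern_shift -/a.
have da : forall t, derivable (fun t => P (a + t)) t 1.
  by move=> t; apply/derivable1_diffP; apply: differentiable_comp => //; exact/derivable1_diffP.
have cra : continuous (fun t => rho (a + t)).
  move=> t; apply: continuous_comp; last exact: cr.
  by apply: continuousD; [exact: cst_continuous|exact: cvg_id].
have Pa : derive1 (fun t => P (a + t)) = (fun t => rho (a + t)).
  apply/funext => t; have dl : is_derive t (1 : R) (fun t => a + t) 1.
    by rewrite -[1 in X in is_derive _ _ _ X]add0r; apply: is_deriveD.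
  have dPa : is_derive (a + t) (1 : R) P (rho (a + t)).
    by apply: DeriveDef => //; rewrite -derive1E P'.
  have := @is_derive1_comp _ P (fun t => a + t) t _ _ dPa dl.
  by rewrite mulr1 derive1E => /(@derive_val _ _ _ _ _ _ _).
have I := Rintegral_derive1 s0 cra da Pa.
have Ii : leb.-integrable `[0, s] (EFin \o (fun t => rho (a + t))).
  apply: continuous_compact_integrable; first exact: segment_compact.
  exact: continuous_subspaceT.
by rewrite RintegralZl// /Rintegral I addr0.
Qed.

(** Test against [bump_line], then exchange the integrals over the segment and over the space. The
    last hypothesis says that the box of width [e] around the segment, which contains the support of
    the test function, lies in [V]. *)
Lemma mollified_increment rho (e : R) (V : set 'rV[R]_n) (U g : 'rV[R]_n -> R) i x s :
  0 < e -> 0 <= s ->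
  (forall k, C1k k setT rho) -> (forall t, 0 <= rho t) ->
  (forall t, e <= `|t| -> rho t = 0) ->
  (\int[leb]_t (rho t)%:E = 1)%E -> (exists K, forall t, rho t <= K) ->
  mu.-integrable setT (EFin \o (U : borelV R n -> R)) ->
  mu.-integrable setT (EFin \o (g : borelV R n -> R)) ->
  (forall phi, test_fun V phi ->
    \int[mu]_y (U y * pder i phi y) = - \int[mu]_y (g y * phi y)) ->
  (forall y : 'rV[R]_n, (forall j, j != i -> `|x 0 j - y 0 j| <= e) ->
     x 0 i - e <= y 0 i <= x 0 i + s + e -> V y) ->
  \int[mu]_y (U y * kern rho (x + s *: basis_vec R i - y)) - \int[mu]_y (U y * kern rho (x - y))
  = \int[leb]_(t in `[0, s]) (\int[mu]_y (g y * kern rho (x + t *: basis_vec R i - y))).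
Proof.
move=> e0 s0 Cr r0 rout r1 [B rB] iU ig Wk box.
have cr : continuous rho by move=> t; exact: (Cr 0%N).
have mr : measurable_fun setT rho by exact: continuous_measurable_fun.
have ir : leb.-integrable setT (EFin \o rho).
  apply/integrableP; split; first exact/measurable_EFinP.
  by under eq_integral do rewrite /= ger0_norm//; rewrite r1 ltry.
have [P [dP P']] := exists_primitive cr ir.
have mk z : measurable_fun setT (fun y : borelV R n => kern rho (z - y)).
  exact: (measurableT_comp (measurable_kern mr) (measurable_translate z)).
have kB (z : 'rV[R]_n) : `|kern rho z| <= B ^+ n by rewrite ger0_norm ?kern_ge0// kern_le.
have iUk z : mu.-integrable setT (EFin \o (fun y : borelV R n => U y * kern rho (z - y))).
  by apply: integrable_mul_bounded.
have test : test_fun V (bump_line rho P i x s).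
  split; first exact: bump_line_smooth.
  (* The compact support is a product of intervals, lengthened by [s] in direction [i]. *)
  pose A (j : 'I_n) : set R := if j == i then `[x 0 i - e, x 0 i + s + e]%classic
    else `[x 0 j - e, x 0 j + e]%classic.
  exists [set y : 'rV[R]_n | forall j, A j (y ord0 j)]; split.
  - by apply: rV_compact => j; rewrite /A; case: ifP => _; exact: segment_compact.
  - move=> y Ay; apply: box => [j ji|].
      have := Ay j; rewrite /A (negbTE ji)/= in_itv/= => /andP[h1 h2].
      by rewrite ler_norml; apply/andP; split; lra.
    by have := Ay i; rewrite /A eqxx /= in_itv.
  move=> y /existsNP[j Aj]; rewrite /bump_line.
  have [ji|ji] := eqVneq j i; last first.
    rewrite /kern_off (bigD1 j)//= rout ?mul0r//.
    move: Aj; rewrite /A (negbTE ji)/= in_itv/= !mxE => /negP.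
    by rewrite negb_and -!ltNge => /orP[h|h]; rewrite ler_normr; apply/orP; [left|right]; lra.
  (* In direction [i] the support is invisible on [P]; in the integral form, [rho] vanishes for
     every [t] of the segment. *)
  rewrite -/(bump_line rho P i x s y) (bump_lineE i x y s0 cr dP P').
  move: Aj; rewrite /A ji eqxx/= in_itv/= => /negP; rewrite negb_and -!ltNge => Aj.
  rewrite (@eq_Rintegral _ _ _ _ _ (cst 0)); first by rewrite Rintegral_cst// mul0r.
  move=> t; rewrite inE/= in_itv/= => /andP[t0 ts]; rewrite kern_shift rout ?mulr0//.
  by case/orP: Aj => h; rewrite ler_normr; apply/orP; [left|right]; lra.
have E : \int[mu]_y (U y * kern rho (x + s *: basis_vec R i - y)) - \int[mu]_y (U y * kern rho (x - y))
    = \int[mu]_y (g y * bump_line rho P i x s y).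
  apply: oppr_inj; rewrite -(Wk _ test) -RintegralB// -mulN1r -RintegralZl//; last first.
    rewrite (_ : _ \o _ = ((fun y => (U y * kern rho (x + s *: basis_vec R i - y))%:E) \- (fun y => (U y * kern rho (x - y))%:E))%E); last exact/funext.
    by apply: integrableB => //; exact: iUk.
  apply: eq_Rintegral => y _; rewrite bump_line_pder//; ring.
rewrite E; under eq_Rintegral do rewrite (bump_lineE _ _ _ s0 cr dP P').
pose D : set R := `[0, s]%classic.
have mD : measurable D by exact: measurable_itv.
(* The indicator of the segment is put in the integrand, so that Fubini applies on the full product
   space. *)
pose f (z : measurableTypeR R * borelV R n) : R :=
  (\1_D z.1 * g z.2) * kern rho (x + z.1 *: basis_vec R i - z.2).
have i1 : leb.-integrable setT (EFin \o (\1_D : measurableTypeR R -> R)).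
  apply/integrableP; split; first by apply/measurable_EFinP; exact: measurable_indic.
  under eq_integral do rewrite /= ger0_norm//.
  by rewrite integral_indic//= setIT lebesgue_measure_itv/=; case: ifP; rewrite ltry.
have If : (leb \x mu)%E.-integrable setT (EFin \o f).
  apply: (integrable_mul_bounded (M := B ^+ n)) => //; last exact: measurable_kern_line.
  exact: (integrable_product i1 ig).
have mky y : measurable_fun setT (fun t : measurableTypeR R => kern rho (x + t *: basis_vec R i - y)).
  have := measurableT_comp (measurable_kern_line i x mr) (@pair2_measurable _ _ (measurableTypeR R) (borelV R n) y). exact.
have If1 t : mu.-integrable setT (EFin \o (fun y => f (t, y))).
  rewrite (_ : _ \o _ = (fun y => (\1_D t)%:E * (g y * kern rho (x + t *: basis_vec R i - y))%:E)%E).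
    by apply: integrableZl => //; exact: (integrable_mul_bounded ig).
  by apply/funext => y; rewrite /= -EFinM /f/= mulrA.
have If2 y : leb.-integrable setT (EFin \o (fun t => f (t, y))).
  rewrite (_ : _ \o _ = (fun t => (g y)%:E * (\1_D t * kern rho (x + t *: basis_vec R i - y))%:E)%E).
    by apply: integrableZl => //; exact: (integrable_mul_bounded i1).
  by apply/funext => t; rewrite /= -EFinM /f/=; congr EFin; ring.
transitivity (\int[mu]_y (\int[leb]_t f (t, y))).
  apply: eq_Rintegral => y _; rewrite Rintegral_mkcond -RintegralZl//.
    apply: eq_Rintegral => t _; rewrite /f/= patchE indicE -/D.
    by case: ifP => _; rewrite ?mul1r ?mul0r ?mulr0.
  rewrite [X in integrable _ _ X](_ : _ = EFin \o (fun t : measurableTypeR R => \1_D t * kern rho (x + t *: basis_vec R i - y))).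
    exact: (integrable_mul_bounded i1).
  apply/funext => t; rewrite /= patchE indicE -/D.
  by case: ifP => _; rewrite ?mul1r ?mul0r.
rewrite -(RFubini If If1 If2) [RHS]Rintegral_mkcond; apply: eq_Rintegral => t _.
rewrite patchE -/D /f/= indicE; case: ifP => _.
  by under eq_Rintegral do rewrite mul1r.
by under eq_Rintegral do rewrite !mul0r; rewrite Rintegral_cst// mul0r.
Qed.
End Increment.

(** * Cutoff functions *)

Section Cutoff.
Variables (R : realType) (n : nat).
Local Notation mu := (muV R n).
Implicit Types (W : set 'rV[R]_n).

(* The term 1 keeps the infimum meaningful when the complement of W is empty. *)
Let dist W (y : 'rV[R]_n) : R := inf ([set `|y - z| | z in ~` W] `|` [set 1]).

Let dist_has_inf W y : has_inf ([set `|y - z| | z in ~` W] `|` [set 1]).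
Proof.
split; first by exists 1; right.
by exists 0 => _ [[z _ <-]|->].
Qed.

Let dist_ge0 W y : 0 <= dist W y.
Proof.
apply: lb_le_inf; first by exists 1; right.
by move=> _ [[z _ <-]|->].
Qed.

Let dist_lip W x y : dist W x <= dist W y + `|x - y|.
Proof.
rewrite -lerBlDr; apply: lb_le_inf; first by exists 1; right.
move=> _ [[z nWz <-]|->]; rewrite lerBlDr.
  apply: (@le_trans _ _ `|x - z|); first by apply: ge_inf; [exact: (dist_has_inf W x).2|left; exists z => //].
  rewrite (_ : x - z = (x - y) + (y - z)); last by rewrite addrA subrK.
  by rewrite addrC; apply: le_trans (ler_normD _ _) _; rewrite addrC.
apply: (@le_trans _ _ 1); last by rewrite lerDl.
by apply: ge_inf; [exact: (dist_has_inf W x).2|right].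
Qed.

Let dist_out W y : ~ W y -> dist W y = 0.
Proof.
move=> nWy; apply/eqP; rewrite eq_le dist_ge0 andbT; apply: ge_inf.
  exact: (dist_has_inf W y).2.
by left; exists y => //; rewrite subrr normr0.
Qed.

Let dist_gt0 W y : open W -> W y -> 0 < dist W y.
Proof.
move=> oW Wy; have /nbhs_ballP[e /= e0 eW] : nbhs y W by exact: open_nbhs_nbhs.
apply: (@lt_le_trans _ _ (Num.min e 1)); first by rewrite lt_min e0 ltr01.
apply: lb_le_inf; first by exists 1; right.
move=> _ [[z nWz <-]|->]; last by rewrite ge_min lexx orbT.
rewrite ge_min leNgt; apply/orP; left; apply/negP => yz.
by apply: nWz; apply: eW; rewrite -ball_normE.
Qed.

Let dist_continuous W : continuous (dist W).
Proof.
move=> x; apply/(@cvgrPdist_le _ _ _ (nbhs x)) => e e0; apply: (@filterS _ _ _ (ball x e)); last exact: nbhsx_ballx.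
move=> y; rewrite -ball_normE /= => xy; apply: le_trans (ltW xy).
rewrite ler_norml; apply/andP; split.
  by rewrite lerNl opprB lerBlDr addrC distrC; exact: dist_lip.
by rewrite lerBlDr addrC; exact: dist_lip.
Qed.

(** Clipping k times the distance to the complement at 1: at a point of [W] the distance is
    positive, so the value is 1 for large k. Continuous cutoffs suffice because they are never
    differentiated. *)
Lemma exists_cutoff W : open W -> exists phi : nat -> 'rV[R]_n -> R,
  [/\ forall k, continuous (phi k), forall k y, 0 <= phi k y <= 1,
      forall k y, ~ W y -> phi k y = 0 &
      forall y, phi k y @[k --> \oo] --> (\1_W y : R)].
Proof.
move=> oW; exists (fun k y => Num.min (k%:R * dist W y) 1); split.
- move=> k x; apply: (@continuous_min _ _ (fun x => k%:R * dist W x) (cst 1)); last exact: cst_continuous.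
  by apply: continuousM; [exact: cst_continuous|exact: dist_continuous].
- move=> k y; rewrite ge_min lexx orbT le_min ler01 !andbT.
  by rewrite mulr_ge0.
- by move=> k y nW; rewrite dist_out// mulr0 min_l.
move=> y; rewrite indicE; have [Wy|nWy] := pselect (W y); last first.
  rewrite memNset// dist_out//; under eq_fun do rewrite mulr0 min_l//.
  exact: cvg_cst.
rewrite mem_set//; have d0 := dist_gt0 oW Wy.
apply: (@cvg_trans _ (cst (1 : R) @ \oo)); last exact: cvg_cst.
apply: near_eq_cvg; near=> k => /=.
rewrite min_r// -ler_pdivrMr// div1r.
near: k; exact: nbhs_infty_ger.
Unshelve. all: by end_near. Qed.

(** The Borel sets over which [w] integrates to 0 form a Dynkin system containing the open sets,
    which are stable under intersection; hence all Borel sets qualify. *)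
Lemma ae_eq0_of_open (w : borelV R n -> R) : mu.-integrable setT (EFin \o w) ->
  (forall W, open W -> \int[mu]_(x in W) w x = 0) ->
  ae_eq mu setT (EFin \o w) (cst 0%E).
Proof.
move=> iw w0.
have wE E : measurable E -> mu.-integrable E (EFin \o w).
  by move=> mE; apply: integrableS iw.
have w0E W : open W -> (\int[mu]_(x in W) (w x)%:E = 0)%E.
  move=> oW; rewrite -[LHS]fineK; first by rewrite [fine _]w0.
  by apply: (integrable_fin_num _ (wE _ (open_measurableV oW))); exact: open_measurableV.
apply: integral_ae_eq => //.
move=> E _ mE; rewrite integral_cst// mul0e.
apply: (@dynkin_induction _ (borelV R n) [set U : set 'rV[R]_n | open U]
  (fun E => (\int[mu]_(x in E) (w x)%:E = 0)%E)) => //.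
- by move=> A B; exact: openI.
- by apply: w0E; exact: openT.
- move=> S mS S0; have := w0E setT (@openT _).
  rewrite -(setUv S) integral_setU_EFin//; last 3 first.
  + exact: measurableC.
  + by apply/measurable_EFinP; apply: measurable_int; apply: wE; rewrite setUv.
  + by apply/disj_setPCl.
  by rewrite S0 add0e.
- move=> F mF tF F0; rewrite integral_bigcup//; last first.
    by apply: wE; exact: bigcup_measurable.
  by rewrite eseries0// => k _ _; exact: F0.
Qed.
End Cutoff.

(** * Limits of mollified increments *)

Section CoordinatePath.
Variables (R : realType) (n : nat).
Implicit Types (x y c : 'rV[R]_n) (i : 'I_n) (s : R).

(** Staircase from [y] to [x], changing one coordinate at a time; in a cube it does not leave the
    cube ([coord_path_ball]). *)
Definition coord_path x y k : 'rV[R]_n := \row_j (if (j < k)%N then x 0 j else y 0 j).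

Lemma coord_path0 x y : coord_path x y 0 = y.
Proof. by apply/rowP => j; rewrite mxE. Qed.

Lemma coord_pathn x y : coord_path x y n = x.
Proof. by apply/rowP => j; rewrite mxE ltn_ord. Qed.

Lemma coord_pathS x y i :
  coord_path x y i.+1 = coord_path x y i + (x 0 i - y 0 i) *: basis_vec R i.
Proof.
apply/rowP => j; rewrite shift_coord !mxE ltnS leq_eqVlt (inj_eq val_inj).
have [->|ji] := eqVneq j i; last by rewrite addr0.
by rewrite /= ltnn addrC subrK.
Qed.

Lemma coord_path_ball c r x y k : ball c r x -> ball c r y -> ball c r (coord_path x y k).
Proof.
move=> [r0 bx] [_ by_]; split=> // i j; rewrite mxE.
by case: ifP => _; [have := bx i j|have := by_ i j]; rewrite ord1.
Qed.

End CoordinatePath.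

Section LimitPrimitive.
Variables (R : realType) (n : nat).
Implicit Types (x y c : 'rV[R]_n) (i : 'I_n) (s : R).
Variables (c : 'rV[R]_n) (r K : R) (F : nat -> 'rV[R]_n -> R) (G : 'I_n -> 'rV[R]_n -> R)
  (I : 'I_n -> 'rV[R]_n -> R -> R).
Let V := ball c r.
Hypothesis r0 : 0 < r.
Hypothesis K0 : 0 <= K.
Hypothesis FI : forall i x s, 0 <= s -> V x -> V (x + s *: basis_vec R i) ->
  F m (x + s *: basis_vec R i) - F m x @[m --> \oo] --> I i x s.
Hypothesis FK : forall m i x s, 0 <= s -> V x -> V (x + s *: basis_vec R i) ->
  `|F m (x + s *: basis_vec R i) - F m x| <= K * s.
Hypothesis Iest : forall i x s a e, 0 <= s -> V x -> V (x + s *: basis_vec R i) ->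
  (forall t, 0 <= t <= s -> `|G i (x + t *: basis_vec R i) - a| <= e) ->
  `|I i x s - s * a| <= s * e.
Hypothesis Gc : forall i x, V x -> {for x, continuous (G i)}.

(** A negative step is a positive step read from its other end. *)
Let step_cvg i x s : V x -> V (x + s *: basis_vec R i) ->
  cvg (F m (x + s *: basis_vec R i) - F m x @[m --> \oo]).
Proof.
move=> Vx Vxs; have [s0|s0] := leP 0 s; first by apply/cvg_ex; eexists; exact: FI.
rewrite (_ : (fun m => _) = (fun m => - (F m (x + s *: basis_vec R i + (- s) *: basis_vec R i) - F m (x + s *: basis_vec R i)))).
  apply: is_cvgN; apply/cvg_ex; eexists; apply: FI => //; first by rewrite oppr_ge0 ltW.
  by rewrite scaleNr addrK.
by apply/funext => m; rewrite scaleNr addrK opprB.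
Qed.

Let step_bound m i x s : V x -> V (x + s *: basis_vec R i) ->
  `|F m (x + s *: basis_vec R i) - F m x| <= K * `|s|.
Proof.
move=> Vx Vxs; have [s0|s0] := leP 0 s; first by rewrite (ger0_norm s0); exact: FK.
rewrite distrC (ltr0_norm s0).
have {1}-> : x = x + s *: basis_vec R i + (- s) *: basis_vec R i by rewrite scaleNr addrK.
by apply: FK; [rewrite oppr_ge0 ltW| |rewrite scaleNr addrK].
Qed.

(** Telescoping along the staircase, as the hypotheses only concern axis-parallel segments. *)
Let path_cvg x y k : (k <= n)%N -> V x -> V y ->
  cvg (F m (coord_path x y k) - F m y @[m --> \oo]).
Proof.
move=> kn Vx Vy; elim: k kn => [|k IH] kn.
  by rewrite coord_path0; under eq_fun do rewrite subrr; exact: is_cvg_cst.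
rewrite (coord_pathS x y (Ordinal kn)).
set p := coord_path x y (Ordinal kn); set q := p + _.
rewrite (_ : (fun m => _) = (fun m => (F m q - F m p) + (F m p - F m y))).
  apply: is_cvgD; last exact: IH (ltnW kn).
  by apply: step_cvg; rewrite ?/p -?coord_pathS; exact: coord_path_ball.
by apply/funext => m; rewrite addrA subrK.
Qed.

Let path_bound m x y k delta : (k <= n)%N -> V x -> V y ->
  (forall j, `|x 0 j - y 0 j| <= delta) ->
  `|F m (coord_path x y k) - F m y| <= k%:R * (K * delta).
Proof.
move=> kn Vx Vy xy; elim: k kn => [|k IH] kn.
  by rewrite coord_path0 subrr normr0 mul0r.
rewrite (coord_pathS x y (Ordinal kn)).
set p := coord_path x y (Ordinal kn); set q := p + _.
rewrite -[F m q](subrK (F m p)) -addrA -natr1 mulrDl mul1r addrC.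
apply: le_trans (ler_normD _ _) _; apply: lerD; first exact: IH (ltnW kn).
apply: le_trans (step_bound _ _ _) _.
- exact: coord_path_ball.
- by rewrite -coord_pathS; exact: coord_path_ball.
- by rewrite ler_wpM2l// xy.
Qed.

Let Vc : V c. Proof. exact: ballxx. Qed.

Let g x : R := lim (F m x - F m c @[m --> \oo]).

Let gE x : V x -> F m x - F m c @[m --> \oo] --> g x.
Proof. by move=> Vx; have := path_cvg (leqnn n) Vx Vc; rewrite coord_pathn. Qed.

Let g_sub x y : V x -> V y -> F m x - F m y @[m --> \oo] --> g x - g y.
Proof.
move=> Vx Vy; rewrite (_ : (fun m => _) = (fun m => (F m x - F m c) - (F m y - F m c))).
  by apply: cvgB; exact: gE.
by apply/funext => m; rewrite opprB addrA subrK.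
Qed.

(** The uniform bound on increments passes to the limit. It is the source of the continuity of [g],
    which the mere existence of partial derivatives would not give. *)
Let g_lip x y delta : V x -> V y -> (forall j, `|x 0 j - y 0 j| <= delta) ->
  `|g x - g y| <= n%:R * (K * delta).
Proof.
move=> Vx Vy xy.
have cn : `|F m x - F m y| @[m --> \oo] --> `|g x - g y| by apply: cvg_norm; exact: g_sub.
rewrite -(cvg_lim _ cn)//; apply: limr_le; first by apply/cvg_ex; eexists; exact: cn.
apply: nearW => m; rewrite -{1}(coord_pathn x y); exact: path_bound.
Qed.

Let g_inc i x s : 0 <= s -> V x -> V (x + s *: basis_vec R i) ->
  g (x + s *: basis_vec R i) - g x = I i x s.
Proof.
move=> s0 Vx Vxs; have := g_sub Vxs Vx => /(cvg_lim _) <- //.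
by apply: cvg_lim => //; exact: FI.
Qed.

Let Vopen : open V. Proof. exact: ball_open. Qed.

Let g_cont x : V x -> {for x, continuous g}.
Proof.
move=> Vx; apply/(@cvgrPdist_le _ _ _ (nbhs x)) => e e0.
pose d := e / (n%:R * K + 1).
have nK : 0 < n%:R * K + 1 by rewrite ltr_wpDl// mulr_ge0.
have d0 : 0 < d by rewrite divr_gt0.
have : nbhs x (V `&` ball x d).
  by apply: filterI; [exact: open_nbhs_nbhs|exact: nbhsx_ballx].
apply: filterS => y [Vy [_ xy]].
apply: (@le_trans _ _ (n%:R * (K * d))).
  by apply: g_lip => // j; exact: ltW (xy 0 j).
rewrite mulrA /d mulrA ler_pdivrMr// mulrC ler_wpM2l ?lerDl//.
exact: ltW.
Qed.

(** On a short segment [G i] deviates from [G i x] by at most [e], so [Iest] applies. For h < 0 the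
    segment is run from x + h e_i, with length -h. *)
Let g_near i x e : V x -> 0 < e -> \forall h \near (0 : R),
  `|g (x + h *: basis_vec R i) - g x - h * G i x| <= `|h| * e.
Proof.
move=> Vx e0.
have : nbhs x (V `&` (fun y => `|G i x - G i y| <= e)).
  apply: filterI; first exact: open_nbhs_nbhs.
  by have /(@cvgrPdist_le _ _ _ (nbhs x)) := Gc (i := i) Vx; exact.
move=> /nbhs_ballP[d /= d0 dV]; near=> h.
have hd : `|h| < d by near: h; exact: (@nbhs0_lt R R).
have bt t : `|t| <= `|h| -> ball x d (x + t *: basis_vec R i).
  move=> th; split=> // a j; rewrite ord1 shift_coord /ball/= opprD addNKr.
  by case: ifP => _; rewrite normrN ?normr0//; exact: le_lt_trans hd.
have Vh : V (x + h *: basis_vec R i) by apply: (dV _ (bt _ _)).1.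
have [h0|h0] := leP 0 h.
  rewrite g_inc// (ger0_norm h0); apply: Iest => // t /andP[t0 th].
  rewrite distrC; apply: (dV _ (bt t _)).2; rewrite !ger0_norm//.
set x' := x + h *: basis_vec R i.
have xE : x' + (- h) *: basis_vec R i = x by rewrite scaleNr addrK.
have nh0 : 0 <= - h by rewrite oppr_ge0 ltW.
have gi : g x - g x' = I i x' (- h) by rewrite -g_inc// xE.
rewrite (_ : g x' - g x - _ = - (I i x' (- h) - (- h) * G i x)); last by rewrite -gi; ring.
rewrite normrN (ltr0_norm h0); apply: Iest; rewrite ?xE// => t /andP[t0 th].
rewrite distrC /x' -addrA -scalerDl; apply: (dV _ (bt _ _)).2.
by rewrite (ltr0_norm h0) ler_norml; lra.
Unshelve. all: by end_near. Qed.

Let g_deriv i x : V x -> is_derive x (basis_vec R i) g (G i x).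
Proof.
move=> Vx.
have D : (fun h => h^-1 *: ((g \o shift x) (h *: basis_vec R i) - g x)) @ 0^' --> G i x.
  apply/cvgrPdist_le => e e0; near=> h.
  have h0 : h != 0 by near: h; exact: nbhs_dnbhs_neq.
  have : `|g (x + h *: basis_vec R i) - g x - h * G i x| <= `|h| * e.
    by near: h; apply: nbhs_dnbhs; exact: g_near.
  rewrite /= [h *: _ + x]addrC -ler_pdivrMl ?normr_gt0// -normfV -normrM distrC.
  rewrite mulrBr mulrA mulVf// mul1r; exact.
by apply: DeriveDef; [apply/cvg_ex; exists (G i x)|exact: cvg_lim].
Unshelve. all: by end_near. Qed.

(** An abstract passage to the limit: [F] will be the mollifications and [I] the integral of [G i]
    along a segment, known here only through its first-order estimate. The bound by n K r, one K r
    per step of the staircase, serves later for dominated convergence. *)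
Lemma limit_primitive : exists g0 : 'rV[R]_n -> R,
  [/\ forall x, V x -> F m x - F m c @[m --> \oo] --> g0 x,
      forall m x, V x -> `|F m x - F m c| <= n%:R * (K * r),
      forall x, V x -> {for x, continuous g0} &
      forall i x, V x -> is_derive x (basis_vec R i) g0 (G i x)].
Proof.
exists g; split=> // m x Vx; rewrite -{1}(coord_pathn x c); apply: path_bound => // j.
by rewrite distrC; case: Vx => _ /(_ 0 j) /ltW.
Qed.
End LimitPrimitive.

(** * Primitives of a weak gradient *)

Section RealIntegrable.
Context d (T : measurableType d) (R : realType) (mu : {measure set T -> \bar R}).

Lemma integrable_subR D (f g : T -> R) : measurable D ->
  mu.-integrable D (EFin \o f) -> mu.-integrable D (EFin \o g) ->
  mu.-integrable D (EFin \o (fun x => f x - g x)).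
Proof.
move=> mD fi gi; rewrite (_ : _ \o _ = ((EFin \o f) \- (EFin \o g))%E); last exact/funext.
exact: integrableB.
Qed.

Lemma integrable_mulR D (f : T -> R) (a : R) : measurable D ->
  mu.-integrable D (EFin \o f) -> mu.-integrable D (EFin \o (fun x => f x * a)).
Proof.
move=> mD fi; rewrite (_ : _ \o _ = (fun x => a%:E * (f x)%:E)%E).
  exact: integrableZl.
by apply/funext => x; rewrite /= -EFinM mulrC.
Qed.

End RealIntegrable.

Section Convolution.
Variables (R : realType) (n : nat).
Local Notation mu := (muV R n).
Local Notation leb := (@lebesgue_measure R).
Implicit Types (rho : R -> R) (i : 'I_n) (x y : 'rV[R]_n).

Lemma measurable_continuous_on (V : set 'rV[R]_n) (f : 'rV[R]_n -> R) : open V ->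
  (forall x, V x -> {for x, continuous f}) ->
  measurable_fun setT ((fun x => f x * \1_V x) : borelV R n -> R).
Proof.
move=> oV cf; have mV := open_measurableV oV.
have mf : measurable_fun (V : set (borelV R n)) (f : borelV R n -> R).
  apply: (measurability _ (@RGenOpens.measurableE R)) => _ [_ [a [b ->]] <-].
  apply: open_measurableV; rewrite openE => x [Vx fx]; apply: filterI.
    exact: open_nbhs_nbhs.
  apply: (cf _ Vx); apply: open_nbhs_nbhs; split=> //; exact: interval_open.
rewrite (_ : (fun _ => _) = f \_ V); first by apply/(measurable_restrictT _ mV).
by apply/funext => x; rewrite patchE indicE; case: ifPn => _; rewrite ?mulr1 ?mulr0.
Qed.

Lemma integrable_bounded_on (V : set 'rV[R]_n) (f : 'rV[R]_n -> R) (M : R) :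
  measurable (V : set (borelV R n)) -> (mu V < +oo)%E ->
  measurable_fun setT ((fun x => f x * \1_V x) : borelV R n -> R) ->
  (forall x, V x -> `|f x| <= M) ->
  mu.-integrable setT (EFin \o ((fun x => f x * \1_V x) : borelV R n -> R)).
Proof.
move=> mV Voo mf fM.
have i1 : mu.-integrable setT (EFin \o (\1_V : borelV R n -> R)).
  apply/integrableP; split; first by apply/measurable_EFinP; exact: measurable_indic.
  under eq_integral do rewrite /= ger0_norm//.
  by rewrite integral_indic//= setIT.
rewrite (_ : (fun x => _) = (fun x => \1_V x * (f x * \1_V x))); last first.
  by apply/funext => x; rewrite indicE; case: (x \in V); rewrite ?mul1r ?mulr1 ?mul0r ?mulr0.
apply: (integrable_mul_bounded (M := `|M|) i1) => // x.
rewrite indicE; case: (boolP (x \in V)) => [xV|_]; last by rewrite mulr0 normr0.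
by rewrite mulr1; apply: le_trans (ler_norm M); apply: fM; exact: set_mem.
Qed.

Lemma measurable_kern_sub rho : measurable_fun setT rho ->
  measurable_fun setT (fun z : borelV R n * borelV R n => kern rho ((z.1 : 'rV[R]_n) - z.2)).
Proof.
move=> mr.
have H : measurable_fun setT ((fun z => (z.1 : 'rV[R]_n) - z.2) : borelV R n * borelV R n -> borelV R n).
  apply: measurable_coord_rV => j.
  rewrite (_ : (fun _ => _) = (fun z : borelV R n * borelV R n => z.1 0 j - z.2 0 j)); last first.
    by apply/funext => z; rewrite !mxE.
  apply: measurable_funB.
    exact: (measurableT_comp (@measurable_coord R n j) measurable_fst).
  exact: (measurableT_comp (@measurable_coord R n j) measurable_snd).
exact: (measurableT_comp (measurable_kern mr) H).
Qed.

Section Duality.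
Variables (rho : R -> R) (B : R).
Hypothesis mr : measurable_fun setT rho.
Hypothesis r0 : forall t, 0 <= rho t.
Hypothesis re : forall t, rho (- t) = rho t.
Hypothesis rB : forall t, rho t <= B.

Let kB (z : 'rV[R]_n) : `|kern rho z| <= B ^+ n.
Proof. by rewrite ger0_norm ?kern_ge0// kern_le. Qed.

Lemma integrable_mul_kern (U : borelV R n -> R) x : mu.-integrable setT (EFin \o U) ->
  mu.-integrable setT (EFin \o (fun y => U y * kern rho (x - y))).
Proof.
move=> iU; apply: (integrable_mul_bounded iU _ (fun y => kB (x - y))).
exact: (measurableT_comp (measurable_kern mr) (measurable_translate x)).
Qed.

Let f (phi U : borelV R n -> R) (z : borelV R n * borelV R n) : R :=
  (phi z.1 * U z.2) * kern rho ((z.1 : 'rV[R]_n) - z.2).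

Let If (phi U : borelV R n -> R) : mu.-integrable setT (EFin \o phi) ->
  mu.-integrable setT (EFin \o U) -> (mu \x mu)%E.-integrable setT (EFin \o f phi U).
Proof.
move=> ip iU; apply: (integrable_mul_bounded (M := B ^+ n)) => //; last exact: measurable_kern_sub.
exact: (integrable_product ip iU).
Qed.

Let If1 (phi U : borelV R n -> R) x : mu.-integrable setT (EFin \o U) ->
  mu.-integrable setT (EFin \o (fun y => f phi U (x, y))).
Proof.
move=> iU; rewrite (_ : _ \o _ = (fun y => (phi x)%:E * (U y * kern rho ((x : 'rV[R]_n) - y))%:E)%E).
  by apply: integrableZl => //; exact: integrable_mul_kern.
by apply/funext => y; rewrite /= -EFinM /f/= mulrA.
Qed.

Let fE (phi U : borelV R n -> R) : mu.-integrable setT (EFin \o U) ->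
  (fun x => phi x * \int[mu]_y (U y * kern rho ((x : 'rV[R]_n) - y))) =
  (fun x => \int[mu]_y f phi U (x, y)).
Proof.
move=> iU; apply/funext => x; rewrite -RintegralZl//; last exact: integrable_mul_kern.
by apply: eq_Rintegral => y _; rewrite /f mulrA.
Qed.

Lemma measurable_mul_conv (phi U : borelV R n -> R) : mu.-integrable setT (EFin \o phi) ->
  mu.-integrable setT (EFin \o U) ->
  measurable_fun setT (fun x : borelV R n => phi x * \int[mu]_y (U y * kern rho ((x : 'rV[R]_n) - y))).
Proof.
move=> ip iU; rewrite (fE phi iU).
exact: (measurableT_comp (@fine_measurable R setT measurableT) (measurable_fubini_F (If ip iU))).
Qed.

(** Fubini, together with the evenness of the kernel to exchange its two points. *)
Lemma conv_duality (phi U : borelV R n -> R) : mu.-integrable setT (EFin \o phi) ->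
  mu.-integrable setT (EFin \o U) ->
  \int[mu]_x (phi x * \int[mu]_y (U y * kern rho ((x : 'rV[R]_n) - y))) =
  \int[mu]_y (U y * \int[mu]_x (phi x * kern rho ((y : 'rV[R]_n) - x))).
Proof.
move=> ip iU; rewrite (fE phi iU).
have fC x y : f phi U (x, y) = f U phi (y, x).
  by rewrite /f/= -(kern_sym _ re) opprB [phi x * _]mulrC.
rewrite RFubini//.
- rewrite (fE U ip); apply: eq_Rintegral => y _; apply: eq_Rintegral => x _; exact: fC.
- exact: If.
- by move=> x; exact: If1.
- by move=> y; under [X in EFin \o X]eq_fun do rewrite fC; exact: If1.
Qed.

Lemma measurable_conv_line (g : borelV R n -> R) i x (s : R) : mu.-integrable setT (EFin \o g) ->
  measurable_fun `[0, s] (fun t : measurableTypeR R => \int[mu]_y (g y * kern rho (x + t *: basis_vec R i - y))).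
Proof.
move=> ig; pose D : set R := `[0, s]%classic.
have mD : measurable D by exact: measurable_itv.
have i1 : leb.-integrable setT (EFin \o (\1_D : measurableTypeR R -> R)).
  apply/integrableP; split; first by apply/measurable_EFinP; exact: measurable_indic.
  under eq_integral do rewrite /= ger0_norm//.
  by rewrite integral_indic//= setIT lebesgue_measure_itv/=; case: ifP; rewrite ltry.
pose h (z : measurableTypeR R * borelV R n) : R :=
  (\1_D z.1 * g z.2) * kern rho (x + z.1 *: basis_vec R i - z.2).
have Ih : (leb \x mu)%E.-integrable setT (EFin \o h).
  apply: (integrable_mul_bounded (M := B ^+ n)) => //; last exact: measurable_kern_line.
  exact: (integrable_product i1 ig).
have mh := measurableT_comp (@fine_measurable R setT measurableT) (measurable_fubini_F Ih).
apply: (eq_measurable_fun _ _ (measurable_funS measurableT (@subsetT _ _) mh)) => t tD.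
rewrite /= /fubini_F; congr fine; apply: eq_integral => y _.
by rewrite /h/= indicE -/D tD mul1r.
Qed.

End Duality.
End Convolution.

Section LocalPrimitive.
Variables (R : realType) (n : nat).
Local Notation mu := (muV R n).
Local Notation leb := (@lebesgue_measure R).
Implicit Types (i : 'I_n) (x y : 'rV[R]_n) (s t a : R).
Variables (c : 'rV[R]_n) (r M : R) (U : borelV R n -> R) (G : 'I_n -> 'rV[R]_n -> R).
(** The larger cube [V] leaves a margin [r] around [W]; the mollification radii [e m] = r / (m + 1)
    never exceed it. *)
Let W : set 'rV[R]_n := ball c r.
Let V : set 'rV[R]_n := ball c (r + r).
Let g i : borelV R n -> R := fun x => G i x * \1_V x.
Hypothesis r_gt0 : 0 < r.
Hypothesis iU : mu.-integrable setT (EFin \o U).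
Hypothesis Gc : forall i x, V x -> {for x, continuous (G i)}.
Hypothesis GM : forall i x, V x -> `|G i x| <= M.
Hypothesis Wk : forall i phi, test_fun V phi ->
    \int[mu]_y (U y * pder i phi y) = - \int[mu]_y (g i y * phi y).

Let oW : open W. Proof. exact: ball_open. Qed.
Let oV : open V. Proof. exact: ball_open. Qed.
Let WV x : W x -> V x. Proof. by apply: le_ball; rewrite lerDl ltW. Qed.
Let Wc : W c. Proof. exact: ballxx. Qed.
Let Mi i : 0 <= M. Proof. by apply: le_trans (GM i (WV Wc)); exact: normr_ge0. Qed.

Let Voo : (mu V < +oo)%E. Proof. by rewrite muV_ball ?ltry// addr_gt0. Qed.
Let Woo : (mu W < +oo)%E. Proof. by rewrite muV_ball ?ltry. Qed.
Let mV : measurable (V : set (borelV R n)). Proof. exact: open_measurableV. Qed.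
Let mW : measurable (W : set (borelV R n)). Proof. exact: open_measurableV. Qed.

Let mg i : measurable_fun setT (g i).
Proof. by apply: measurable_continuous_on => // x; exact: Gc. Qed.

Let ig i : mu.-integrable setT (EFin \o g i).
Proof. by apply: (integrable_bounded_on (M := M)) => //; [exact: mg|exact: GM]. Qed.

Let gM i x : `|g i x| <= M.
Proof.
rewrite /g indicE; case: (boolP (x \in V)) => [xV|_].
  by rewrite mulr1 GM//; exact: set_mem.
by rewrite mulr0 normr0 (Mi i).
Qed.

Let e (m : nat) : R := r / m.+1%:R.
Let e_gt0 m : 0 < e m. Proof. by rewrite divr_gt0. Qed.
Let e_le m : e m <= r.
Proof. by rewrite ler_pdivrMr// ler_peMr ?ler1n// ltW. Qed.

Let e_small (d : R) : 0 < d -> \forall m \near \oo, e m <= d.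
Proof.
move=> d0; near=> m; rewrite ler_pdivrMr// mulrC -ler_pdivrMr//.
apply: (@le_trans _ _ m%:R); last by rewrite ler_nat.
by near: m; exact: nbhs_infty_ger.
Unshelve. all: by end_near. Qed.

Let moll m := exists_mollifier (e_gt0 m).
Let rho m := sval (cid (moll m)).
Let Cr m : forall k, C1k k setT (rho m). Proof. by have [] := svalP (cid (moll m)). Qed.
Let r0 m : forall t, 0 <= rho m t. Proof. by have [] := svalP (cid (moll m)). Qed.
Let rout m : forall t, e m <= `|t| -> rho m t = 0. Proof. by have [] := svalP (cid (moll m)). Qed.
Let re m : forall t, rho m (- t) = rho m t. Proof. by have [] := svalP (cid (moll m)). Qed.
Let r1 m : (\int[leb]_t (rho m t)%:E = 1)%E. Proof. by have [_ _ _ _ []] := svalP (cid (moll m)). Qed.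
Let rB m : exists K, forall t, rho m t <= K. Proof. by have [_ _ _ _ []] := svalP (cid (moll m)). Qed.
Let mr m : measurable_fun setT (rho m).
Proof. by apply: continuous_measurable_fun => t; exact: (@Cr m 0%N). Qed.

Let F m x := \int[mu]_y (U y * kern (rho m) (x - y)).
Let H m i x := \int[mu]_y (g i y * kern (rho m) (x - y)).

Let FH m i x s : 0 <= s -> W x -> W (x + s *: basis_vec R i) ->
  F m (x + s *: basis_vec R i) - F m x = \int[leb]_(t in `[0, s]) H m i (x + t *: basis_vec R i).
Proof.
move=> s0 [_ Wx] [_ Wxs].
apply: (mollified_increment (e_gt0 m) s0 (Cr m) (r0 m) (@rout m) (r1 m) (rB m) iU (ig i) (Wk i)).
move=> y yj yi; split; first by rewrite addr_gt0.
move=> a j; rewrite ord1; have := Wx 0 j; have := Wxs 0 j; have em := e_le m.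
rewrite shift_coord /ball/= => h1 h2; have [ji|ji] := eqVneq j i; last first.
  rewrite (_ : c 0 j - y 0 j = (c 0 j - x 0 j) + (x 0 j - y 0 j)); last by rewrite addrA subrK.
  apply: le_lt_trans (ler_normD _ _) _; apply: ltr_leD => //.
  exact: le_trans (yj _ ji) em.
move: yi h1 h2; rewrite ji eqxx => /andP[y1 y2].
by rewrite !ltr_norml => /andP[h1 h2] /andP[h3 h4]; apply/andP; split; lra.
Qed.

Let H_cvg i x : V x -> H m i x @[m --> \oo] --> G i x.
Proof.
move=> Vx; have gx : g i x = G i x by rewrite /g indicE mem_set// mulr1.
apply/cvgrPdist_le => eta eta0.
have : nbhs x (V `&` (fun y => `|G i x - G i y| <= eta)).
  apply: filterI; first exact: open_nbhs_nbhs.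
  by have /(@cvgrPdist_le _ _ _ (nbhs x)) := Gc (i := i) Vx; exact.
move=> /nbhs_ballP[d /= d0 dV]; apply: filterS (e_small d0) => m emd.
rewrite distrC -gx; apply: (kern_approx (e_gt0 m) (mr m) (r0 m) (@re m) (@rout m) (r1 m) (mg i) (gM i)).
move=> y by_; have [Vy] := dV y (le_ball emd by_).
by rewrite gx distrC /g indicE mem_set// mulr1.
Qed.

(** A crude bound: [kern_approx] with oscillation at most 2 M, plus M for the value itself. *)
Let H_bound m i x : `|H m i x| <= 3 * M.
Proof.
have h : `|H m i x - g i x| <= M + M.
  apply: (kern_approx (e_gt0 m) (mr m) (r0 m) (@re m) (@rout m) (r1 m) (mg i) (gM i)).
  by move=> y _; apply: le_trans (ler_normB _ _) _; apply: lerD; exact: gM.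
rewrite -[H m i x](subrK (g i x)); apply: le_trans (ler_normD _ _) _.
by have := gM i x; lra.
Qed.

Let mH m i x s : measurable_fun `[0, s] (fun t : measurableTypeR R => H m i (x + t *: basis_vec R i)).
Proof. by have [B rBm] := rB m; apply: (measurable_conv_line (B := B)) => //; exact: ig. Qed.

Let seg_in i x s t : W x -> W (x + s *: basis_vec R i) -> 0 <= t <= s -> W (x + t *: basis_vec R i).
Proof.
move=> [_ Wx] [_ Wxs] /andP[t0 ts]; split=> // a j; rewrite ord1.
have := Wx 0 j; have := Wxs 0 j; rewrite !shift_coord /ball/=; case: ifP => // _.
by rewrite !ltr_norml => /andP[h1 h2] /andP[h3 h4]; apply/andP; split; lra.
Qed.

Let iseg (a s : R) : leb.-integrable `[0, s] (EFin \o cst a).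
Proof.
apply: continuous_compact_integrable; first exact: segment_compact.
by apply: continuous_subspaceT => t; exact: cst_continuous.
Qed.

Let I i x s := \int[leb]_(t in `[0, s]) G i (x + t *: basis_vec R i).

(** Obtained as a pointwise limit of the measurable functions [H m i]. *)
Let mG i x s : W x -> W (x + s *: basis_vec R i) ->
  measurable_fun `[0, s] (fun t : measurableTypeR R => G i (x + t *: basis_vec R i)).
Proof.
move=> Wx Wxs; apply: (@measurable_fun_cvg _ _ R _ (fun m (t : measurableTypeR R) => H m i (x + t *: basis_vec R i))) => [m|t /=]; first exact: mH.
by rewrite in_itv/= => ts; apply: H_cvg; apply: WV; exact: seg_in ts.
Qed.

Let FI i x s : 0 <= s -> W x -> W (x + s *: basis_vec R i) ->
  F m (x + s *: basis_vec R i) - F m x @[m --> \oo] --> I i x s.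
Proof.
move=> s0 Wx Wxs; under eq_fun do rewrite FH//.
apply: (Rdominated_convergence (g := cst (3 * M))).
- exact: measurable_itv.
- by move=> m; exact: mH.
- exact: mG.
- by move=> t /=; rewrite in_itv/= => ts; apply: H_cvg; apply: WV; exact: seg_in ts.
- exact: iseg.
- by move=> m t _; exact: H_bound.
Qed.

Let lebseg (s : R) : 0 <= s -> fine (leb `[0, s]%classic) = s.
Proof.
rewrite le_eqVlt => /predU1P[<-|s0]; first by rewrite set_itv1 lebesgue_measure_set1.
by rewrite lebesgue_measure_itv/= lte_fin s0 -EFinB subr0.
Qed.

(** [limit_primitive] wants a nonnegative constant without reference to an index, and [GM] yields 0
    <= M only once some [i] is given; hence the absolute value. *)
Let FK m i x s : 0 <= s -> W x -> W (x + s *: basis_vec R i) ->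
  `|F m (x + s *: basis_vec R i) - F m x| <= (3 * `|M|) * s.
Proof.
move=> s0 Wx Wxs; rewrite FH//.
have iH : leb.-integrable `[0, s] (EFin \o (fun t : measurableTypeR R => H m i (x + t *: basis_vec R i))).
  apply: (le_integrable _ _ _ (iseg (3 * M) s)) => //; first by apply/measurable_EFinP; exact: mH.
  move=> t _ /=; rewrite lee_fin; apply: le_trans (H_bound _ _ _) _; exact: ler_norm.
apply: le_trans (le_normr_Rintegral _ iH) _ => //.
rewrite -[X in _ * X](lebseg s0) -Rintegral_cst//; apply: le_Rintegral => //.
- exact: integrable_norm iH.
- exact: iseg.
- move=> t _; apply: le_trans (H_bound _ _ _) _; rewrite ler_pM2l// ler_norm//.
Qed.

Let Iest i x s a eta : 0 <= s -> W x -> W (x + s *: basis_vec R i) ->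
  (forall t, 0 <= t <= s -> `|G i (x + t *: basis_vec R i) - a| <= eta) ->
  `|I i x s - s * a| <= s * eta.
Proof.
move=> s0 Wx Wxs Ga.
have iG : leb.-integrable `[0, s] (EFin \o (fun t : measurableTypeR R => G i (x + t *: basis_vec R i))).
  apply: (le_integrable _ _ _ (iseg M s)) => //.
    by apply/measurable_EFinP; exact: mG.
  move=> t /=; rewrite in_itv/= => ts; rewrite lee_fin; apply: le_trans (ler_norm M).
  by apply: GM; apply: WV; exact: seg_in ts.
have sa b : s * b = \int[leb]_(t in `[0, s]) b by rewrite Rintegral_cst// lebseg// mulrC.
rewrite !sa -RintegralB//; last exact: iseg.
have iGa : leb.-integrable `[0, s] (EFin \o (fun t : measurableTypeR R => G i (x + t *: basis_vec R i) - a)).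
  rewrite (_ : _ \o _ = ((EFin \o (fun t : measurableTypeR R => G i (x + t *: basis_vec R i))) \- (EFin \o cst a))%E).
    by apply: integrableB => //; exact: iseg.
  exact/funext.
apply: le_trans (le_normr_Rintegral _ iGa) _ => //.
apply: le_Rintegral => //.
- exact: integrable_norm iGa.
- exact: iseg.
Qed.

Lemma exists_limit_primitive : exists g0 : 'rV[R]_n -> R,
  [/\ forall x, W x -> F m x - F m c @[m --> \oo] --> g0 x,
      forall m x, W x -> `|F m x - F m c| <= n%:R * ((3 * `|M|) * r),
      forall x, W x -> {for x, continuous g0} &
      forall i x, W x -> is_derive x (basis_vec R i) g0 (G i x)].
Proof.
apply: (@limit_primitive R n c r (3 * `|M|) F G I);
  [exact: r_gt0|by rewrite mulr_ge0|exact: FI|exact: FK|exact: Iest|].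
by move=> i x Wx; exact: Gc (WV Wx).
Qed.

Let iphi (phi : 'rV[R]_n -> R) : continuous phi -> (forall y, 0 <= phi y <= 1) ->
  (forall y, ~ W y -> phi y = 0) -> mu.-integrable setT (EFin \o (phi : borelV R n -> R)).
Proof.
move=> cphi phi01 phiW; rewrite (_ : phi = (fun y => phi y * \1_W y)); last first.
  apply/funext => y; rewrite indicE; have [Wy|nWy] := pselect (W y).
    by rewrite mem_set// mulr1.
  by rewrite memNset// mulr0 phiW.
apply: (integrable_bounded_on (M := 1)) => //.
  by apply: measurable_continuous_on => // x _; exact: cphi.
by move=> y _; have /andP[p0 p1] := phi01 y; rewrite ger0_norm.
Qed.

(** Duality moves the mollification from [U] onto the continuous [phi], where it converges pointwise
    and is bounded by 3; dominated convergence with dominant 3 |U| concludes. *)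
Let cvg_conv (phi : 'rV[R]_n -> R) : continuous phi -> (forall y, 0 <= phi y <= 1) ->
  (forall y, ~ W y -> phi y = 0) ->
  \int[mu]_x (phi x * F m x) @[m --> \oo] --> \int[mu]_y (U y * phi y).
Proof.
move=> cphi phi01 phiW; have ip := iphi cphi phi01 phiW.
have mphi : measurable_fun setT (phi : borelV R n -> R) by exact: continuous_measurable_rV.
have phi1 y : `|phi y| <= 1 by have /andP[p0 p1] := phi01 y; rewrite ger0_norm.
pose P m y := \int[mu]_x (phi x * kern (rho m) (y - x)).
have PE m : \int[mu]_x (phi x * F m x) = \int[mu]_y (U y * P m y).
  by have [B rBm] := rB m; exact: (conv_duality (mr m) (r0 m) (@re m) rBm ip iU).
have P3 m y : `|P m y| <= 3.
  have h : `|P m y - phi y| <= 1 + 1.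
    apply: (kern_approx (e_gt0 m) (mr m) (r0 m) (@re m) (@rout m) (r1 m) mphi phi1).
    by move=> z _; apply: le_trans (ler_normB _ _) _; exact: lerD.
  rewrite -[P m y](subrK (phi y)); apply: le_trans (ler_normD _ _) _.
  by have := phi1 y; lra.
have Pcvg y : P m y @[m --> \oo] --> phi y.
  apply/cvgrPdist_le => eta eta0.
  have : nbhs y (fun z => `|phi y - phi z| <= eta).
    by have /(@cvgrPdist_le _ _ _ (nbhs y)) := cphi y; exact.
  move=> /nbhs_ballP[d /= d0 dV]; apply: filterS (e_small d0) => m emd.
  rewrite distrC; apply: (kern_approx (e_gt0 m) (mr m) (r0 m) (@re m) (@rout m) (r1 m) mphi phi1).
  by move=> z yz; rewrite distrC; apply: dV; exact: le_ball yz.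
under eq_fun do rewrite PE.
have mU : measurable_fun setT U by apply/measurable_EFinP; exact: measurable_int iU.
apply: (Rdominated_convergence (f_ := fun m (y : borelV R n) => U y * P m y) (f := fun y : borelV R n => U y * phi y) (g := fun y => `|U y| * 3)).
- exact: measurableT.
- by move=> m; have [B rBm] := rB m; exact: (measurable_mul_conv (mr m) (r0 m) rBm iU ip).
- exact: measurable_funM.
- by move=> y _; apply: cvgM; [exact: cvg_cst|exact: Pcvg].
- apply: (integrable_mul_bounded (M := 3)) => [|//|_]; last by rewrite ger0_norm.
  exact: integrable_norm iU.
- by move=> m y _; rewrite normrM ler_wpM2l.
Qed.

(** Only [F m x - F m c] is known to converge. Pairing with a cutoff [phi] shows that [F m c] times
    the integral of [phi] converges too, which gives a limit [C] of [F m c]; then [U - g0 - C] is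
    orthogonal to all cutoffs of open subsets of [W]. *)
Lemma exists_ae_primitive : exists g1 : 'rV[R]_n -> R,
  [/\ forall x, W x -> {for x, continuous g1},
      forall i x, W x -> is_derive x (basis_vec R i) g1 (G i x) &
      ae_in W (fun x => U x = g1 x)].
Proof.
have [g0 [g0F FB g0c g0d]] := exists_limit_primitive.
set Kn := (X in forall m x, W x -> _ <= X) in FB.
have g0B x : W x -> `|g0 x| <= Kn.
  move=> Wx; have cn : `|F m x - F m c| @[m --> \oo] --> `|g0 x| by apply: cvg_norm; exact: g0F.
  rewrite -(cvg_lim _ cn)//; apply: limr_le; first by apply/cvg_ex; eexists; exact: cn.
  by apply: nearW => m; exact: FB.
have Kn0 : 0 <= Kn by apply: le_trans (g0B _ Wc); exact: normr_ge0.
pose gW : borelV R n -> R := fun x => g0 x * \1_W x.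
have mgW : measurable_fun setT gW by apply: measurable_continuous_on => // x; exact: g0c.
have igW : mu.-integrable setT (EFin \o gW).
  by apply: (integrable_bounded_on (M := Kn)) => // x; exact: g0B.
have m1W : measurable_fun setT (\1_W : borelV R n -> R) by exact: measurable_indic.
have i1W : mu.-integrable setT (EFin \o (\1_W : borelV R n -> R)).
  apply/integrableP; split; first by apply/measurable_EFinP.
  under eq_integral do rewrite /= ger0_norm//.
  by rewrite integral_indic//= setIT.
have indW1 (x : borelV R n) : `|\1_W x| <= (1 : R).
  by rewrite indicE; case: (x \in W); rewrite ?normr1 ?normr0.
pose test (phi : 'rV[R]_n -> R) := [/\ continuous phi, forall y, 0 <= phi y <= 1 &
  forall y, ~ W y -> phi y = 0].
have phi1 phi (tp : test phi) y : `|phi y| <= 1.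
  by have [_ p01 _] := tp; have /andP[p0 p1] := p01 y; rewrite ger0_norm.
have mphi phi (tp : test phi) : measurable_fun setT (phi : borelV R n -> R).
  by have [cp _ _] := tp; exact: continuous_measurable_rV.
(* The left side is the pairing of [phi] with [F m] minus that with [F m - F m c]; the first
   converges by duality, the second is dominated by [phi * Kn]. *)
have key phi : test phi ->
    F m c * \int[mu]_x phi x @[m --> \oo] --> \int[mu]_y (U y * phi y) - \int[mu]_y (gW y * phi y).
  move=> tp; have [cp p01 pW] := tp; have ip := iphi cp p01 pW.
  have cA := cvg_conv cp p01 pW.
  have ipF m : mu.-integrable setT (EFin \o (fun x => phi x * F m x)).
    have A0 : 0 <= Kn + `|F m c| by rewrite addr_ge0.
    have ipK : mu.-integrable setT (EFin \o (fun x : borelV R n => phi x * cst (Kn + `|F m c|) x)).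
      by apply: (integrable_mul_bounded (M := Kn + `|F m c|) ip) => [//|x /=]; rewrite ger0_norm.
    apply: (le_integrable _ _ _ ipK) => //.
      apply/measurable_EFinP; have [B rBm] := rB m.
      exact: (measurable_mul_conv (mr m) (r0 m) rBm ip iU).
    move=> x _ /=; rewrite lee_fin !normrM.
    have [Wx|nWx] := pselect (W x); last by rewrite pW// normr0 !mul0r.
    rewrite ler_wpM2l// (ger0_norm A0) -[F m x](subrK (F m c)).
    by apply: le_trans (ler_normD _ _) _; rewrite lerD2r FB.
  have cB : \int[mu]_x (phi x * (F m x - F m c)) @[m --> \oo] --> \int[mu]_y (gW y * phi y).
    apply: (Rdominated_convergence (f_ := fun m (x : borelV R n) => phi x * (F m x - F m c)) (f := fun y : borelV R n => gW y * phi y) (g := fun y : borelV R n => phi y * Kn)).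
    - exact: measurableT.
    - move=> m; rewrite (_ : (fun x => _) = (fun x => phi x * F m x - phi x * F m c)); last first.
        by apply/funext => x; rewrite mulrBr.
      apply: measurable_funB; last by apply: measurable_funM => //; exact: mphi.
      have [B rBm] := rB m; exact: (measurable_mul_conv (mr m) (r0 m) rBm ip iU).
    - by apply: measurable_funM => //; exact: mphi.
    - move=> x _; have [Wx|nWx] := pselect (W x); last first.
        by rewrite pW// mulr0; under eq_fun do rewrite mul0r; exact: cvg_cst.
      rewrite /gW indicE mem_set// mulr1 mulrC; apply: cvgM; first exact: cvg_cst.
      exact: g0F.
    - by apply: (integrable_mul_bounded (M := Kn)) => // _; rewrite ger0_norm.
    - move=> m x _; rewrite normrM ger0_norm; last by have /andP[] := p01 x.
      have [Wx|nWx] := pselect (W x); last by rewrite pW// !mul0r.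
      by apply: ler_wpM2l; [have /andP[] := p01 x|exact: FB].
  rewrite (_ : (fun m => _) = (fun m => \int[mu]_x (phi x * F m x) - \int[mu]_x (phi x * (F m x - F m c)))).
    exact: cvgB cA cB.
  apply/funext => m.
  have iB : mu.-integrable setT (EFin \o (fun x => phi x * (F m x - F m c))).
    rewrite (_ : (fun x => _) = (fun x => phi x * F m x - phi x * F m c)); last first.
      by apply/funext => x; rewrite mulrBr.
    by apply: integrable_subR => //; exact: integrable_mulR.
  rewrite -RintegralB// -RintegralZl//; apply: eq_Rintegral => x _; ring.
have [phik [ck k01 kW kcvg]] := exists_cutoff oW.
have tk k : test (phik k) by split; [exact: ck|exact: k01|exact: kW].
have m_gt0 : 0 < fine (mu W).
  by rewrite /W muV_ball//= exprn_gt0// mulrn_wgt0.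
have lim_k : \int[mu]_x phik k x @[k --> \oo] --> fine (mu W).
  have <- : \int[mu]_x (\1_W x) = fine (mu W).
    by rewrite /Rintegral integral_indic// setIT.
  apply: (Rdominated_convergence (f_ := phik : nat -> borelV R n -> R) (f := \1_W) (g := \1_W)) => //.
  - by move=> k; exact: mphi.
  - move=> k x _; have [Wx|nWx] := pselect (W x); last by rewrite kW// normr0.
    by rewrite indicE mem_set//; exact: phi1.
(* The integrals of the cutoffs tend to the positive measure of [W], so they are not all zero. *)
have [k0 k0P] : exists k, \int[mu]_x phik k x != 0.
  apply: contrapT => /forallNP h; have z k : \int[mu]_x phik k x = 0.
    by apply/eqP; have := h k; move/negP; rewrite negbK.
  move: lim_k; under eq_fun do rewrite z.
  move=> /(cvg_lim _) => /(_ (@norm_hausdorff _ _)) E; move: m_gt0; rewrite -E.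
  by rewrite lim_cst ?ltxx//; exact: norm_hausdorff.
pose C := (\int[mu]_y (U y * phik k0 y) - \int[mu]_y (gW y * phik k0 y)) / \int[mu]_x phik k0 x.
have aC : F m c @[m --> \oo] --> C.
  rewrite (_ : (fun m => F m c) = (fun m => (F m c * \int[mu]_x phik k0 x) * (\int[mu]_x phik k0 x)^-1)).
    by apply: cvgM; [exact: key|exact: cvg_cst].
  by apply/funext => m; rewrite mulfK.
have eqC phi : test phi ->
    C * \int[mu]_x phi x = \int[mu]_y (U y * phi y) - \int[mu]_y (gW y * phi y).
  move=> tp; rewrite -(cvg_lim (@norm_hausdorff _ _) (key phi tp)).
  apply/esym/cvg_lim; first exact: norm_hausdorff.
  by apply: cvgM; [exact: aC|exact: cvg_cst].
(* This is [U - g0 - C] on [W] and 0 elsewhere. *)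
pose w : borelV R n -> R := fun x => (U x * \1_W x - gW x) - \1_W x * C.
have iw : mu.-integrable setT (EFin \o w).
  apply: integrable_subR => //; last exact: integrable_mulR.
  by apply: integrable_subR => //; exact: (integrable_mul_bounded iU m1W indW1).
have w0 phi : test phi -> \int[mu]_x (w x * phi x) = 0.
  move=> tp; have [cp p01 pW] := tp; have ip := iphi cp p01 pW.
  have iUp := integrable_mul_bounded iU (mphi _ tp) (phi1 _ tp).
  have igp := integrable_mul_bounded igW (mphi _ tp) (phi1 _ tp).
  transitivity (\int[mu]_x ((U x * phi x - gW x * phi x) - phi x * C)).
    apply: eq_Rintegral => x _; rewrite /w.
    have [Wx|nWx] := pselect (W x); last by rewrite pW// !mulr0 mul0r !subr0.
    by rewrite indicE mem_set// mulr1 mul1r; ring.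
  rewrite RintegralB//; last 2 first.
  - exact: integrable_subR.
  - exact: integrable_mulR.
  by rewrite RintegralB// RintegralZr// -(eqC _ tp) mulrC subrr.
have mw : measurable_fun setT w by apply/measurable_EFinP; exact: measurable_int iw.
have wO (O : set 'rV[R]_n) : open O -> \int[mu]_(x in O) w x = 0.
  (* Cutoffs of the intersection with [W] are admissible tests and tend to its indicator; as [w]
     vanishes off [W], the limit is the integral over [O]. *)
  move=> oO; have oOW : open (O `&` W) by exact: openI.
  have mOW := open_measurableV oOW.
  have [psi [psic psi01 psiO psicvg]] := exists_cutoff oOW.
  have tpsi k : test (psi k) by split=> // y nW; apply: psiO => -[].
  have lim0 : \int[mu]_x (w x * psi k x) @[k --> \oo] --> \int[mu]_x (w x * \1_(O `&` W) x).
    apply: (Rdominated_convergence (f_ := fun k (x : borelV R n) => w x * psi k x)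
      (f := fun x : borelV R n => w x * \1_(O `&` W) x) (g := fun x => `|w x|)) => //.
    - by move=> k; apply: measurable_funM => //; exact: mphi.
    - by apply: measurable_funM => //; exact: measurable_indic.
    - by move=> x _; apply: cvgM; [exact: cvg_cst|exact: psicvg].
    - exact: integrable_norm iw.
    - by move=> k x _; rewrite normrM -[leRHS]mulr1 ler_wpM2l// phi1.
  rewrite Rintegral_mkcond.
  transitivity (\int[mu]_x (w x * \1_(O `&` W) x)).
    apply: eq_Rintegral => x _; rewrite patchE !indicE in_setI.
    case: (x \in O) => /=; last by rewrite mulr0.
    case: (boolP (x \in W)) => [_|xW]; first by rewrite mulr1.
    by rewrite /w /gW indicE (negbTE xW) !mulr0 mul0r !subr0.
  move: lim0; under eq_fun do rewrite w0//.
  by move=> /(cvg_lim (@norm_hausdorff _ _)) <-; rewrite lim_cst//; exact: norm_hausdorff.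
have wae := ae_eq0_of_open iw wO.
exists (fun x => g0 x + C); split.
- by move=> x Wx; apply: (@continuousD _ _ _ g0 (cst C)); [exact: g0c|exact: cst_continuous].
- move=> i x Wx; have := is_deriveD (g0d i x Wx) (is_derive_cst C x (basis_vec R i)).
  by rewrite addr0.
apply/null_setE; move: wae => [N [mN N0 sN]]; exists N; split=> // x /= [Wx Ux].
apply: sN => /= h; apply: Ux; have := h Logic.I; rewrite /w /gW indicE mem_set//.
by rewrite !mulr1 mul1r => -[]; lra.
Qed.
End LocalPrimitive.

(** * Smoothness of the weak Jacobian *)

Section FunctionAlgebra.
Variables (T : Type) (R : comNzRingType) (S : (T -> R) -> Prop).
Hypothesis Scst : forall a, S (fun=> a).
Hypothesis Sadd : forall f g, S f -> S g -> S (fun t => f t + g t).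
Hypothesis Smul : forall f g, S f -> S g -> S (fun t => f t * g t).

Lemma closed_sum (I : Type) (r : seq I) (P : pred I) (F : I -> T -> R) :
  (forall i, S (F i)) -> S (fun t => \sum_(i <- r | P i) F i t).
Proof.
move=> SF; elim: r => [|i r IH].
  by rewrite (_ : (fun _ => _) = fun=> 0)//; apply/funext => t; rewrite big_nil.
rewrite (_ : (fun _ => _) = fun t => (if P i then F i t else 0) + \sum_(i <- r | P i) F i t).
  by apply: Sadd => //; case: (P i).
by apply/funext => t; rewrite big_cons; case: (P i); rewrite ?add0r.
Qed.

Lemma closed_prod (I : Type) (r : seq I) (P : pred I) (F : I -> T -> R) :
  (forall i, S (F i)) -> S (fun t => \prod_(i <- r | P i) F i t).
Proof.
move=> SF; elim: r => [|i r IH].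
  by rewrite (_ : (fun _ => _) = fun=> 1)//; apply/funext => t; rewrite big_nil.
rewrite (_ : (fun _ => _) = fun t => (if P i then F i t else 1) * \prod_(i <- r | P i) F i t).
  by apply: Smul => //; case: (P i).
by apply/funext => t; rewrite big_cons; case: (P i); rewrite ?mul1r.
Qed.

Definition entries_closed m n (A : T -> 'M[R]_(m, n)) := forall i j, S (fun t => A t i j).

(** The class [S] is instantiated twice: by continuity at the pair (x0, x0) and by smoothness on a
    ball. *)
Lemma closed_det n (A : T -> 'M[R]_n) : entries_closed A -> S (fun t => \det (A t)).
Proof.
by move=> SA; apply: closed_sum => s; apply: Smul => //; apply: closed_prod => i.
Qed.

Lemma closed_adj n (A : T -> 'M[R]_n) : entries_closed A -> entries_closed (fun t => \adj (A t)).
Proof.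
move=> SA i j; rewrite (_ : (fun _ => _) = fun t => (-1) ^+ (j + i) * \det (row' j (col' i (A t)))).
  apply: Smul => //; apply: (@closed_det _ (fun t => row' j (col' i (A t)))) => a b.
  by rewrite (_ : (fun _ => _) = fun t => A t (lift j a) (lift i b))//; apply/funext => t; rewrite !mxE.
by apply/funext => t; rewrite mxE.
Qed.

Lemma closed_mulmx m n p (A : T -> 'M[R]_(m, n)) (B : T -> 'M[R]_(n, p)) :
  entries_closed A -> entries_closed B -> entries_closed (fun t => A t *m B t).
Proof.
move=> SA SB i j; rewrite (_ : (fun _ => _) = fun t => \sum_k A t i k * B t k j).
  by apply: closed_sum => k; exact: Smul.
by apply/funext => t; rewrite mxE.
Qed.

End FunctionAlgebra.

Section PowR.
Variable R : realType.

Lemma C1k_eq k (D : set R) (p q : R -> R) : open D -> (forall t, D t -> p t = q t) ->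
  C1k k D p -> C1k k D q.
Proof.
move=> oD; elim: k p q => [|k IH] p q pq.
all: have npq t : D t -> \forall s \near t, p s = q s
  by move=> Dt; apply: filterS (open_nbhs_nbhs (conj oD Dt)).
  move=> cp t Dt; move: (cp _ Dt); rewrite /prop_for /continuous_at (pq _ Dt) => pt.
  exact: cvg_trans (near_eq_cvg (npq _ Dt)) pt.
move=> [dp Cp]; split=> [t Dt|]; first exact: near_eq_derivable (npq _ Dt) (dp _ Dt).
apply: IH Cp => t Dt; rewrite !derive1E; exact: near_eq_derive (npq _ Dt).
Qed.

Lemma C1k_scale k (D : set R) (p : R -> R) (a : R) : open D -> C1k k D p ->
  C1k k D (fun t => a * p t).
Proof.
move=> oD; elim: k p => [|k IH] p.
  by move=> cp t Dt; apply: continuousM; [exact: cst_continuous|exact: cp].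
move=> [dp Cp]; split=> [t Dt|].
  by apply: derivableM; [exact: derivable_cst|exact: dp].
apply: (C1k_eq oD) (IH _ Cp) => t Dt.
rewrite !derive1E (@deriveM _ _ (cst a) p)//; last exact: dp.
by rewrite derive_cst scaler0 addr0.
Qed.

(** The exponent varies in the induction, since the derivative is a t^(a - 1). *)
Lemma C1k_powR k (a : R) : C1k k [set t | 0 < t] (fun t => t `^ a).
Proof.
have oD : open [set t : R | 0 < t] by exact: open_gt.
elim: k a => [|k IH] a.
  move=> t /= t0; apply/differentiable_continuous/derivable1_diffP.
  by case: (is_derive1_powR a t0).
split=> [t /= t0|]; first by case: (is_derive1_powR a t0).
apply: (C1k_eq oD) (C1k_scale a oD (IH (a - 1))) => t /= t0.
by rewrite derive1E (@derive_val _ _ _ _ _ _ _ (is_derive1_powR a t0)).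
Qed.
End PowR.

Section AlmostEverywhere.
Variables (R : realType) (n : nat).
Implicit Types (Om V : set 'rV[R]_n) (P Q : 'rV[R]_n -> Prop).

Lemma ae_inS Om V P : V `<=` Om -> ae_in Om P -> ae_in V P.
Proof.
move=> VO /null_setE nP; apply/null_setE; apply: negligibleS nP => x [Vx nPx].
by split=> //; exact: VO.
Qed.

Lemma ae_in_imp Om P Q : (forall x, Om x -> P x -> Q x) -> ae_in Om P -> ae_in Om Q.
Proof.
move=> PQ /null_setE nP; apply/null_setE; apply: negligibleS nP => x [Ox nQx].
by split=> // Px; apply: nQx; exact: PQ.
Qed.

Lemma ae_in_and Om P Q : ae_in Om P -> ae_in Om Q -> ae_in Om (fun x => P x /\ Q x).
Proof.
move=> /null_setE nP /null_setE nQ; apply/null_setE.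
apply: negligibleS (negligibleU nP nQ) => x [Ox /not_andP[h|h]]; [left|right]; by split.
Qed.

Lemma ae_in_all (J : finType) Om (P : J -> 'rV[R]_n -> Prop) :
  (forall j, ae_in Om (P j)) -> ae_in Om (fun x => forall j, P j x).
Proof.
move=> aP; suff : forall s : seq J, ae_in Om (fun x => forall j, j \in s -> P j x).
  by move=> /(_ (enum J)); apply: ae_in_imp => x _ h j; apply: h; rewrite mem_enum.
elim=> [|j s IH].
  by apply/null_setE; apply: negligibleS (negligible_set0 _) => x [_ []].
apply: ae_in_imp (ae_in_and (aP j) IH) => x _ [h1 h2] j'.
by rewrite inE => /predU1P[->//|]; exact: h2.
Qed.

(** A nonempty open set contains a ball, which has positive measure. *)
Lemma ae_in_ex V P : open V -> V !=set0 -> ae_in V P -> exists2 x, V x & P x.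
Proof.
move=> oV [x0 Vx0] /null_setE nP; apply: contrapT => /forall2NP h.
have /nbhs_ballP[e /= e0 eV] : nbhs x0 V by exact: open_nbhs_nbhs.
have nb : negligible (muV R n) (ball x0 e : set (borelV R n)).
  apply: negligibleS nP => x xe; split; first exact: eV.
  by case: (h x) => // nV; have := eV _ xe.
have mB : measurable (ball x0 e : set (borelV R n)) by exact: ball_measurableV.
have := (negligibleP (muV R n) mB).1 nb => B0.
have := muV_ball x0 e0; rewrite B0 => -[] /esym/eqP.
by rewrite gt_eqF// exprn_gt0// mulrn_wgt0.
Qed.

End AlmostEverywhere.

(** * Local smooth formula for the weak Jacobian *)

Section LocalJacobian.
Variables (R : realType) (d k : nat).
Implicit Types (Om V : set 'rV[R]_d) (x y : 'rV[R]_d).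

(** L(y)^-1 L(x) for t = (y, x), with the inverse spelled out through the adjugate so that the
    entries are rational in those of [L]. *)
Definition quotient_mx m (L : 'rV[R]_d -> 'M[R]_m) (t : 'rV[R]_d * 'rV[R]_d) : 'M[R]_m :=
  ((\det (L t.1))^-1 *: \adj (L t.1)) *m L t.2.

Lemma quotient_mxE m (L : 'rV[R]_d -> 'M[R]_m) x y : L x \in unitmx ->
  quotient_mx L (x, y) = invmx (L x) *m L y.
Proof. by move=> Lx; rewrite /quotient_mx /invmx Lx. Qed.

Let cont (T : topologicalType) (t0 : T) (f : T -> R) := {for t0, continuous f}.

Let contC (T : topologicalType) (t0 : T) a : cont t0 (fun=> a).
Proof. exact: cst_continuous. Qed.

Let contD (T : topologicalType) (t0 : T) f g : cont t0 f -> cont t0 g -> cont t0 (fun t => f t + g t).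
Proof. exact: continuousD. Qed.

Let contM (T : topologicalType) (t0 : T) f g : cont t0 f -> cont t0 g -> cont t0 (fun t => f t * g t).
Proof. exact: continuousM. Qed.

Lemma quotient_mx_cont Om m (L : 'rV[R]_d -> 'M[R]_m) x0 : smooth_mx_on Om L -> Om x0 ->
  L x0 \in unitmx ->
  entries_closed (cont (x0, x0)) (quotient_mx L).
Proof.
move=> sL Ox Lu; have cL a b : {for x0, continuous (fun y => L y a b)}.
  by have [_] := sL a b [::] x0 Ox.
have c1 : entries_closed (cont (x0, x0)) (fun t : 'rV[R]_d * 'rV[R]_d => L t.1).
  move=> a b; apply: (@continuous_comp _ _ _ fst (fun y => L y a b)); first exact: cvg_fst.
  exact: cL.
have c2 : entries_closed (cont (x0, x0)) (fun t : 'rV[R]_d * 'rV[R]_d => L t.2).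
  move=> a b; apply: (@continuous_comp _ _ _ snd (fun y => L y a b)); first exact: cvg_snd.
  exact: cL.
have cC := @contC _ (x0, x0); have cD := @contD _ (x0, x0); have cM := @contM _ (x0, x0).
apply: (closed_mulmx cC cD cM (A := fun t => (\det (L t.1))^-1 *: \adj (L t.1)) (B := fun t => L t.2)) => // a b.
rewrite (_ : (fun _ => _) = fun t => (\det (L t.1))^-1 * \adj (L t.1) a b); last first.
  by apply/funext => t; rewrite mxE.
apply: contM; last exact: (closed_adj cC cD cM c1).
apply: continuousV; first by rewrite /= -unitfE -unitmxE.
exact: (closed_det cC cD cM c1).
Qed.

Lemma recover_closed (T : Type) (S : (T -> R) -> Prop) N
  (W : 'I_d -> 'I_d -> 'M[R]_N -> 'M[R]_k.+2) (A : T -> 'M[R]_N) :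
  (forall a, S (fun=> a)) -> (forall f g, S f -> S g -> S (fun t => f t + g t)) ->
  (forall f g, S f -> S g -> S (fun t => f t * g t)) ->
  (forall i j a, S (fun t => \det (W i j (A t)) `^ a)) ->
  (forall i j, entries_closed S (fun t => W i j (A t))) ->
  entries_closed S (fun t => recover W (A t)).
Proof.
move=> SC SD SM SP SW i j.
rewrite (_ : (fun _ => _) = fun t => \det (W i j (A t)) `^ (k.+1%:R^-1) * \det (W i j (A t)) `^ (-1)
                  * \adj (W i j (A t)) 0 (pos k i j)); last first.
  by apply/funext => t; rewrite mxE.
by apply SM; [apply SM; exact: SP|exact: closed_adj].
Qed.

Lemma local_jacobian Om (Df : 'rV[R]_d -> 'M[R]_d) (L : 'rV[R]_d -> 'M[R]_#|{: ksubset d k.+1}|) s x0 :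
  (k.+2 <= d)%N -> open Om -> smooth_mx_on Om L -> (forall x, Om x -> L x \in unitmx) ->
  ae_in Om (fun x => L x = compound k.+1 (Df x)) ->
  odd k.+1 \/ (odd d /\ ae_in Om (fun x => 0 < s * \det (Df x))) ->
  Om x0 -> exists2 r, 0 < r & ball x0 r `<=` Om /\
    exists G, smooth_mx_on (ball x0 r) G /\ ae_in (ball x0 r) (fun x => Df x = G x).
Proof.
move=> kd oO sL Lu aeL sgn Ox0.
have [W [Wlin W1 Wrec]] := @compound_recover R d k kd.
pose N := quotient_mx L.
have cN := quotient_mx_cont sL Ox0 (Lu _ Ox0).
have N1 : N (x0, x0) = 1%:M by rewrite /N quotient_mxE ?mulVmx// Lu.
have cW i j : entries_closed (cont (x0, x0)) (fun t => W i j (N t)).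
  move=> a b; have [c [I [J WE]]] := Wlin i j a b.
  rewrite (_ : (fun _ => _) = fun t => c * N t I J); last by apply/funext => t; rewrite WE.
  by apply: contM; [exact: contC|exact: cN].
have cC := @contC _ (x0, x0); have cD := @contD _ (x0, x0); have cM := @contM _ (x0, x0).
have cdet i j : cont (x0, x0) (fun t => \det (W i j (N t))).
  exact: (closed_det cC cD cM (cW i j)).
have cadj i j := closed_adj cC cD cM (cW i j).
have W1' i j : W i j (N (x0, x0)) = 1%:M by rewrite N1 W1.
have crec : entries_closed (cont (x0, x0)) (fun t => recover W (N t)).
  apply: recover_closed => //.
  move=> i j a; apply: (@continuous_comp _ _ _ (fun t => \det (W i j (N t))) (fun u => u `^ a)); first exact: cdet.
  apply: (C1k_cont (C1k_powR 0 a)); rewrite /= W1' det1; exact: ltr01.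
have posn (f : 'rV[R]_d * 'rV[R]_d -> R) : cont (x0, x0) f -> 0 < f (x0, x0) ->
    \forall t \near (x0, x0), 0 < f t.
  by move=> cf f0; have := cf _ (lt_nbhsr f0).
(* The hypotheses of [Wrec] are secured jointly in base point and variable, because the base point
   is not chosen yet. *)
have near1 : \forall t \near (x0, x0), [/\ forall i j, 0 < \det (W i j (N t)),
    forall i j a, 0 < \adj (W i j (N t)) a a & 0 < \det (recover W (N t))].
  near=> t; split.
  - near: t; apply: filter_forall => i; apply: filter_forall => j.
    by apply: posn; [exact: cdet|rewrite W1' det1].
  - near: t; apply: filter_forall => i; apply: filter_forall => j; apply: filter_forall => a.
    by apply: posn; [exact: cadj|rewrite W1' adjugate1 mxE eqxx].
  - near: t; apply: posn; first exact: (closed_det cC cD cM crec).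
    by rewrite recover1 ?det1.
have : \forall x \near x0, Om x by exact: open_nbhs_nbhs.
(* A neighbourhood of (x0, x0) contains a product of neighbourhoods; the ball is taken in both
   factors, so base point and variable may range over it freely. *)
case: near1 => -[A B] /= [nA nB] AB nO.
have nV : nbhs x0 (A `&` (B `&` Om)) by apply: filterI => //; exact: filterI.
have /nbhs_ballP[r /= r0 rV] := nV.
have rO x : ball x0 r x -> Om x by move=> /rV[_ []].
have oV : open (ball x0 r : set 'rV[R]_d) by exact: ball_open.
pose sg x := odd k.+1 \/ (odd d /\ 0 < s * \det (Df x)).
have aesg : ae_in Om sg.
  case: sgn => [ok|[od ae_s]]; last by apply: ae_in_imp ae_s => x _ h; right.
  by apply: ae_in_imp aeL => x _ _; left.
have good := ae_inS rO (ae_in_and aeL aesg).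
(* The base point is one where [L] is the true compound and the sign condition holds. *)
have [x1 Vx1 [L1 sg1]] := ae_in_ex oV (ex_intro _ x0 (ballxx x0 r0)) good.
exists r => //; split; first exact: rO.
pose A1 := Df x1; have kd' : (0 < k.+1 <= d)%N by rewrite /= ltnW.
have A1u : A1 \in unitmx by apply: (compound_unitmx kd'); rewrite -L1; exact: Lu (rO _ Vx1).
have cA1V : compound k.+1 (invmx A1) = invmx (L x1).
  have L1u := Lu _ (rO _ Vx1).
  apply: (can_inj (mulKmx L1u)); rewrite mulmxV// {1}L1 -compoundM mulmxV//.
  exact: compound1.
have P x (Vx : ball x0 r x) := AB (x1, x) (conj (rV _ Vx1).1 (rV _ Vx).2.1).
(* df_x = df_x1 (df_x1^-1 df_x), the second factor being recovered from the representative and hence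
   defined on the whole ball. *)
exists (fun x => A1 *m recover W (N (x1, x))); split; last first.
  apply: ae_in_imp good => x Vx [Lx sgx].
  have [P1 P2 P3] := P x Vx.
  have NE : N (x1, x) = compound k.+1 (invmx A1 *m Df x).
    by rewrite /N quotient_mxE ?Lu//; [rewrite compoundM cA1V -Lx|exact: rO].
  rewrite NE -Wrec -?NE//; first by rewrite mulmxA mulmxV// mul1mx.
  case: sgx => [ok|[od dx]]; first by left.
  case: sg1 => [ok|[_ d1]]; first by left.
  right; split=> //.
  (* The sign [s] enters squared, so positive and negative determinants are treated alike. *)
  have dd : 0 < \det A1 * \det (Df x).
    have := mulr_gt0 d1 dx; rewrite mulrACA -expr2 pmulr_rgt0//.
    by rewrite exprn_even_gt0//=; apply: contraTneq d1 => ->; rewrite mul0r ltxx.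
  have a0 : \det A1 != 0 by rewrite -unitfE -unitmxE.
  rewrite det_mulmx det_inv (_ : _ * _ = (\det A1 * \det (Df x)) / \det A1 ^+ 2); last by field.
  by rewrite divr_gt0// exprn_even_gt0.
have smooth_of (f : 'rV[R]_d -> R) : (forall m, Ck m (ball x0 r) f) -> smooth_on (ball x0 r) f.
  by move/smooth_onP.
pose S (f : 'rV[R]_d -> R) := forall m, Ck m (ball x0 r) f.
have SC a : S (fun=> a) by move=> m; exact: Ck_cst.
have SD f g : S f -> S g -> S (fun t => f t + g t).
  by move=> Sf Sg m; exact: (Ck_add oV (Sf m) (Sg m)).
have SM f g : S f -> S g -> S (fun t => f t * g t).
  by move=> Sf Sg m; exact: (Ck_mul oV (Sf m) (Sg m)).
have SN : entries_closed S (fun x => N (x1, x)).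
  apply: (closed_mulmx SC SD SM (A := fun=> (\det (L x1))^-1 *: \adj (L x1)) (B := L)) => a b; first exact: SC.
  by move=> m; apply: (Ck_sub rO); move: m; apply/smooth_onP; exact: sL.
have SW i j : entries_closed S (fun x => W i j (N (x1, x))).
  move=> a b; have [c [I [J WE]]] := Wlin i j a b.
  rewrite (_ : (fun _ => _) = fun x => c * N (x1, x) I J); last by apply/funext => t; rewrite WE.
  by apply: SM; [exact: SC|exact: SN].
have Srec : entries_closed S (fun x => recover W (N (x1, x))).
  apply: recover_closed => // i j a m.
  apply: (Ck_comp (D := [set t | 0 < t]) oV _ _ (C1k_powR m a)) => [x Vx|].
    by have [P1 _ _] := P x Vx; exact: P1.
  exact: (closed_det SC SD SM (SW i j)).
move=> a b; apply: smooth_of.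
by apply: (closed_mulmx SC SD SM (A := fun=> A1)) => // i j; exact: SC.
Unshelve. all: by end_near. Qed.
End LocalJacobian.

(** * Smoothness of the map *)

Section Local.
Variables (R : realType) (n : nat).
Implicit Types (Om V : set 'rV[R]_n) (x y c : 'rV[R]_n).

Lemma local_smooth_primitive Om p u (v G : 'I_n -> 'rV[R]_n -> R) c r M :
  1 <= p -> open Om -> 0 < r -> ball c (r + r) `<=` Om ->
  Lp Om p u -> (forall i, Lp Om p (v i)) -> (forall i, weak_pder Om i u (v i)) ->
  (forall i, ae_in (ball c (r + r)) (fun x => v i x = G i x)) ->
  (forall i, smooth_on (ball c (r + r)) (G i)) ->
  (forall i x, ball c (r + r) x -> `|G i x| <= M) ->
  exists g, smooth_on (ball c r) g /\ ae_in (ball c r) (fun x => u x = g x).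
Proof.
move=> p1 oO r0 VO Lu Lv uv vG sG GM.
pose V : set 'rV[R]_n := ball c (r + r); pose W : set 'rV[R]_n := ball c r.
have oV : open V by exact: ball_open.
have oW : open W by exact: ball_open.
have WV : W `<=` V by move=> x; apply: le_ball; rewrite lerDl ltW.
have mV := open_measurableV oV; have mO := open_measurableV oO.
have Voo : (muV R n V < +oo)%E by rewrite muV_ball ?ltry// addr_gt0.
have Gc i x : V x -> {for x, continuous (G i)} by move=> Vx; have [_] := sG i [::] x Vx.
have iU := Lp_integrable_restrict p1 Lu VO mO mV Voo.
have [|g [gc gd ug]] := exists_ae_primitive r0 iU Gc GM.
  move=> i phi tphi; apply: (weak_identity p1 oO oV VO Voo Lu (Lv i) (uv i) (vG i)) => //.
  by apply: measurable_continuous_on => // x; exact: Gc.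
exists g; split; last first.
  apply: ae_in_imp ug => x Wx; rewrite indicE mem_set ?mulr1//; exact: WV.
apply/smooth_onP => -[|k]; split=> // i; split=> [x Wx|]; first by case: (gd i x Wx).
apply: (@Ck_eq _ _ _ _ (G i)) => //.
  by move=> x Wx; rewrite /pder (@derive_val _ _ _ _ _ _ _ (gd i x Wx)).
by apply: (Ck_sub WV); move: k; apply/smooth_onP; exact: sG.
Qed.

(** The set where two continuous functions differ is open, and a null open set is empty. *)
Lemma eq_of_ae V (f g : 'rV[R]_n -> R) : open V ->
  (forall x, V x -> {for x, continuous f}) -> (forall x, V x -> {for x, continuous g}) ->
  ae_in V (fun x => f x = g x) -> forall x, V x -> f x = g x.
Proof.
move=> oV cf cg fg x Vx; apply/eqP; apply: contraT => fgx.
have d0 : 0 < `|f x - g x| by rewrite normr_gt0 subr_eq0.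
have nfg : \forall y \near x, 0 < `|f y - g y|.
  have c : {for x, continuous (fun y => `|f y - g y|)}.
    apply: (@continuous_comp _ _ _ (fun y => f y - g y) Num.norm); last exact: norm_continuous.
    by apply: continuousB; [exact: cf|exact: cg].
  exact: (c _ (lt_nbhsr d0)).
have nV : nbhs x (V `&` (fun y => 0 < `|f y - g y|)).
  by apply: filterI => //; exact: open_nbhs_nbhs.
have /nbhs_ballP[r /= r0 rV] := nV.
have [] := @ae_in_ex _ _ (ball x r) (fun y => f y = g y) (ball_open _ _).
- by exists x; exact: ballxx.
- by apply: ae_inS fg => y /rV[].
move=> y /rV[_ +] E; by rewrite E subrr normr0 ltxx.
Qed.

(* Local representatives patch together by [eq_of_ae]; the null sets are collected over countably many rational cubes. *)
Lemma glue_smooth Om (u : 'rV[R]_n -> R) : open Om ->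
  (forall x, Om x -> exists2 r, 0 < r & ball x r `<=` Om /\
     exists g, smooth_on (ball x r) g /\ ae_in (ball x r) (fun y => u y = g y)) ->
  exists g, smooth_on Om g /\ ae_in Om (fun y => u y = g y).
Proof.
move=> oO loc.
have H x : exists rg : R * ('rV[R]_n -> R), Om x -> [/\ 0 < rg.1, ball x rg.1 `<=` Om,
    smooth_on (ball x rg.1) rg.2 & ae_in (ball x rg.1) (fun y => u y = rg.2 y)].
  (* The pair (0, u) is a filler outside [Om], so that [choice] can be applied to all points. *)
  have [Ox|nOx] := pselect (Om x); last by exists (0, u).
  by have [r r0 [rO [g [sg ug]]]] := loc x Ox; exists (r, g).
have [rg rgP] := choice H.
(* Each point uses the representative centred at it; [gE] shows that on a whole ball this agrees
   with the representative of the centre. *)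
pose g y := (rg y).2 y.
have gE x y : Om x -> ball x (rg x).1 y -> g y = (rg x).2 y.
  move=> Ox xy; have [rx0 rxO sx ux] := rgP x Ox.
  have Oy := rxO _ xy; have [ry0 ryO sy uy] := rgP y Oy.
  have oI : open (ball x (rg x).1 `&` ball y (rg y).1) by apply: openI; exact: ball_open.
  apply: (@eq_of_ae _ (rg y).2 (rg x).2 oI) => [z [xz yz]|z [xz yz]||].
  - by have [_] := sy [::] z yz.
  - by have [_] := sx [::] z xz.
  - have := ae_in_and (ae_inS (@subIsetl _ _ _) ux) (ae_inS (@subIsetr _ _ _) uy).
    by apply: ae_in_imp => z _ [<- <-].
  - by split=> //; exact: ballxx.
exists g; split.
  apply/smooth_onP => k.
  have loc_k x : Om x -> Ck k (ball x (rg x).1) g.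
    move=> Ox; have [rx0 rxO sx ux] := rgP x Ox.
    apply: (@Ck_eq _ _ _ _ (rg x).2); first exact: ball_open.
      by move=> y xy; rewrite (gE x).
    exact: (smooth_onP _ _).1 sx k.
  (* Generalised from [g] to any [h], because the induction passes to partial derivatives. *)
  suff : forall h, (forall x, Om x -> Ck k (ball x (rg x).1) h) -> Ck k Om h by apply.
  elim: k {loc_k} => [|k IH] h hk; split=> //.
  - move=> x Ox; have [rx0 _ _ _] := rgP x Ox.
    by apply: Ck_cont (hk x Ox) _; exact: ballxx.
  - move=> x Ox; have [rx0 _ _ _] := rgP x Ox.
    by apply: Ck_cont (hk x Ox) _; exact: ballxx.
  move=> i; split=> [x Ox|].
    have [rx0 _ _ _] := rgP x Ox; have [_ /(_ i)[+ _]] := hk x Ox.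
    by apply; exact: ballxx.
  by apply: IH => x Ox; have [_ /(_ i)[_]] := hk x Ox.
pose T q := exists2 x, Om x & ratball q `<=` ball x (rg x).1.
pose bad : set 'rV[R]_n := [set y | Om y /\ ~ u y = g y].
have : negligible (muV R n) (\bigcup_m (if unpickle m is Some q then
    (if `[< T q >] then bad `&` ratball q else set0) else set0) : set (borelV R n)).
  apply: negligible_bigcup => m; case: (unpickle m) => [q|]; last exact: negligible_set0.
  case: asboolP => [[x Ox qx]|_]; last exact: negligible_set0.
  have [rx0 rxO sx ux] := rgP x Ox; move/null_setE : ux; apply: negligibleS.
  move=> y [[Oy uy] qy]; split; first exact: qx.
  by move=> h; apply: uy; rewrite h (gE x)//; exact: qx.
move=> nb; apply/null_setE; apply: negligibleS nb => y by_.
have [Oy _] := by_; have [ry0 ryO _ _] := rgP y Oy.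
have [q [qy qr]] := ratball_between y ry0.
exists (pickle q) => //; rewrite pickleK; case: asboolP => [_|]; first by split.
by case; exists y.
Qed.

End Local.

Theorem mainTheorem1 (R : realType) (d k : nat) (p : R)
    (Omega : set 'rV[R]_d) (f : 'rV[R]_d -> 'rV[R]_d)
    (Df : 'rV[R]_d -> 'M[R]_d) :
  (2 < d)%N -> open Omega ->
  (2 <= k)%N -> (k <= d.-1)%N -> 1 <= p ->
  sobolev_W1p Omega p f Df ->
  (* the sign assumption on det df, which may be dropped when k is odd *)
  (odd k \/
   ae_in Omega (fun x => 0 < \det (Df x)) \/
   ae_in Omega (fun x => \det (Df x) < 0)) ->
  (* x |-> /\^k df_x has a smooth representative with values in GL *)
  (exists L : 'rV[R]_d -> 'M[R]_#|{: ksubset d k}|,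
     [/\ smooth_mx_on Omega L,
         forall x, Omega x -> L x \in unitmx &
         ae_in Omega (fun x => L x = compound k (Df x))]) ->
  (* k and d are not both even *)
  ~~ (~~ odd k && ~~ odd d) ->
  exists g : 'rV[R]_d -> 'rV[R]_d,
    smooth_vec_on Omega g /\ ae_in Omega (fun x => f x = g x).
Proof.
(* The order becomes k.+1, matching [compound_recover]. *)
case: k => [//|k] d2 oO k2 kd p1 Sf sgn [L [sL Lu aeL]] par.
have kd' : (k.+2 <= d)%N by rewrite -(ltn_predK d2) ltnS.
(* [s] is the constant sign of the Jacobian; for odd order the left disjunct holds and 0 is a
   filler. For even order, parity makes [d] odd. *)
have [s sgns] : exists s : R, odd k.+1 \/ (odd d /\ ae_in Omega (fun x => 0 < s * \det (Df x))).
  have [ok|ek] := boolP (odd k.+1); first by exists 0; left.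
  have od : odd d by move: par; rewrite ek /= negbK.
  case: sgn => [ok|[ap|an]]; first by rewrite ok in ek.
    by exists 1; right; split=> //; apply: ae_in_imp ap => x _; rewrite mul1r.
  by exists (-1); right; split=> //; apply: ae_in_imp an => x _; rewrite mulN1r oppr_gt0.
(* Row [j] of [Df] is the weak gradient of the [j]-th component, so components are treated one by
   one. *)
have comp j : exists g, smooth_on Omega g /\ ae_in Omega (fun x => f x 0 j = g x).
  apply: glue_smooth => // x0 Ox0.
  have [r r0 [rO [G [sG DfG]]]] := local_jacobian kd' oO sL Lu aeL sgns Ox0.
  have nG : \forall x \near x0, forall i, `|G x j i| <= `|G x0 j i| + 1.
    apply: (@filter_forall _ _ _ (nbhs x0)) => i; have [_ c] := sG j i [::] x0 (ballxx _ r0).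
    have /(_ _) := (@cvgrPdist_le _ _ _ (nbhs x0) _ _ _).1 c 1 ltr01.
    apply: filterS => x h; rewrite -lerBlDl; apply: le_trans (lerB_dist _ _) _.
    by rewrite distrC.
  have nV : nbhs x0 (ball x0 r `&` (fun x => forall i, `|G x j i| <= `|G x0 j i| + 1)).
    by apply: filterI => //; exact: nbhsx_ballx.
  have /nbhs_ballP[e /= e0 eV] := nV.
  (* The primitive lives on a ball of half the radius, [local_smooth_primitive] requiring the
     gradient on the doubled ball. *)
  pose r' := e / 2; have r'0 : 0 < r' by rewrite divr_gt0.
  have rr : r' + r' = e by rewrite /r' -splitr.
  have bV x : ball x0 (r' + r') x -> ball x0 r x by rewrite rr => /eV[].
  have VO : ball x0 (r' + r') `<=` Omega by move=> x /bV; exact: rO.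
  exists r' => //; split.
    by move=> x xr; apply: VO; apply: le_ball xr; rewrite lerDl ltW.
  have [Lf Sv] := Sf j.
  (* The sum over [i] of the local bounds is one bound for all the partial derivatives. *)
  apply: (@local_smooth_primitive R d Omega p (fun x => f x 0 j) (fun i x => Df x j i)
    (fun i x => G x j i) x0 r' (\sum_i (`|G x0 j i| + 1))) => //.
  - by move=> i; case: (Sv i).
  - by move=> i; case: (Sv i).
  - by move=> i; apply: ae_in_imp (ae_inS bV DfG) => x _ ->.
  - by move=> i w x /bV; exact: sG.
  move=> i x; rewrite rr => /eV[_ /(_ i)] h; apply: le_trans h _.
  rewrite (bigD1 i)//= lerDl sumr_ge0//.
have [g gP] := choice comp.
exists (fun x => \row_j g j x); split.
  move=> j; have [sg _] := gP j.
  suff -> : (fun x => (\row_j g j x) 0 j) = g j by [].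
  by apply/funext => x; rewrite mxE.
apply: (@ae_in_imp _ _ _ (fun x => forall j, f x 0 j = g j x)).
  by move=> x _ h; apply/rowP => j; rewrite mxE.
by apply: ae_in_all => j; case: (gP j).
Qed.
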